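(* There is an absolute constant $C>0$ such that the following holds. Let $n,M\ge1$ be integers, $\sigma>0$, $1\le r<\infty$, and let $X$ be a realization of the process described in the context, where for some constants $s>0$, $c_*>0$ the eigenfunctions satisfy $\|\varphi_j\|_{s,2}\le c_*$ for all $1\le j\le r$. Put $\lambda_{\max}=\max_{1\le j\le r}\lambda_j$, $L=\lceil e^n\rceil$ and $$\hat\sigma^2=\frac1M\left\|\dot X^{(L+M)}-\dot X^{(L)}\right\|_2^2.$$ Then, for any $t>0$, with probability at least $1-e^{-t}$, $$|\hat\sigma^2-\sigma^2|\le C\max\left\{c_*^2\,r\,\lambda_{\max}L^{-2s}\left(1\vee\sqrt t\vee t\right),\ \sigma^2\sqrt{\frac tM},\ \sigma^2\frac tM\right\}.$$
   Context: Model: $X(t)$, $t\in[0,1]$, satisfies $dX(t)=S(t)\,dt+\sigma\,dW(t)$, where $W$ is standard Brownian motion, $\sigma>0$ is the (unknown) noise level, and $S(t)=\sum_{k=1}^r\sqrt{\lambda_k}\,\xi_k\varphi_k(t)$ with $\xi_k$ i.i.d. standard Gaussian variables independent of $W$, $\{\varphi_k\}_{k=1}^r$ orthonormal in $L_2[0,1]$, $\lambda_k>0$. In the paper, $n$ is the size of an i.i.d. sample $X_1,\dots,X_n$ of such processes and $X$ is a further independent copy, used to estimate $\sigma^2$. Fix an orthonormal basis $e_1,e_2,\dots$ of $L_2[0,1]$. For $l\ge1$, $\dot X^{(l)}=\sum_{k=1}^l\left(\int_0^1e_k(t)\,dX(t)\right)e_k$. $\|\cdot\|_2$ is the norm of $L_2[0,1]$.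 For $\varphi\in L_2[0,1]$, $\|\varphi\|_{s,2}=\left(\sum_{k\ge1}k^{2s}\langle\varphi,e_k\rangle^2\right)^{1/2}$. *)

(* Defs.v *)
From HB Require Import structures.
From mathcomp Require Import all_boot all_order all_algebra.
From mathcomp Require Import all_classical all_reals all_analysis.

Set Implicit Arguments.
Unset Strict Implicit.
Unset Printing Implicit Defensive.
Import Order.TTheory GRing.Theory Num.Theory.
Import numFieldNormedType.Exports.

Local Open Scope classical_set_scope.
Local Open Scope ring_scope.

(* Square-integrable functions on [0,1] are represented by functions on the
   whole line: the restricted measure ignores their values outside [0,1]. *)
Definition leb01 (R : realType) :=
  mrestr (@lebesgue_measure R) (measurable_itv `[0%R, 1%R] : measurable (`[0, 1] : set R)).

Arguments leb01 : clear implicits.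

HB.instance Definition _ (R : realType) := Measure.on (leb01 R).

Lemma leb01_fin (R : realType) : fin_num_fun (leb01 R).
Proof.
move=> U mU; rewrite ge0_fin_numE ?measure_ge0// /leb01 /mrestr.
apply: (@le_lt_trans _ _ (@lebesgue_measure R `[0, 1])).
  by apply: le_measure; rewrite ?inE//=; exact: measurableI.
by rewrite lebesgue_measure_itv/= lte01 oppr0 adde0 ltry.
Qed.

HB.instance Definition _ (R : realType) :=
  Measure_isFinite.Build _ _ _ (leb01 R) (@leb01_fin R).

Section L2.
Variable R : realType.
Implicit Types f g : R -> R.

Definition inL2 f : Prop := f \in Lfun (leb01 R) 2%:E.

Definition ip2 f g : R := \int[leb01 R]_x (f x * g x).

Definition norm2 f : \bar R := 'N[leb01 R]_2%:E[EFin \o f].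

Definition orthonormal_family (I : eqType) (D : set I) (f : I -> R -> R) :=
  (forall i, D i -> inL2 (f i)) /\
  (forall i j, D i -> D j -> ip2 (f i) (f j) = (i == j)%:R).

(* The basis is e 1, e 2, ...; the value e 0 is unused. *)
Definition orthonormal_basis (e : nat -> R -> R) :=
  orthonormal_family [set k | (1 <= k)%N] e /\
  forall f, inL2 f ->
    norm2 (fun x => f x - \sum_(1 <= k < n.+1) ip2 f (e k) * e k x)
      @[n --> \oo] --> 0%E.

Definition smooth_norm (e : nat -> R -> R) (s : R) f : \bar R :=
  ((\sum_(1 <= k <oo) (k%:R `^ (2 * s) * ip2 f (e k) ^+ 2)%:E) `^ 2^-1)%E.

End L2.

Section Independence.
Context d (T : measurableType d) (R : realType) (P : probability T R).

(* Taking B i := setT for some of the i's gives the product rule for all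
   subfamilies. *)
Definition mutually_independent (I : finType) (Y : I -> T -> R) :=
  forall B : I -> set R, (forall i, measurable (B i)) ->
    P (\bigcap_(i in [set: I]) (Y i @^-1` B i)) =
    (\prod_(i : I) P (Y i @^-1` B i))%E.

Definition generated_salgebra (I : Type) (D : set I) (Y : I -> T -> R) :
    set (set T) :=
  <<s \bigcup_(i in D) preimage_set_system [set: T] (Y i) measurable >>.

Definition independent_salgebras (F G : set (set T)) :=
  forall A B, F A -> G B -> P (A `&` B) = (P A * P B)%E.

(* Equality of laws on Borel sets only: on non-measurable sets the two
   set functions carry unrelated values. *)
Definition has_normal_law (Y : T -> R) (m sd : R) :=
  forall B : set R, measurable B -> P (Y @^-1` B) = normal_prob m sd B.

Definition standard_brownian01 (W : R -> {RV P >-> R}) :=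
  [/\ {ae P, forall w, W 0 w = 0},
      forall (m : nat) (t : nat -> R),
        (forall i, 0 <= t i <= 1) -> nondecreasing_seq t ->
        mutually_independent
          (fun (i : 'I_m) (w : T) => W (t i.+1) w - W (t i) w),
      forall u v, 0 <= u -> u < v -> v <= 1 ->
        has_normal_law (fun w => W v w - W u w) 0 (Num.sqrt (v - u))
    & {ae P, forall w,
        {within `[0, 1], continuous (fun t => W t w)}}].

End Independence.

Section StochasticIntegral.
Variable R : realType.

(* The step function \sum_(i < m) a_i 1_(t_i, t_(i+1)] on [0,1]. *)
Record step01 := Step01 {
  step_size : nat;
  step_val : nat -> R;
  step_node : nat -> R;
  step_node01 : forall i, 0 <= step_node i <= 1;
  step_node_nd : nondecreasing_seq step_node }.

Definition step_fun (h : step01) (x : R) : R :=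
  \sum_(i < step_size h)
    step_val h i * \1_(`]step_node h i, step_node h i.+1]) x.

Definition step_integral (T : Type) (X : R -> T -> R) (h : step01) (w : T) : R :=
  \sum_(i < step_size h)
    step_val h i * (X (step_node h i.+1) w - X (step_node h i) w).

Definition cvg_in_probability d (T : measurableType d) (P : probability T R)
    (U : nat -> T -> R) (V : T -> R) :=
  forall eps : R, 0 < eps ->
    P [set w | eps <= `|U n w - V w|] @[n --> \oo] --> 0%E.

(* J is (a version of) \int_0^1 f(t) dX(t) for a deterministic f in L2[0,1]:
   the limit in probability of the integrals of step functions tending to f
   in L2[0,1]. *)
Definition is_stochastic_integral d (T : measurableType d)
    (P : probability T R) (X : R -> T -> R) (f : R -> R) (J : T -> R) :=
  exists h : nat -> step01,
    norm2 (fun x => step_fun (h n) x - f x) @[n --> \oo] --> 0%E /\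
    cvg_in_probability P (fun n => step_integral X (h n)) J.

End StochasticIntegral.

Section Model.
Variables (R : realType) (T : Type).

Definition signal (r : nat) (lambda : 'I_r -> R) (xi : 'I_r -> T -> R)
    (phi : 'I_r -> R -> R) (w : T) (t : R) : R :=
  \sum_(k < r) Num.sqrt (lambda k) * xi k w * phi k t.

(* With Z k = \int_0^1 e_k dX, this is the projection \dot X^{(l)}. *)
Definition dotX (e : nat -> R -> R) (Z : nat -> T -> R) (l : nat)
    (w : T) (x : R) : R :=
  \sum_(1 <= k < l.+1) Z k w * e k x.

Definition sigma2_hat (e : nat -> R -> R) (Z : nat -> T -> R) (L M : nat)
    (w : T) : R :=
  M%:R^-1 * fine (norm2 (fun x => dotX e Z (L + M) w x - dotX e Z L w x)) ^+ 2.

Definition ceil_exp (n : nat) : nat := `|Num.ceil (expR n%:R : R)|%N.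

End Model.

Arguments ceil_exp : clear implicits.

(* Main.v *)
Require Import Defs.
From HB Require Import structures.
From mathcomp Require Import all_boot all_order all_algebra.
From mathcomp Require Import all_classical all_reals all_analysis.
From mathcomp Require Import measurable_realfun.
From mathcomp Require Import ring lra.
Import Order.TTheory GRing.Theory Num.Theory.
Import numFieldNormedType.Exports.
Local Open Scope classical_set_scope.
Local Open Scope ring_scope.
Set Implicit Arguments.
Unset Strict Implicit.
Unset Printing Implicit Defensive.

(** The estimator only involves the coefficients Z_k = \int e_k dX with
    L < k <= L + M: by orthonormality it is the mean of their squares
    (sigma2_hatE). Each Z_k is the sum of a bias, the k-th coefficient of the
    signal, and of sigma times the Wiener integral of e_k. The Wiener integrals
    are independent standard Gaussian variables, independent of the signal.
    Hence sigma2_hat / sigma ^ 2 has the law of S / M with S = |b + Y| ^ 2,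
    where Y is a standard Gaussian vector of R ^ M and the bias b is a Gaussian
    vector independent of Y. Smoothness makes the coefficients of the
    eigenfunctions beyond L small (smooth_tail), so that the variances of the
    coordinates of b add up to at most
    V = c ^ 2 r lambda_max L ^ (- 2 s) / sigma ^ 2. What remains is the bound
    |S / M - 1| <= C max (V max (1, sqrt t, t), sqrt (t / M), t / M) with
    probability at least 1 - exp (- t), for every t > 0 (model_bound).

    Two different arguments are needed for it. If t or V is bounded below, the
    bound is a concentration inequality (model_concentration): exponential
    moments control the chi-square part, the cross term and |b| ^ 2, up to a
    factor 6 in the probability, which is absorbed by applying them at t + 5. If
    t and V are both small, the allowed deviation can be much smaller than the
    standard deviation of S / M, and no tail bound is of any help; but the
    required probability is then at most t, and a lower bound on the probability
    that S lies in the segment [M, M + K sqrt (t M)] is enough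
    (model_small_ball). It comes from two properties of the chi-square law: it
    has a fixed amount of mass above its mean (chi_mass_above_mean), and a set
    beyond the mean loses mass when it is dilated (chi_dilate), so that among
    the segments of equal length that cover the bulk of this mass the first is
    the heaviest.

    Everything about Gaussian vectors is drawn from the invariance of the
    two-dimensional Gaussian law under rotations (gauss_rot). It gives, for each
    vector, an isometry that moves this vector to the first axis and keeps
    standard Gaussian vectors standard Gaussian (align); the law of |b + Y| ^ 2
    for fixed b then depends on |b| only. Freezing b is legitimate because two
    independent sigma-algebras behave like the two coordinates of a product
    space (independent_product).

    The same isometries replace the theory of Wiener integrals. Each Z_k is a
    limit in probability of integrals of step functions. On a common grid these
    are linear combinations of the normalized increments of W, which are
    independent standard Gaussian variables, with coefficient vectors that are
    almost orthonormal. Aligning these vectors one after the other produces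
    exactly independent standard Gaussian variables close to the given
    combinations (near_orthonormal). Hence Z_k is as close as desired, in
    probability, to a variable of the exact Gaussian model (gaussian_approx).
    The bound for that model passes to the Z_k: the error of the approximation
    costs a factor 2 in the constant and an arbitrarily small probability. *)

(** * Measurability and integrals of nonnegative real functions *)

Section MeasurableSets.
Variable R : realType.

Lemma measurable_affine (a b : R) : measurable_fun [set: R] (fun x => a * x + b).
Proof. by apply: measurable_funD => //; exact: measurable_funM. Qed.

Lemma measurable_seg (x y : R) : measurable [set u : R | x <= u <= y].
Proof.
rewrite (_ : [set u | _] = `[x, y]%classic); first exact: measurable_itv.
by apply/seteqP; split => u /=; rewrite in_itv.
Qed.

Lemma measurable_ray (x : R) : measurable [set u : R | x <= u].
Proof.
rewrite (_ : [set u | _] = `[x, +oo[%classic); first exact: measurable_itv.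
by apply/seteqP; split => u /=; rewrite in_itv/= andbT.
Qed.

Section Levels.
Context d (T : measurableType d) (f : T -> R).
Hypothesis mf : measurable_fun setT f.

Lemma measurable_preim (A : set R) : measurable A -> measurable [set x | A (f x)].
Proof. by move=> mA; rewrite -[X in measurable X]setTI; exact: mf. Qed.

Lemma measurable_sublevel y : measurable [set x | f x <= y].
Proof.
rewrite -[X in measurable X]setTI; apply: measurable_fun_le => //.
Qed.

Lemma measurable_superlevel y : measurable [set x | y < f x].
Proof.
rewrite (_ : [set x | _] = ~` [set x | f x <= y]).
  exact/measurableC/measurable_sublevel.
by apply/seteqP; split => x /=; rewrite ltNge => /negP.
Qed.

End Levels.
End MeasurableSets.

Section NonnegativeIntegrals.
Context d (T : measurableType d) (R : realType) (mu : {measure set T -> \bar R}).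
Implicit Types f g : T -> R.

Lemma ge0_EFin_integralD f g : measurable_fun setT f -> measurable_fun setT g ->
  (forall x, 0 <= f x) -> (forall x, 0 <= g x) ->
  (\int[mu]_x (f x + g x)%:E = \int[mu]_x (f x)%:E + \int[mu]_x (g x)%:E)%E.
Proof.
move=> mf mg f0 g0.
have f0' x : setT x -> (0 <= (f x)%:E)%E by rewrite lee_fin.
have g0' x : setT x -> (0 <= (g x)%:E)%E by rewrite lee_fin.
have mf' : measurable_fun setT (fun x => (f x)%:E) by exact/measurable_EFinP.
have mg' : measurable_fun setT (fun x => (g x)%:E) by exact/measurable_EFinP.
exact: (@ge0_integralD _ _ _ mu setT measurableT _ _ f0' mf' g0' mg').
Qed.

Lemma ge0_EFin_integralZl f (k : R) : measurable_fun setT f -> (forall x, 0 <= f x) -> 0 <= k ->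
  (\int[mu]_x (k * f x)%:E = k%:E * \int[mu]_x (f x)%:E)%E.
Proof.
move=> mf f0 k0.
have f0' x : setT x -> (0 <= (f x)%:E)%E by rewrite lee_fin.
have mf' : measurable_fun setT (fun x => (f x)%:E) by exact/measurable_EFinP.
have k0' : (0 <= k%:E)%E by rewrite lee_fin.
exact: (@ge0_integralZl _ _ _ mu setT measurableT _ mf' _ f0' k0').
Qed.

Lemma ge0_EFin_integral_le f g : measurable_fun setT f -> measurable_fun setT g ->
  (forall x, 0 <= f x) -> (forall x, f x <= g x) ->
  (\int[mu]_x (f x)%:E <= \int[mu]_x (g x)%:E)%E.
Proof.
move=> mf mg f0 fg.
have f0' x : setT x -> (0 <= (f x)%:E)%E by rewrite lee_fin.
have mf' : measurable_fun setT (fun x => (f x)%:E) by exact/measurable_EFinP.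
have mg' : measurable_fun setT (fun x => (g x)%:E) by exact/measurable_EFinP.
by apply: (ge0_le_integral mu measurableT f0' mf' mg') => x _; rewrite lee_fin.
Qed.

Lemma integral_indicT A : measurable A -> (\int[mu]_x (\1_A x : R)%:E = mu A)%E.
Proof. by move=> mA; rewrite integral_indic// setIT. Qed.

Lemma measure_le_integral A f : measurable A -> measurable_fun setT f ->
  (forall x, 0 <= f x) -> (forall x, A x -> 1 <= f x) ->
  (mu A <= \int[mu]_x (f x)%:E)%E.
Proof.
move=> mA mf f0 fA; rewrite -integral_indicT//.
have mi : measurable_fun setT (\1_A : T -> R) by exact: measurable_indic.
apply: (ge0_EFin_integral_le mi mf) => // x.
by rewrite indicE; case: (boolP (x \in A)) => // xA; apply: fA; rewrite inE in xA.
Qed.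

End NonnegativeIntegrals.

(** * The standard Gaussian law on the line *)

Section RealLineMeasures.
Variable R : realType.

(** The identity from measurableTypeR R, on which normal_prob and
    lebesgue_measure are defined, to R with its canonical measurable structure,
    in which random variables take their values. The two copies gauss and leb
    below are transported along it. *)
Definition borel_id : measurableTypeR R -> R := idfun.

Lemma measurable_borel_id : measurable_fun setT borel_id.
Proof. exact: measurable_id. Qed.

HB.instance Definition _ :=
  @isMeasurableFun.Build _ _ _ _ borel_id measurable_borel_id.

Definition gauss : probability R R :=
  distribution (normal_prob (0 : R) 1 : probability (measurableTypeR R) R)
    borel_id.

Definition leb : set R -> \bar R := pushforward (@lebesgue_measure R) borel_id.

Let leb0 : leb set0 = 0%E.
Proof. exact: (@measure0 _ _ _ (@lebesgue_measure R)). Qed.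

Let leb_ge0 A : (0 <= leb A)%E.
Proof. exact: (@measure_ge0 _ _ _ (@lebesgue_measure R)). Qed.

Let leb_additive : semi_sigma_additive leb.
Proof. exact: (@measure_semi_sigma_additive _ _ _ (@lebesgue_measure R)). Qed.

HB.instance Definition _ :=
  isMeasure.Build _ _ _ leb leb0 leb_ge0 leb_additive.

Let leb_sigma_finite : sigma_finite setT leb.
Proof. exact: (@sigma_finiteT _ _ _ (@lebesgue_measure R)). Qed.

HB.instance Definition _ := Measure_isSigmaFinite.Build _ _ _ leb leb_sigma_finite.

Lemma gaussE A : gauss A = normal_prob 0 1 A.
Proof. by []. Qed.

Lemma lebE A : leb A = lebesgue_measure A.
Proof. by []. Qed.

Lemma ge0_integral_leb (f : R -> \bar R) :
  measurable_fun setT f -> (forall x, 0 <= f x)%E ->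
  (\int[leb]_x f x = \int[lebesgue_measure]_x f x)%E.
Proof.
move=> mf f0.
exact: (@ge0_integral_pushforward _ _ _ _ _ borel_id measurable_borel_id
  lebesgue_measure setT f).
Qed.

Definition gpdf (x : R) : R := normal_pdf 0 1 x.

Lemma measurable_gpdf : measurable_fun setT gpdf.
Proof. exact: measurable_normal_pdf. Qed.

Lemma gpdf_ge0 x : 0 <= gpdf x.
Proof. exact: normal_pdf_ge0. Qed.

Lemma gaussE_leb A : measurable A -> gauss A = (\int[leb]_(x in A) (gpdf x)%:E)%E.
Proof.
move=> mA; rewrite gaussE /normal_prob.
rewrite (@ge0_integral_pushforward _ _ _ _ _ borel_id measurable_borel_id
  lebesgue_measure A (EFin \o gpdf))//.
  by apply/measurable_EFinP/measurable_funTS; exact: measurable_gpdf.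
by move=> x _ /=; rewrite lee_fin gpdf_ge0.
Qed.

Import HBNNSimple.
(** The Gaussian law is given by its density on sets; monotone convergence of
    simple functions extends this to integrals. *)
Lemma ge0_integral_gauss (f : R -> \bar R) :
  measurable_fun setT f -> (forall x, 0 <= f x)%E ->
  (\int[gauss]_x f x = \int[leb]_x (f x * (gpdf x)%:E))%E.
Proof.
move=> mf f0.
have p0 x : (0 <= (gpdf x : R)%:E)%E by rewrite lee_fin gpdf_ge0.
have mp : measurable_fun setT (fun x : R => (gpdf x)%:E).
  by apply/measurable_EFinP; exact: measurable_gpdf.
pose h := nnsfun_approx measurableT mf.
have hf x : (EFin \o h ^~ x) @ \oo --> f x.
  by apply: cvg_nnsfun_approx.
have ndh x m n : (m <= n)%N -> h m x <= h n x.
  by move=> mn; exact/lefP/nd_nnsfun_approx.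
transitivity (limn (fun n => \int[gauss]_x (h n x)%:E)%E).
  rewrite -monotone_convergence//.
  - by apply: eq_integral => x _; apply/esym/cvg_lim => //; exact: hf.
  - by move=> n; exact/measurable_EFinP.
  - by move=> n x _; rewrite lee_fin.
  - by move=> x _ m n mn; rewrite lee_fin ndh.
transitivity (limn (fun n =>
    \int[leb]_x ((h n x)%:E * (gpdf x)%:E))%E); last first.
  rewrite -monotone_convergence//.
  - apply: eq_integral => x _; apply/cvg_lim => //; apply: cvgeZr => //.
    exact: hf.
  - by move=> n; apply: emeasurable_funM => //; exact/measurable_EFinP.
  - by move=> n x _; rewrite mule_ge0// lee_fin.
  - by move=> x _ m n mn; rewrite lee_wpmul2r// lee_fin ndh.
congr (limn _); apply/funext => n.
rewrite integralT_nnsfun sintegralE.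
transitivity (\int[leb]_x
    (\sum_(y \in range (h n)) (y * \1_(h n @^-1` [set y]) x)%:E * (gpdf x)%:E))%E; last first.
  apply: eq_integral => x _.
  rewrite -ge0_mule_fsuml => [|y]; last exact: nnfun_muleindic_ge0.
  by rewrite fsumEFin // -(fimfunE _ x).
rewrite ge0_integral_fsum//; last 2 first.
- move=> y; apply: emeasurable_funM => //.
  by apply/measurable_EFinP; exact: measurable_funM.
- by move=> y x _; rewrite mule_ge0// nnfun_muleindic_ge0.
apply: eq_fsbigr => r rh.
under eq_integral do rewrite EFinM -muleA.
rewrite ge0_integralZl//.
- congr (_ * _)%E.
  rewrite [LHS](gaussE_leb (A := h n @^-1` [set r]))// [LHS]integral_mkcond; apply: eq_integral => x _.
  by rewrite epatch_indic muleC.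
- by apply: emeasurable_funM => //; exact/measurable_EFinP.
- by move=> x _; rewrite mule_ge0// lee_fin.
- by move: rh; rewrite inE => -[t _ <-]; rewrite lee_fin.
Qed.

(** Both sides are measures, so uniqueness of Lebesgue measure reduces the claim
    to half-open intervals; the sign of the slope decides which end of an
    interval stays open, which Lebesgue measure does not see. *)
Lemma leb_affine (a b : R) : a != 0 -> forall A, measurable A ->
  leb A = (`|a|%:E * leb ((fun x => a * x + b)%R @^-1` A))%E.
Proof.
move=> a0 A mA.
have ap : 0 < `|a| by rewrite normr_gt0.
have maff : measurable_fun [set: measurableTypeR R] (fun x => a * x + b : measurableTypeR R).
  apply: (@measurable_funD _ (measurableTypeR R) R setT (fun x => a * x) (fun=> b)) => //.
  by apply: (@measurable_funM _ (measurableTypeR R) R setT (fun=> a) id).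
suff H : forall X, ocitv X -> lebesgue_measure X =
    (`|a|%:E * lebesgue_measure ((fun x => a * x + b)%R @^-1` X))%E.
  unshelve refine (@lebesgue_measure_unique R (mscale (NngNum (ltW ap))
    (pushforward lebesgue_measure (fun x => a * x + b : measurableTypeR R))) H A mA).
  exact: maff.
move=> _ [[u v] _ <-].
have -> : (fun x => a * x + b) @^-1` `]u, v]%classic =
   if 0 < a then `](u - b) / a, (v - b) / a]%classic
   else `[(v - b) / a, (u - b) / a[%classic.
  case: ifPn => [a1|]; last first.
    rewrite -leNgt le_eqVlt (negbTE a0)/= => a1.
    apply/seteqP; split => x /=; rewrite !in_itv/= ler_ndivrMr// ltr_ndivlMr// => /andP[? ?]; apply/andP; split; lra.
  by apply/seteqP; split => x /=; rewrite !in_itv/= ltr_pdivrMr// ler_pdivlMr// => /andP[? ?]; apply/andP; split; lra.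
case: ifPn => [a1|].
  rewrite !lebesgue_measure_itv/= !lte_fin ltr_pM2r ?invr_gt0// ltrD2r.
  case: ifP => _; last by rewrite mule0.
  by rewrite -?EFinN -?EFinD -?EFinM gtr0_norm//; congr (_%:E); field.
rewrite -leNgt le_eqVlt (negbTE a0)/= => a1.
rewrite !lebesgue_measure_itv/= !lte_fin ltr_nM2r ?invr_lt0// ltrD2r.
case: ifP => _; last by rewrite mule0.
by rewrite -?EFinN -?EFinD -?EFinM ltr0_norm//; congr (_%:E); field.
Qed.

Lemma ge0_integral_affine (a b : R) (f : R -> \bar R) : a != 0 ->
  measurable_fun setT f -> (forall x, 0 <= f x)%E ->
  (\int[leb]_x f x = `|a|%:E * \int[leb]_x f (a * x + b)%R)%E.
Proof.
move=> a0 mf f0.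
have ap : 0 < `|a| by rewrite normr_gt0.
have maff : measurable_fun [set: R] (fun x => a * x + b).
  by apply: measurable_funD => //; exact: measurable_funM.
unshelve refine (etrans (@eq_measure_integral _ _ _ setT
  (mscale (NngNum (ltW ap)) (pushforward leb (fun x => a * x + b))) leb f _) _) => //.
  by move=> A mA _; exact: leb_affine.
rewrite ge0_integral_mscale//=; congr (_ * _)%E.
exact: (ge0_integral_pushforward maff).
Qed.

Lemma gpdfE x : gpdf x = gpdf 0 * expR (- x ^+ 2 / 2).
Proof.
rewrite /gpdf /normal_pdf oner_eq0 /normal_fun !subr0.
by rewrite expr0n/= oppr0 mul0r expR0 mulr1 expr1n.
Qed.

Lemma gpdf_gt0 x : 0 < gpdf x.
Proof.
rewrite gpdfE mulr_gt0 ?expR_gt0// /gpdf /normal_pdf oner_eq0.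
by rewrite mulr_gt0 ?normal_peak_gt0 ?oner_eq0// expR_gt0.
Qed.

(** The factor on the right is the density of the law of a X relative to the law
    of X, for X standard Gaussian. All moment generating functions below come
    from this identity applied to a constant f. *)
Lemma gauss_scale (a : R) (f : R -> \bar R) : a != 0 ->
  measurable_fun setT f -> (forall x, 0 <= f x)%E ->
  (\int[gauss]_x f (a * x)%R =
   \int[gauss]_x (f x * (`|a|^-1 * expR ((1 - a ^- 2) * x ^+ 2 / 2))%:E))%E.
Proof.
move=> a0 mf f0.
have ap : 0 < `|a| by rewrite normr_gt0.
have mexp : measurable_fun [set: R] (fun x : R => expR ((1 - a ^- 2) * x ^+ 2 / 2)).
  apply: measurableT_comp => //; apply: measurable_funM => //.
  by apply: measurable_funM => //; exact: measurable_funX.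
have ma : measurable_fun [set: R] (fun x : R => a * x) by exact: measurable_funM.
have mg : measurable_fun setT
    (fun x => f x * (`|a|^-1 * expR ((1 - a ^- 2) * x ^+ 2 / 2))%:E)%E.
  by apply: emeasurable_funM => //; apply/measurable_EFinP; exact: measurable_funM.
have mgp : measurable_fun setT (fun x => f x *
    (`|a|^-1 * expR ((1 - a ^- 2) * x ^+ 2 / 2))%:E * (gpdf x)%:E)%E.
  by apply: emeasurable_funM => //; apply/measurable_EFinP; exact: measurable_gpdf.
have g0 x : (0 <= f x * (`|a|^-1 * expR ((1 - a ^- 2) * x ^+ 2 / 2))%:E)%E.
  by rewrite mule_ge0// lee_fin mulr_ge0 ?expR_ge0// invr_ge0 ltW.
have gp0 x : (0 <= f x * (`|a|^-1 * expR ((1 - a ^- 2) * x ^+ 2 / 2))%:E * (gpdf x)%:E)%E.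
  by rewrite mule_ge0// lee_fin gpdf_ge0.
rewrite ge0_integral_gauss//; last exact: measurableT_comp ma.
rewrite [RHS]ge0_integral_gauss// [RHS](@ge0_integral_affine a 0)//.
rewrite -ge0_integralZl//; last first.
  rewrite (_ : (fun x => _) = (fun x => f x * (`|a|^-1 * expR ((1 - a ^- 2) * x ^+ 2 / 2))%:E * (gpdf x)%:E)%E \o (fun x => a * x)); last first.
    by apply/funext => x /=; rewrite addr0.
  exact: measurableT_comp.
apply: eq_integral => x _; rewrite addr0.
rewrite -muleA -EFinM muleCA -EFinM; congr (_ * _%:E)%E.
rewrite [gpdf (a * x)]gpdfE [gpdf x]gpdfE.
rewrite (_ : - x ^+ 2 / 2 = (1 - a ^- 2) * (a * x) ^+ 2 / 2 + (- (a * x) ^+ 2 / 2)).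
  by rewrite expRD; field; rewrite gt_eqF.
by field.
Qed.

Lemma gaussN (A : set R) : measurable A -> gauss [set x | A (- x)] = gauss A.
Proof.
move=> mA.
have mNA : measurable [set x | A (- x)].
  by rewrite -[X in measurable X]setTI; exact: oppr_measurable.
have mi : measurable_fun setT (fun x : R => (\1_A x)%:E : \bar R).
  by apply/measurable_EFinP; exact: measurable_indic.
have i0 (x : R) : (0 <= (\1_A x)%:E :> \bar R)%E by rewrite lee_fin.
have N0 : -1 != 0 :> R by rewrite oppr_eq0 oner_eq0.
have := gauss_scale N0 mi i0.
move=> H.
have <- : (\int[gauss]_x (\1_A x)%:E = gauss A)%E by rewrite integral_indic// setIT.
transitivity (\int[gauss]_x (\1_A (-1 * x)%R)%:E)%E.
  pose B := [set x | A (- x)].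
  have <- : (\int[gauss]_x (\1_B x)%:E = gauss B)%E.
    by rewrite integral_indic// setIT.
  apply: eq_integral => x _.
  rewrite mulN1r !indicE; suff -> : (x \in B) = (- x \in A) by [].
  by apply/idP/idP; rewrite !inE.
rewrite H; apply: eq_integral => x _.
by rewrite normrN1 sqrrN expr1n invr1 subrr !mul0r expR0 mulr1 mule1.
Qed.

End RealLineMeasures.

(** * Rotation invariance in the plane *)

Section PlaneRotation.
Variable R : realType.
Local Notation gauss := (gauss R).
Local Notation leb := (@leb R).

(** The joint density depends on x ^ 2 + y ^ 2 only, and a rotation preserves
    area. The rotation is split into the shear that replaces y by
    u = c x + s y at fixed x and the one that replaces x at fixed u, so that
    affine substitutions on the line and an exchange of integrals suffice.
    Solving for y is where s must not vanish. *)
Lemma gauss_rot (c s : R) (f : R * R -> \bar R) : s != 0 -> c ^+ 2 + s ^+ 2 = 1 ->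
  measurable_fun setT f -> (forall x, 0 <= f x)%E ->
  (\int[gauss]_x \int[gauss]_y f (c * x + s * y, - s * x + c * y)%R =
   \int[gauss]_x \int[gauss]_y f (x, y))%E.
Proof.
move=> s0 cs mf f0.
have as0 : 0 < `|s| by rewrite normr_gt0.
have mrot : measurable_fun [set: R * R] (fun z => (c * z.1 + s * z.2, - s * z.1 + c * z.2)).
  by apply: measurable_fun_pair; apply: measurable_funD; apply: measurable_funM.
have mfr : measurable_fun [set: R * R] (fun z => f (c * z.1 + s * z.2, - s * z.1 + c * z.2)).
  exact: (measurableT_comp mf mrot).
(* the integrand of the double integral against Lebesgue measure after the
   substitution u = c x + s y in the second variable *)
pose G := fun z : R * R => (`|s|^-1%:E * (f (z.2, (c * z.2 - z.1) / s)%R *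
   (gpdf ((z.2 - c * z.1) / s)%R)%:E * (gpdf z.1)%:E))%E.
have mG : measurable_fun setT G.
  apply: emeasurable_funM => //; apply: emeasurable_funM; last first.
    by apply/measurable_EFinP; apply: (measurableT_comp (@measurable_gpdf R)).
  apply: emeasurable_funM.
    apply: (measurableT_comp mf); apply: measurable_fun_pair => //.
    apply: measurable_funM => //; apply: measurable_funB => //.
    exact: measurable_funM.
  apply/measurable_EFinP; apply: (measurableT_comp (@measurable_gpdf R)).
  apply: measurable_funM => //; apply: measurable_funB => //.
  exact: measurable_funM.
have G0 z : (0 <= G z)%E.
  by rewrite !mule_ge0// lee_fin ?gpdf_ge0// invr_ge0 ltW.
transitivity (\int[leb]_x \int[leb]_u G (x, u))%E.
  rewrite ge0_integral_gauss//; first last.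
  - by move=> x; exact: integral_ge0.
  - exact: (@measurable_fun_fubini_tonelli_F _ _ _ _ _ gauss _ mfr).
  apply: eq_integral => x _.
  have mfx : measurable_fun [set: R] (fun y => f (c * x + s * y, - s * x + c * y)).
    exact: (measurableT_comp mfr (pair1_measurable x)).
  rewrite ge0_integral_gauss// -ge0_integralZr//; first last.
  - by rewrite lee_fin gpdf_ge0.
  - by move=> y _; rewrite mule_ge0// lee_fin gpdf_ge0.
  - by apply: emeasurable_funM => //; apply/measurable_EFinP; exact: measurable_gpdf.
  have mGx : measurable_fun [set: R] (fun u => G (x, u)).
    exact: (measurableT_comp mG (pair1_measurable x)).
  rewrite [RHS](ge0_integral_affine (c * x) s0 mGx (fun=> G0 _)).
  rewrite -[RHS]ge0_integralZl//; last first.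
    exact: (measurableT_comp mGx (measurable_affine _ _)).
  apply: eq_integral => y _; rewrite /G /= muleA -EFinM divff ?gt_eqF// mul1e.
  rewrite addrK; congr (f (_, _) * (gpdf _)%:E * _)%E.
  - by rewrite addrC.
  - apply: (mulfI s0); rewrite mulrCA divff// mulr1.
    have cs' : c ^+ 2 = 1 - s ^+ 2 by rewrite -cs addrK.
    transitivity (s * (c * y) + x * (c ^+ 2 - 1)); last by ring.
    by rewrite cs'; ring.
  - by field.
transitivity (\int[leb]_u \int[leb]_x G (x, u))%E.
  exact: (@fubini_tonelli _ _ _ _ _ leb leb G mG G0).
have mF : measurable_fun setT (fun x => \int[gauss]_y f (x, y))%E.
  have := @measurable_fun_fubini_tonelli_F _ _ _ _ _ gauss f mf f0.
  exact.
rewrite [RHS]ge0_integral_gauss//; last first.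
  by move=> x; apply: integral_ge0.
apply: eq_integral => u _.
have mfu : measurable_fun [set: R] (fun y => f (u, y)).
  exact: (measurableT_comp mf (pair1_measurable u)).
rewrite ge0_integral_gauss// -ge0_integralZr//; first last.
- by rewrite lee_fin gpdf_ge0.
- by move=> y _; rewrite mule_ge0// lee_fin gpdf_ge0.
- by apply: emeasurable_funM => //; apply/measurable_EFinP; exact: measurable_gpdf.
have mk : measurable_fun [set: R] (fun v => f (u, v) * (gpdf v)%:E * (gpdf u)%:E)%E.
  by apply: emeasurable_funM => //; apply: emeasurable_funM => //; apply/measurable_EFinP; exact: measurable_gpdf.
have k0 v : (0 <= f (u, v) * (gpdf v)%:E * (gpdf u)%:E)%E.
  by rewrite !mule_ge0// lee_fin gpdf_ge0.
have sN : - s^-1 != 0 by rewrite oppr_eq0 invr_eq0.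
rewrite [RHS](ge0_integral_affine (c * u / s) sN mk k0).
have mk' := measurableT_comp mk (measurable_affine (- s^-1) (c * u / s)).
have n0 : (0 <= (`|- s^-1|%:E : \bar R))%E by rewrite lee_fin.
rewrite -(@ge0_integralZl _ _ _ leb _ measurableT _ mk' _ (fun x _ => k0 _) n0).
apply: eq_integral => x _; rewrite /G /= normrN normfV; congr (_ * _)%E.
have -> : - s^-1 * x + c * u / s = (c * u - x) / s by ring.
rewrite -!muleA -!EFinM; congr (_ * _%:E)%E.
rewrite [gpdf ((u - _) / _)]gpdfE [gpdf x]gpdfE [gpdf u]gpdfE [gpdf ((c * u - _) / _)]gpdfE.
rewrite mulrACA [RHS]mulrACA -!expRD; congr (_ * expR _).
apply: (mulfI (_ : 2 * s ^+ 2 != 0)); first by rewrite mulf_neq0// expf_neq0.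
transitivity (- ((u - c * x) ^+ 2 + s ^+ 2 * x ^+ 2)); first by field.
transitivity (- (s ^+ 2 * u ^+ 2 + (c * u - x) ^+ 2)); last by field.
have -> : s ^+ 2 = 1 - c ^+ 2 by rewrite -cs addrC addKr.
by ring.
Qed.

End PlaneRotation.

(** * Independent Gaussian sequences *)

Section PairLaw.
Context d d1 d2 (T : measurableType d) (T1 : measurableType d1)
  (T2 : measurableType d2) (R : realType) (P : probability T R).

(** Product measures are determined by rectangles. The event E, a condition on
    other variables, is carried along so that the lemma can be used inside an
    induction over coordinates. *)
Lemma pair_law (E : set T) (U : T -> T1) (V : T -> T2)
    (m1 : probability T1 R) (m2 : probability T2 R) :
  measurable E -> measurable_fun setT U -> measurable_fun setT V ->
  (forall A B, measurable A -> measurable B ->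
    P (E `&` (U @^-1` A `&` V @^-1` B)) = (P E * (m1 A * m2 B))%E) ->
  forall F : set (T1 * T2), measurable F ->
    P (E `&` [set w | F (U w, V w)]) = (P E * (m1 \x m2) F)%E.
Proof.
move=> mE mU mV boxes F mF.
have mpair : measurable_fun setT (fun w => (U w, V w)).
  exact: measurable_fun_pair.
have mpre : measurable [set w | F (U w, V w)].
  by rewrite -[X in measurable X]setTI; exact: mpair.
have PE : P E = (fine (P E))%:E by rewrite fineK// fin_num_measure.
have [PE0|PEn0] := eqVneq (P E) 0%E.
  rewrite PE0 mul0e; apply/eqP; rewrite eq_le measure_ge0 andbT -PE0.
  by apply: le_measure; rewrite ?inE//; exact: measurableI.
have e0 : 0 < fine (P E) by rewrite fine_gt0// lt0e PEn0 measure_ge0 -ge0_fin_numE// fin_num_measure.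
have ei0 : 0 <= (fine (P E))^-1 by rewrite invr_ge0 ltW.
suff -> : (m1 \x m2)%E F = ((fine (P E))^-1%:E * P (E `&` [set w | F (U w, V w)]))%E.
  rewrite [in RHS]PE muleA -EFinM divff ?gt_eqF// mul1e//.
unshelve refine (etrans (@product_measure_unique _ _ _ _ _ m1 m2
  (mscale (NngNum ei0) (pushforward (mrestr P mE) (fun w => (U w, V w)))) _ F mF) _).
- exact: mpair.
- move=> A B mA mB; rewrite /mscale /pushforward /mrestr /=.
  transitivity ((fine (P E))^-1%:E * P (E `&` (U @^-1` A `&` V @^-1` B)))%E.
    by congr (_ * P _)%E; apply/seteqP; split => w /=; tauto.
  by rewrite boxes// [in X in (_ * X)%E]PE muleA -EFinM mulVf ?gt_eqF// mul1e.
- rewrite /mscale /pushforward /mrestr /=.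
  by congr (_ * P _)%E; apply/seteqP; split => w /=; tauto.
Qed.

Lemma product_measure_indic (m1 : probability T1 R) (m2 : probability T2 R)
    (F : set (T1 * T2)) : measurable F ->
  ((m1 \x m2) F = \int[m1]_x \int[m2]_y (\1_F (x, y))%:E)%E.
Proof.
move=> mF; rewrite -(@fubini_tonelli1 _ _ _ _ _ m1 m2 (EFin \o \1_F))//.
- by rewrite integral_indic// setIT.
- by apply/measurable_EFinP; exact: measurable_indic.
- by move=> z; rewrite /= lee_fin.
Qed.

End PairLaw.

Section Sequences.
Variable R : realType.
Implicit Types x y v : nat -> R.

Definition shift x : nat -> R := fun i => x i.+1.
Definition scons (a : R) x : nat -> R := fun i => if i is j.+1 then x j else a.

Definition dot n x y : R := \sum_(i < n) x i * y i.

Lemma dotS n x y : dot n.+1 x y = x 0%N * y 0%N + dot n (shift x) (shift y).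
Proof. by rewrite /dot big_ord_recl. Qed.

Lemma dot_ge0 n x : 0 <= dot n x x.
Proof. by apply: sumr_ge0 => i _; rewrite -expr2 sqr_ge0. Qed.

End Sequences.

Section Iid.
Context d (T : measurableType d) (R : realType) (P : probability T R).
Local Notation gauss := (gauss R).

Fixpoint box n (Y : nat -> T -> R) (B : nat -> set R) : set T :=
  if n is m.+1 then
    Y 0%N @^-1` B 0%N `&` box m (fun i => Y i.+1) (fun i => B i.+1)
  else setT.

Fixpoint gauss_box n (B : nat -> set R) : \bar R :=
  if n is m.+1 then (gauss (B 0%N) * gauss_box m (fun i => B i.+1))%E else 1%E.

(** The first n terms of Y are independent standard Gaussian variables, jointly
    independent of the event E. The event makes inductions on n go through: a
    condition on the first term is absorbed into E before the remaining terms
    are treated. All terms are required to be measurable, also those from n on,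
    so that linear images of Y need no side conditions. *)
Definition iid (E : set T) n (Y : nat -> T -> R) :=
  [/\ measurable E, forall i, measurable_fun setT (Y i) &
   forall B : nat -> set R, (forall i, measurable (B i)) ->
     P (E `&` box n Y B) = (P E * gauss_box n B)%E].

Lemma measurable_box n Y B : (forall i, measurable_fun setT (Y i)) ->
  (forall i, measurable (B i)) -> measurable (box n Y B).
Proof.
elim: n Y B => [|n IH] Y B mY mB //=.
apply: measurableI; last exact: IH.
by rewrite -[X in measurable X]setTI; exact: mY.
Qed.

Lemma iid_head E n Y : iid E n.+1 Y -> forall B, measurable B ->
  P (E `&` Y 0%N @^-1` B) = (P E * gauss B)%E.
Proof.
move=> [mE mY H] B mB.
have H1 m Z : box m Z (fun=> setT) = setT :> set T.
  by elim: m Z => [|m IH] Z //=; rewrite IH preimage_setT setTI.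
have H2 m : gauss_box m (fun=> setT) = 1%E.
  by elim: m => [|m IH] //=; rewrite IH probability_setT mule1.
have := H (fun i => if i is 0 then B else setT).
rewrite /= H1 H2 setIT mule1; apply; by case.
Qed.

Lemma iid_tail E n Y B : measurable B -> iid E n.+1 Y ->
  iid (E `&` Y 0%N @^-1` B) n (fun i => Y i.+1).
Proof.
move=> mB iY; have [mE mY H] := iY; split => //.
  by apply: measurableI => //; rewrite -[X in measurable X]setTI; exact: mY.
move=> D mD; rewrite (iid_head iY)// -setIA -muleA.
by apply: (H (fun i => if i is j.+1 then D j else B)); case.
Qed.

Lemma iid_cons E n Y :
  measurable E -> (forall i, measurable_fun setT (Y i)) ->
  (forall B, measurable B -> P (E `&` Y 0%N @^-1` B) = (P E * gauss B)%E) ->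
  (forall B, measurable B -> iid (E `&` Y 0%N @^-1` B) n (fun i => Y i.+1)) ->
  iid E n.+1 Y.
Proof.
move=> mE mY H0 H1; split => // B mB /=.
by rewrite setIA; have [_ _ ->//] := H1 _ (mB 0%N); rewrite H0// muleA.
Qed.

Lemma iid_flip E n Y : iid E n.+1 Y ->
  iid E n.+1 (fun i w => if i is j.+1 then Y i w else - Y 0%N w).
Proof.
move=> iY; have [mE mY _] := iY; apply: iid_cons => //.
- by case => [|i] //; exact: measurableT_comp.
- move=> B mB; have mNB : measurable [set x | B (- x)].
    by rewrite -[X in measurable X]setTI; exact: oppr_measurable.
  by rewrite -(gaussN mB) -(iid_head iY).
- move=> B mB; have mNB : measurable [set x | B (- x)].
    by rewrite -[X in measurable X]setTI; exact: oppr_measurable.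
  exact: (iid_tail mNB iY).
Qed.

Definition rot (c s : R) (x : nat -> R) : nat -> R := fun i =>
  match i with 0 => c * x 0%N + s * x 1%N | 1 => - s * x 0%N + c * x 1%N | _ => x i end.

(** Condition on the coordinates from 2 on, which the rotation leaves alone; then
    the law of the first two is a product of two Gaussian laws and is rotation
    invariant. *)
Lemma iid_rot (c s : R) E n Y : s != 0 -> c ^+ 2 + s ^+ 2 = 1 ->
  iid E n.+2 Y -> iid E n.+2 (fun i w => rot c s (fun j => Y j w) i).
Proof.
move=> s0 cs iY; have [mE mY HY] := iY.
split => //.
  case=> [|[|i]] //=; by apply: measurable_funD; apply: measurable_funM.
move=> B mB /=.
set D := box n _ _.
have mD : measurable D by apply: measurable_box => // i; exact: mB.
pose E' := E `&` D.
have mE' : measurable E' by exact: measurableI.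
have H A C : measurable A -> measurable C ->
    P (E' `&` (Y 0%N @^-1` A `&` Y 1%N @^-1` C)) =
    (P E * (gauss A * (gauss C * gauss_box n (fun i => B i.+2))))%E.
  move=> mA mC.
  transitivity (P (E `&` (Y 0%N @^-1` A `&` (Y 1%N @^-1` C `&` D)))).
    by congr (P _); apply/seteqP; split=> w /=; rewrite /E' /=; tauto.
  apply: (HY (fun i => match i with 0 => A | 1 => C | j => B j end)).
  by case=> [|[|i]].
have PE' : P E' = (P E * gauss_box n (fun i => B i.+2))%E.
  by have := H setT setT measurableT measurableT; rewrite !preimage_setT !setIT probability_setT !mul1e.
pose F := [set z : R * R | B 0%N (c * z.1 + s * z.2) /\ B 1%N (- s * z.1 + c * z.2)].
have mrot : measurable_fun [set: R * R] (fun z => (c * z.1 + s * z.2, - s * z.1 + c * z.2)).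
  by apply: measurable_fun_pair; apply: measurable_funD; apply: measurable_funM.
have mF : measurable F.
  rewrite (_ : F = setT `&` (fun z => (c * z.1 + s * z.2, - s * z.1 + c * z.2)) @^-1` (B 0%N `*` B 1%N)).
    by apply: mrot => //; exact: measurableX.
  by rewrite setTI; apply/seteqP; split.
transitivity (P (E' `&` [set w | F (Y 0%N w, Y 1%N w)])).
  by congr (P _); apply/seteqP; split => w /=; rewrite /E' /F /=; tauto.
rewrite (@pair_law _ _ _ _ _ _ _ _ _ _ _ gauss gauss)//; last first.
  by move=> A C mA mC; rewrite H// PE' -muleA; congr (_ * _)%E; rewrite muleA muleC.
rewrite PE' -muleA; congr (_ * _)%E.
rewrite muleC muleA; congr (_ * _)%E.
have mB01 : measurable (B 0%N `*` B 1%N) by exact: measurableX.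
have E1 : (gauss \x gauss)%E (B 0%N `*` B 1%N) = (gauss (B 0%N) * gauss (B 1%N))%E.
  exact: product_measure1E.
rewrite -E1 (product_measure_indic gauss gauss mF).
rewrite (product_measure_indic gauss gauss mB01).
pose f := fun z : R * R => (\1_(B 0%N `*` B 1%N) z)%:E : \bar R.
transitivity (\int[gauss]_x \int[gauss]_y f (c * x + s * y, - s * x + c * y)%R)%E.
  apply: eq_integral => x _; apply: eq_integral => y _; rewrite /f !indicE.
  suff -> : ((x, y) \in F) = ((c * x + s * y, - s * x + c * y)%R \in B 0%N `*` B 1%N).
    by [].
  by apply/idP/idP; rewrite !inE.
rewrite (@gauss_rot _ c s f)//.
  by apply/measurable_EFinP; apply: measurable_indic.
by move=> z; rewrite lee_fin.
Qed.

End Iid.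

Section Align.
Variable R : realType.
Implicit Types x y v : nat -> R.

(** The map is quantified over all probability spaces and all conditioning
    events, so that such maps compose and can be applied to the tail of a
    sequence. *)
Definition iid_preserving (n m : nat) (A : (nat -> R) -> nat -> R) :=
  forall d (T : measurableType d) (P : probability T R) E (Y : nat -> T -> R),
    iid P E n Y -> iid P E m (fun i w => A (fun j => Y j w) i).

Lemma iid_preserving_cons n m A : iid_preserving n m A ->
  iid_preserving n.+1 m.+1 (fun x => scons (x 0%N) (A (shift x))).
Proof.
move=> HA d T P E Y iY; have [mE mY _] := iY.
have mA : forall i, measurable_fun setT (fun w => A (shift (fun j => Y j w)) i).
  by have [] := HA _ _ _ _ _ (iid_tail measurableT iY).
apply: iid_cons => //.
- by case=> [|i] /=; [exact: mY|exact: mA].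
- exact: iid_head iY.
- by move=> B mB; exact: (HA _ _ _ _ _ (iid_tail mB iY)).
Qed.

(** Every vector can be moved to the nonnegative part of the first axis by an
    isometry under which standard Gaussian vectors stay standard Gaussian:
    align the tail recursively, then rotate in the plane of the first two
    coordinates. A vanishing tail would ask for a rotation with zero sine, but
    then it is enough to fix the sign of the first coordinate. *)
Lemma align n v : exists A : (nat -> R) -> nat -> R,
  [/\ forall x y, dot n (A x) (A y) = dot n x y,
      (0 < n)%N -> A v 0%N = Num.sqrt (dot n v v),
      forall i, (0 < i < n)%N -> A v i = 0 &
      iid_preserving n n A].
Proof.
elim: n v => [|n IH] v.
  by exists id; split => // i /andP[].
have [A' [A'd A'0 A'i A'p]] := IH (shift v).
set r := Num.sqrt (dot n (shift v) (shift v)) in A'0.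
have r2 : r ^+ 2 = dot n (shift v) (shift v) by rewrite sqr_sqrtr// dot_ge0.
have [r0|r0] := eqVneq r 0.
  have A'v i : (i < n)%N -> A' (shift v) i = 0.
    by case: i => [|i] ni; [rewrite A'0|exact: A'i].
  have dE : dot n.+1 v v = v 0%N ^+ 2 by rewrite dotS -r2 r0 expr0n addr0.
  have [v0|v0] := leP 0 (v 0%N).
    exists (fun x => scons (x 0%N) (A' (shift x))); split.
    - by move=> x y; rewrite !dotS A'd.
    - by move=> _; rewrite dE sqrtr_sqr ger0_norm.
    - by case=> [|i]//=; exact: A'v.
    - exact: iid_preserving_cons.
  exists (fun x => scons (- x 0%N) (A' (shift x))); split.
  - by move=> x y; rewrite !dotS /= mulrNN A'd.
  - by move=> _; rewrite dE sqrtr_sqr ltr0_norm.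
  - by case=> [|i]//=; exact: A'v.
  - move=> d T P E Y iY.
    have := iid_flip (iid_preserving_cons A'p iY).
    by congr (iid _ _ _ _); apply/funext; case.
have [m nE] : exists m, n = m.+1.
  exists n.-1; rewrite prednK// lt0n; apply: contra_neqN r0 => /eqP n0.
  by rewrite /r n0 /dot big_ord0 sqrtr0.
clearbody r; subst n; rename m into n.
pose q := Num.sqrt (dot n.+2 v v).
have q2 : q ^+ 2 = v 0%N ^+ 2 + r ^+ 2.
  by rewrite sqr_sqrtr ?dot_ge0// dotS r2.
have q0 : q != 0.
  rewrite -sqrf_eq0 q2 gt_eqF// ltr_wpDl ?sqr_ge0// lt0r sqr_ge0 andbT.
  by rewrite sqrf_eq0.
pose A1 x := scons (x 0%N) (A' (shift x)).
have cs : (v 0%N / q) ^+ 2 + (r / q) ^+ 2 = 1.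
  by rewrite !exprMn -mulrDl -q2 exprVn divff// sqrf_eq0.
have s0 : r / q != 0 by rewrite mulf_neq0// invr_eq0.
exists (fun x => rot (v 0%N / q) (r / q) (A1 x)); split.
- move=> x y; rewrite (dotS n.+1 x y) -A'd !dotS !addrA; congr (_ + _).
  rewrite /A1 /shift /=; set a := A' _ 0%N; set b := A' _ 0%N.
  rewrite -[RHS]mul1r -cs.
  by ring.
- move=> _; rewrite /= A'0//; apply: (mulIf q0).
  transitivity (v 0%N ^+ 2 + r ^+ 2); first by field.
  by rewrite -q2 expr2.
- case=> [|[|i]]//= ni.
    by rewrite A'0//; field.
  by rewrite /A1 /= A'i.
- move=> d T P E Y iY.
  exact: (iid_rot s0 cs (iid_preserving_cons A'p iY)).
Qed.

End Align.

Section NearOrthonormal.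
Variable R : realType.
Implicit Types x y v : nat -> R.

(** Scalar products of a standard Gaussian vector with almost orthonormal vectors
    are almost independent standard Gaussian variables; the conclusion produces
    exactly independent ones nearby. Align the first vector: its norm is close
    to 1, so coordinate 0 is a good first variable; the other vectors have a
    small coordinate 0, and their tails are almost orthonormal in one dimension
    less. The bound delta must not depend on the dimension n, because n is the
    size of a grid that is chosen after delta. *)
Lemma near_orthonormal (M : nat) (eps : R) : 0 < eps ->
  exists2 delta : R, 0 < delta & forall n (c : nat -> nat -> R),
    (forall k l, (k < M)%N -> (l < M)%N ->
      `|dot n (c k) (c l) - (k == l)%:R| <= delta) ->
    exists2 A : (nat -> R) -> nat -> R, iid_preserving n M A &
      forall y k, (k < M)%N ->
        `|dot n (c k) y - A y k| <= eps * \sum_(j < M) `|A y j|.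
Proof.
move=> e0; elim: M => [|M [d' d'0 IH]].
  exists 1 => // n c _; exists id => // d T P E Y [mE mY _]; split => // B mB.
  by rewrite /= setIT mule1.
(* the Gram matrix of the tails is off by at most d + (2 d) ^ 2 <= 3 d *)
pose d := Num.min 2^-1 (Num.min (d' / 3) (eps / 2)).
have d0 : 0 < d by rewrite !lt_min invr_gt0 ltr0n !divr_gt0.
have d1 : d <= 2^-1 by rewrite /d ge_min lexx.
have d2 : 3 * d <= d'.
  by rewrite mulrC -ler_pdivlMr// /d !ge_min lexx orbT.
have d3 : 2 * d <= eps.
  by rewrite mulrC -ler_pdivlMr// /d !ge_min lexx !orbT.
exists d => // n c Hc.
have [A1 [A1d A10 A1i A1p]] := align n (c 0%N).
set r := Num.sqrt _ in A10.
have K00 : `|dot n (c 0%N) (c 0%N) - 1| <= d by exact: Hc.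
have r2 : r ^+ 2 = dot n (c 0%N) (c 0%N) by rewrite sqr_sqrtr// dot_ge0.
have r0 : 0 <= r by exact: sqrtr_ge0.
rewrite -r2 in K00.
have [K1 K2] : - d <= r ^+ 2 - 1 /\ r ^+ 2 - 1 <= d.
  by apply/andP; rewrite -ler_norml.
have rh : 2^-1 <= r by nra.
have r1 : `|r - 1| <= d by rewrite ler_norml; apply/andP; split; nra.
have [m nE] : exists m, n = m.+1.
  exists n.-1; rewrite prednK// lt0n; apply/eqP => n0.
  by move: r2; rewrite n0 /dot big_ord0 => r2; nra.
clearbody r; subst n.
have {}A10 : A1 (c 0%N) 0%N = r by exact: A10.
pose c1 k := A1 (c k).
have c1i i : (i < m)%N -> shift (c1 0%N) i = 0 by move=> im; exact: A1i.
have dot0 y : dot m (shift (c1 0%N)) y = 0.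
  by rewrite /dot big1// => i _; rewrite c1i// mul0r.
have x_le k : (k < M)%N -> `|c1 k.+1 0%N| <= 2 * d.
  move=> kM; have := Hc 0%N k.+1 isT kM; rewrite subr0 -A1d dotS dot0 addr0.
  rewrite A10 -/(c1 k.+1) normrM ger0_norm// => rx.
  have := normr_ge0 (c1 k.+1 0%N) => xx; nra.
have [k l kM lM|A2 A2p A2e] := IH m (fun k => shift (c1 k.+1)).
  have := Hc k.+1 l.+1 kM lM; rewrite eqSS -A1d dotS -/(c1 k.+1) -/(c1 l.+1).
  have := x_le k kM; have := x_le l lM; set xk := c1 _ _; set xl := c1 _ _.
  set D := dot m _ _; rewrite !ler_norml => /andP[a1 a2] /andP[b1 b2] /andP[e1 e2].
  apply/andP; split; nra.
exists (fun y => scons (A1 y 0%N) (A2 (shift (A1 y)))).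
  move=> dd T P E Y iY; exact: (iid_preserving_cons A2p (A1p _ _ _ _ _ iY)).
move=> y k kM; rewrite big_ord_recl /=.
set S := \sum_(_ < _) _.
have SE : S = \sum_(j < M) `|A2 (shift (A1 y)) j| by [].
have S0 : 0 <= S by rewrite SE; apply: sumr_ge0.
case: k kM => [|k] kM.
  rewrite -A1d dotS dot0 addr0 A10 /=; set a := A1 y 0%N.
  rewrite -{2}(mul1r a) -mulrBl normrM ler_pM// ?lerDl//; nra.
rewrite -A1d dotS /= -/(c1 k.+1).
have := A2e (shift (A1 y)) k kM; have := x_le k kM.
rewrite -SE; set D := dot m _ _; set a := A1 y 0%N; set x := c1 _ _.
move=> Hx HD.
rewrite -addrA (le_trans (ler_normD _ _))// mulrDr lerD//.
by rewrite normrM ler_wpM2r// (le_trans Hx).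
Qed.

End NearOrthonormal.

(** * Chi-square laws *)

Section Chi.
Variable R : realType.
Local Notation gauss := (gauss R).

Definition sqadd (z : R * R) : R := z.1 ^+ 2 + z.2.

Lemma measurable_sqadd : measurable_fun setT sqadd.
Proof. by apply: measurable_funD => //; apply: measurable_funX. Qed.

HB.instance Definition _ := @isMeasurableFun.Build _ _ _ _ sqadd measurable_sqadd.

(** The chi-square law with m degrees of freedom, built by adding one square at a
    time. Integrals against it then unfold into iterated integrals, and no
    density is ever written down. *)
Fixpoint chi (m : nat) : probability R R :=
  if m is k.+1 then
    distribution ((gauss \x chi k)%E : probability (R * R)%type R) sqadd
  else \d_(0 : R).

Definition sumsq (m : nat) (y : nat -> R) : R := \sum_(i < m) y i ^+ 2.

Lemma sumsqS m y : sumsq m.+1 y = y 0%N ^+ 2 + sumsq m (shift y).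
Proof. by rewrite /sumsq big_ord_recl. Qed.

Lemma sumsq_dot m y : sumsq m y = dot m y y.
Proof. by apply: eq_bigr => i _; rewrite expr2. Qed.

Section Law.
Context d (T : measurableType d) (P : probability T R).

Lemma measurable_sumsq m (Y : nat -> T -> R) : (forall i, measurable_fun setT (Y i)) ->
  measurable_fun setT (fun w => sumsq m (fun j => Y j w)).
Proof. by move=> mY; apply: measurable_sum => i; exact: measurable_funX. Qed.

(** The induction step of chi_law, with its induction hypothesis as a premise;
    kept apart because the same statement, once chi_law is known, is used for
    the pair formed by one coordinate and the sum of squares of the others. *)
Lemma chi_law_pair E m Y : iid P E m.+1 Y ->
  (forall E, iid P E m (fun i => Y i.+1) -> forall A, measurable A ->
    P (E `&` [set w | A (sumsq m (fun j => Y j.+1 w))]) = (P E * chi m A)%E) ->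
  forall F : set (R * R), measurable F ->
    P (E `&` [set w | F (Y 0%N w, sumsq m (fun j => Y j.+1 w))]) =
    (P E * (gauss \x chi m) F)%E.
Proof.
move=> iY IH; have [mE mY _] := iY.
apply: (pair_law (m1 := gauss) (m2 := chi m)) => //.
  exact: (@measurable_sumsq m (fun i => Y i.+1)).
move=> A B mA mB; have := IH _ (iid_tail mA iY) B mB.
by rewrite (iid_head iY)// -setIA muleA.
Qed.

Lemma chi_law E m Y : iid P E m Y -> forall A, measurable A ->
  P (E `&` [set w | A (sumsq m (fun j => Y j w))]) = (P E * chi m A)%E.
Proof.
elim: m E Y => [|m IH] E Y iY A mA.
  have [mE _ _] := iY.
  rewrite /= diracE; have [A0|A0] := boolP (0 \in A).
    rewrite (_ : [set _ | _] = setT) ?setIT ?mule1//.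
    by apply/seteqP; split => // w _ /=; rewrite /sumsq big_ord0; rewrite inE in A0.
  rewrite (_ : [set _ | _] = set0) ?setI0 ?measure0 ?mule0//.
  apply/seteqP; split => // w /=; rewrite /sumsq big_ord0 => H.
  by move: A0; rewrite notin_setE.
have mF : measurable (sqadd @^-1` A).
  by rewrite -[X in measurable X]setTI; exact: measurable_sqadd.
have := chi_law_pair iY (fun E' iE' => IH E' _ iE') mF.
rewrite [in RHS]/= /distribution /pushforward /= => <-.
by congr (P _); apply/seteqP; split => w /=; rewrite sumsqS.
Qed.

Lemma chi_pair E m Y : iid P E m.+1 Y ->
  forall F : set (R * R), measurable F ->
    P (E `&` [set w | F (Y 0%N w, sumsq m (fun j => Y j.+1 w))]) =
    (P E * (gauss \x chi m) F)%E.
Proof. by move=> iY; apply: chi_law_pair => // E' iE'; exact: chi_law. Qed.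

End Law.

Lemma ge0_integral_chiS m (f : R -> \bar R) : measurable_fun setT f ->
  (forall x, 0 <= f x)%E ->
  (\int[chi m.+1]_x f x = \int[gauss]_y \int[chi m]_u f (y ^+ 2 + u)%R)%E.
Proof.
move=> mf f0; rewrite [LHS](@ge0_integral_distribution _ _ _ _ _ _ sqadd f mf f0).
rewrite (@fubini_tonelli1 _ _ _ _ _ gauss (chi m) (f \o sqadd))//.
- by apply: measurableT_comp => //; exact: measurable_sqadd.
- by move=> z; exact: f0.
Qed.

(** The density of the law of a ^ 2 X relative to the law of X when X has law
    chi m: the product of the one-dimensional factors of gauss_scale depends on
    the coordinates through their sum of squares only. *)
Definition chi_weight (a : R) m (u : R) : R :=
  a^-1 ^+ m * expR ((1 - a ^- 2) * u / 2).

Lemma measurable_chi_weight a m : measurable_fun setT (chi_weight a m).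
Proof.
apply: measurable_funM => //; apply: measurableT_comp => //.
by apply: measurable_funM => //; exact: measurable_funM.
Qed.

Lemma chi_weight_ge0 a m u : 0 < a -> 0 <= chi_weight a m u.
Proof. by move=> a0; rewrite mulr_ge0 ?expR_ge0// exprn_ge0// invr_ge0 ltW. Qed.

Lemma chi_scale m (a : R) (f : R -> \bar R) : 0 < a ->
  measurable_fun setT f -> (forall x, 0 <= f x)%E ->
  (\int[chi m]_x f (a ^+ 2 * x)%R = \int[chi m]_x (f x * (chi_weight a m x)%:E))%E.
Proof.
move=> a0; elim: m f => [|m IH] f mf f0.
  rewrite /= !integral_dirac ?diracT ?mul1e//; last 2 first.
  - apply: emeasurable_funM => //; apply/measurable_EFinP.
    exact: measurable_chi_weight.
  - apply: (measurableT_comp mf); exact: measurable_funM.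
  by rewrite /chi_weight !mulr0 mul0r expR0 mulr1 expr0 mule1.
have mw k : measurable_fun setT (fun x => (chi_weight a k x)%:E).
  by apply/measurable_EFinP; exact: measurable_chi_weight.
have w0 k x : (0 <= (chi_weight a k x)%:E)%E by rewrite lee_fin chi_weight_ge0.
have ma : measurable_fun [set: R] (fun x => a ^+ 2 * x) by exact: measurable_funM.
have mfa := measurableT_comp mf ma.
have mfw : measurable_fun setT (fun x => f x * (chi_weight a m.+1 x)%:E)%E.
  exact: emeasurable_funM.
have fw0 x : (0 <= f x * (chi_weight a m.+1 x)%:E)%E by rewrite mule_ge0.
rewrite (ge0_integral_chiS m mfa (fun=> f0 _)) (ge0_integral_chiS m mfw fw0).
pose g (y : R) := (\int[chi m]_u (f (y ^+ 2 + u)%R * (chi_weight a m u)%:E))%E.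
have mfs : measurable_fun [set: R * R] (fun z => f (z.1 ^+ 2 + z.2)%R * (chi_weight a m z.2)%:E)%E.
  apply: emeasurable_funM; first exact: (measurableT_comp mf measurable_sqadd).
  exact: (measurableT_comp (mw m)).
have mg : measurable_fun setT g.
  apply: (@measurable_fun_fubini_tonelli_F _ _ _ _ _ (chi m) _ mfs).
  by move=> z; rewrite mule_ge0.
have msh y : measurable_fun [set: R] (fun u => f (y ^+ 2 + u)).
  by apply: (measurableT_comp mf); exact: measurable_funD.
transitivity (\int[gauss]_y g (a * y)%R)%E.
  apply: eq_integral => y _.
  rewrite /g -(IH (fun u => f ((a * y) ^+ 2 + u)))//.
  by apply: eq_integral => u _; rewrite exprMn -mulrDr.
have g0 y : (0 <= g y)%E by apply: integral_ge0 => u _; rewrite mule_ge0.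
apply: (etrans (gauss_scale (lt0r_neq0 a0) mg g0)).
apply: eq_integral => y _; rewrite /g.
set k : R := _ * _.
have k0 : (0 <= k%:E)%E by rewrite lee_fin mulr_ge0 ?expR_ge0// invr_ge0.
have mfy : measurable_fun setT (fun u => f (y ^+ 2 + u)%R * (chi_weight a m u)%:E)%E.
  by apply: emeasurable_funM => //; exact: msh.
have fy0 u : setT u -> (0 <= f (y ^+ 2 + u)%R * (chi_weight a m u)%:E)%E.
  by move=> _; rewrite mule_ge0.
rewrite -(@ge0_integralZr _ _ _ (chi m) setT measurableT _ mfy _ fy0 k0) /k.
apply: eq_integral => u _; rewrite -muleA -EFinM; congr (_ * _%:E)%E.
rewrite /chi_weight gtr0_norm//.
rewrite (_ : _ * (y ^+ 2 + u) / 2 = (1 - a ^- 2) * u / 2 + (1 - a ^- 2) * y ^+ 2 / 2).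
  by rewrite expRD mulrACA [a^-1 ^+ m.+1]exprSr.
by ring.
Qed.

End Chi.

(** * Exponential tail bounds *)

Section ChiBounds.
Variable R : realType.
Local Notation gauss := (gauss R).
Local Notation chi := (chi R).

Lemma expR_ge1 (x : R) : 0 <= x -> 1 <= expR x.
Proof. by move=> x0; rewrite -expR0 ler_expR. Qed.

Lemma integral_prob1 (mu : probability R R) : (\int[mu]_x cst 1 x = 1)%E.
Proof. by rewrite integral_cst// mul1e; exact: probability_setT. Qed.

(** With x = 2 th this controls 1 / (1 - 2 th), the squared moment generating
    function of the square of one Gaussian variable. *)
Lemma mgf_factor_ub (x : R) : `|x| <= 2^-1 -> 1 <= (1 - x) * expR (x + 2 * x ^+ 2).
Proof.
rewrite ler_norml => /andP[x1 x2].
have H : 1 + (x + 2 * x ^+ 2) <= expR (x + 2 * x ^+ 2) by exact: expR_ge1Dx.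
have x3 : 0 <= 1 - x by lra.
apply: (@le_trans _ _ ((1 - x) * (1 + (x + 2 * x ^+ 2)))).
  have : 0 <= x ^+ 2 * (1 - 2 * x) by rewrite mulr_ge0 ?sqr_ge0//; lra.
  nra.
exact: ler_wpM2l.
Qed.

Lemma mgf_factor_lb (x : R) : 0 <= x <= 1 -> (1 - x) * expR (x + x ^+ 2 / 4) <= 1.
Proof.
move=> /andP[x0 x1]; set y := x + x ^+ 2 / 4.
have H : 1 + (- (y / 2)) <= expR (- (y / 2)) by exact: expR_ge1Dx.
have y2 : 0 <= 1 - y / 2 by rewrite /y; nra.
have E : expR (- y) = expR (- (y / 2)) * expR (- (y / 2)).
  by rewrite -expRD; congr expR; lra.
have K : 1 - x <= expR (- y).
  rewrite E; apply: (@le_trans _ _ ((1 - y / 2) * (1 - y / 2))).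
    rewrite /y; have := mulr_ge0 x0 (sqr_ge0 x); have := sqr_ge0 (x ^+ 2); nra.
  by apply: ler_pM.
rewrite (le_trans (ler_wpM2r (expR_ge0 _) K))//.
by rewrite -expRD addNr expR0.
Qed.

(** The weight of chi_scale with a ^ 2 = 1 / (1 - 2 th) is the exponential sought,
    up to a constant factor, and weights integrate to 1. *)
Lemma chi_mgf m (th : R) : th < 2^-1 ->
  (\int[chi m]_u (expR (th * u))%:E = ((Num.sqrt (1 - 2 * th))^-1 ^+ m)%:E)%E.
Proof.
move=> th1; have s0 : 0 < 1 - 2 * th by lra.
pose a := (Num.sqrt (1 - 2 * th))^-1.
have a0 : 0 < a by rewrite invr_gt0 sqrtr_gt0.
have mE : measurable_fun setT (fun u : R => (expR (th * u))%:E).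
  apply/measurable_EFinP; apply: measurableT_comp => //; exact: measurable_funM.
have := @chi_scale R m a (cst 1%E) a0 (measurable_cst _) (fun=> lee01).
rewrite integral_prob1 => H.
have ap : 0 < a^-1 ^+ m by rewrite exprn_gt0// invr_gt0.
have H2 : ((a^-1 ^+ m)%:E * \int[chi m]_u (expR (th * u))%:E)%E = 1%E.
  rewrite H -(@ge0_integralZl _ _ _ (chi m) setT measurableT _ mE)//; first last.
    by rewrite lee_fin ltW.
  apply: eq_integral => u _; rewrite mul1e -EFinM /chi_weight; congr (_ * expR _)%:E.
  rewrite /a exprVn invrK sqr_sqrtr ?ltW//; lra.
have -> : ((a ^+ m)%:E = (a ^+ m)%:E * 1 :> \bar R)%E by rewrite mule1.
rewrite -H2 muleA -EFinM -exprMn divff ?gt_eqF// expr1n mul1e.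
by [].
Qed.

Let mgf1 (th : R) := (Num.sqrt (1 - 2 * th))^-1.

Lemma chi_mgf_center m (th : R) : th < 2^-1 ->
  (\int[chi m]_u (expR (th * (u - m%:R)))%:E = ((expR (- th) * mgf1 th) ^+ m)%:E)%E.
Proof.
move=> th1.
have mE : measurable_fun setT (fun u : R => (expR (th * u))%:E).
  apply/measurable_EFinP; apply: measurableT_comp => //; exact: measurable_funM.
rewrite exprMn EFinM -(chi_mgf m th1).
have k0 : (0 <= (expR (- th) ^+ m)%:E :> \bar R)%E.
  by rewrite lee_fin exprn_ge0// expR_ge0.
rewrite -(@ge0_integralZl _ _ _ (chi m) setT measurableT _ mE _ _ k0)//.
apply: eq_integral => u _; rewrite -EFinM -expRM_natr -expRD.
by congr (expR _)%:E; ring.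
Qed.

Lemma mgf1_sqr th : th < 2^-1 -> 0 < mgf1 th /\ mgf1 th ^+ 2 * (1 - 2 * th) = 1.
Proof.
move=> th1; have s0 : 0 < 1 - 2 * th by lra.
split; first by rewrite invr_gt0 sqrtr_gt0.
by rewrite exprVn sqr_sqrtr ?ltW// mulVf// gt_eqF.
Qed.

Lemma chi_mgf_ub m (th : R) : `|th| <= 4^-1 ->
  (\int[chi m]_u (expR (th * (u - m%:R)))%:E <= (expR (4 * th ^+ 2 * m%:R))%:E)%E.
Proof.
move=> H; have /andP[h1 h2] : - 4^-1 <= th <= 4^-1 by rewrite -ler_norml.
have th1 : th < 2^-1 by lra.
rewrite chi_mgf_center// expRM_natr lee_fin; have [a0 a2] := mgf1_sqr th1.
have p1 : 0 <= expR (- th) * mgf1 th by rewrite mulr_ge0 ?expR_ge0 ?ltW.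
apply: lerXn2r; rewrite ?nnegrE ?expR_ge0//.
rewrite -ler_sqr ?nnegrE ?expR_ge0//.
have x1 : `|2 * th| <= 2^-1 by rewrite normrM ger0_norm//; lra.
have K := mgf_factor_ub x1.
rewrite exprMn -!expRM_natr.
have t0 : 0 < 1 - 2 * th by lra.
rewrite -(ler_pM2r t0) -[leLHS]mulrA a2 mulr1.
have E : expR (4 * th ^+ 2 * 2%:R) = expR (- th * 2%:R) * expR (2 * th + 2 * (2 * th) ^+ 2).
  by rewrite -expRD; congr expR; ring.
rewrite E -[leRHS]mulrA -[leLHS]mulr1 ler_pM2l ?expR_gt0//.
by rewrite mulrC.
Qed.

Lemma chi_mgf_lb m (th : R) : 0 <= th <= 4^-1 ->
  ((expR (th ^+ 2 / 2 * m%:R))%:E <= \int[chi m]_u (expR (th * (u - m%:R)))%:E)%E.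
Proof.
move=> /andP[h1 h2].
have th1 : th < 2^-1 by lra.
rewrite chi_mgf_center// expRM_natr lee_fin; have [a0 a2] := mgf1_sqr th1.
have p1 : 0 <= expR (- th) * mgf1 th by rewrite mulr_ge0 ?expR_ge0 ?ltW.
apply: lerXn2r; rewrite ?nnegrE ?expR_ge0//.
rewrite -ler_sqr ?nnegrE ?expR_ge0//.
have x1 : 0 <= 2 * th <= 1 by apply/andP; split; lra.
have K := mgf_factor_lb x1.
rewrite exprMn -!expRM_natr.
have t0 : 0 < 1 - 2 * th by lra.
rewrite -(ler_pM2r t0) -[leRHS]mulrA a2 mulr1.
have E : expR (th ^+ 2 / 2 * 2%:R) = expR (- th * 2%:R) * expR (2 * th + (2 * th) ^+ 2 / 4).
  by rewrite -expRD; congr expR; field.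
rewrite E -[leLHS]mulrA -[leRHS]mulr1 ler_pM2l ?expR_gt0//.
by rewrite mulrC.
Qed.

(** Markov's inequality for exp (th (u - m)). A positive th bounds the upper tail,
    a negative one the lower tail. *)
Lemma chi_tail m (th x : R) : `|th| <= 4^-1 ->
  (chi m [set u | (x <= th * (u - m%:R))%R] <= (expR (4 * th ^+ 2 * m%:R - x))%:E)%E.
Proof.
move=> H.
have mth : measurable_fun setT (fun u : R => th * (u - m%:R)).
  by apply: measurable_funM => //; exact: measurable_funB.
have mE : measurable_fun setT (fun u : R => expR (th * (u - m%:R))).
  exact: measurableT_comp.
have mA : measurable [set u : R | x <= th * (u - m%:R)].
  exact: (measurable_preim mth (measurable_ray x)).
have mg : measurable_fun setT (fun u : R => expR (- x) * expR (th * (u - m%:R))).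
  exact: measurable_funM.
apply: (le_trans (measure_le_integral (chi m) mA mg _ _)).
- by move=> u; rewrite mulr_ge0 ?expR_ge0.
- by move=> u /= xu; rewrite -expRD expR_ge1// addrC subr_ge0.
have mE' : measurable_fun setT (fun u : R => (expR (th * (u - m%:R)))%:E) by exact/measurable_EFinP.
have k0 : (0 <= (expR (- x))%:E :> \bar R)%E by rewrite lee_fin expR_ge0.
have -> : (\int[chi m]_u (expR (- x) * expR (th * (u - m%:R)))%:E =
   (expR (- x))%:E * \int[chi m]_u (expR (th * (u - m%:R)))%:E)%E.
  rewrite -(@ge0_integralZl _ _ _ (chi m) setT measurableT _ mE' _ _ k0)//.
rewrite expRD [X in (_ <= X%:E)%E]mulrC EFinM.
by rewrite lee_wpmul2l// chi_mgf_ub.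
Qed.

Lemma gauss_exp_sqr : (\int[gauss]_y (expR (y ^+ 2 / 4))%:E = (Num.sqrt 2)%:E)%E.
Proof.
have s0 : 0 < Num.sqrt 2 :> R by rewrite sqrtr_gt0.
have mE : measurable_fun setT (fun u : R => (expR (u ^+ 2 / 4))%:E).
  apply/measurable_EFinP; apply: measurableT_comp => //.
  by apply: measurable_funM => //; exact: measurable_funX.
have := @gauss_scale R _ (cst 1%E) (lt0r_neq0 s0) (measurable_cst _) (fun=> lee01).
rewrite integral_prob1 => H.
have k0 : (0 <= (Num.sqrt 2)%:E :> \bar R)%E by rewrite lee_fin ltW.
rewrite -[RHS]mule1 H.
have mF : measurable_fun setT (fun u : R => (cst 1 u * ((`|Num.sqrt 2|^-1 : R) * expR ((1 - (Num.sqrt 2) ^- 2) * u ^+ 2 / 2))%:E)%E).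
  apply: emeasurable_funM => //; apply/measurable_EFinP; apply: measurable_funM => //.
  apply: measurableT_comp => //.
  by apply: measurable_funM => //; apply: measurable_funM => //; exact: measurable_funX.
rewrite -(@ge0_integralZl _ _ _ gauss setT measurableT _ mF _ _ k0)//; last first.
  by move=> u _; rewrite mul1e lee_fin mulr_ge0 ?expR_ge0.
apply: eq_integral => u _; rewrite mul1e -EFinM gtr0_norm// mulrA divff ?gt_eqF// mul1r.
by rewrite sqr_sqrtr//; congr (expR _)%:E; field.
Qed.

Lemma gauss_tail (x : R) :
  (gauss [set y | (4 * x <= y ^+ 2)%R] <= (Num.sqrt 2 * expR (- x))%:E)%E.
Proof.
have mS : measurable_fun setT (fun y : R => y ^+ 2) by exact: measurable_funX.
have mE : measurable_fun setT (fun u : R => expR (u ^+ 2 / 4)).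
  by apply: measurableT_comp => //; exact: measurable_funM.
have mA : measurable [set y : R | 4 * x <= y ^+ 2].
  exact: (measurable_preim mS (measurable_ray (4 * x))).
have mg : measurable_fun setT (fun u : R => expR (- x) * expR (u ^+ 2 / 4)).
  exact: measurable_funM.
apply: (le_trans (measure_le_integral gauss mA mg _ _)).
- by move=> u; rewrite mulr_ge0 ?expR_ge0.
- by move=> u /= xu; rewrite -expRD expR_ge1//; lra.
have mE' : measurable_fun setT (fun u : R => (expR (u ^+ 2 / 4))%:E) by exact/measurable_EFinP.
have k0 : (0 <= (expR (- x))%:E :> \bar R)%E by rewrite lee_fin expR_ge0.
rewrite mulrC EFinM -gauss_exp_sqr.
by rewrite -(@ge0_integralZl _ _ _ gauss setT measurableT _ mE' _ _ k0).
Qed.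

End ChiBounds.

(** * Small-ball bounds for chi-square laws *)

Section ProductBounds.
Context d1 d2 (T1 : measurableType d1) (T2 : measurableType d2) (R : realType)
  (m1 : probability T1 R) (m2 : probability T2 R).

Lemma measurable_section (F : set (T1 * T2)) x : measurable F ->
  measurable [set y | F (x, y)].
Proof.
by move=> mF; rewrite -[X in measurable X]setTI; exact: pair1_measurable.
Qed.

Lemma product_measureE (F : set (T1 * T2)) :
  (m1 \x m2)%E F = (\int[m1]_x m2 [set y | F (x, y)])%E.
Proof.
apply: eq_integral => x _ /=; congr (m2 _).
by apply/seteqP; split => y; rewrite /xsection /= inE.
Qed.

Lemma measurable_fun_section (F : set (T1 * T2)) : measurable F ->
  measurable_fun setT (fun x => m2 [set y | F (x, y)]).
Proof.
move=> mF; have := @measurable_fun_xsection _ _ T1 T2 R m2 F mF.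
congr (measurable_fun _ _); apply/funext => x /=; congr (m2 _).
by apply/seteqP; split => y; rewrite /xsection /= inE.
Qed.

Lemma product_measure_ge (F : set (T1 * T2)) (A : set T1) (r : R) :
  measurable F -> measurable A -> 0 <= r ->
  (forall x, A x -> r%:E <= m2 [set y | F (x, y)])%E ->
  (m1 A * r%:E <= (m1 \x m2) F)%E.
Proof.
move=> mF mA r0 H; rewrite product_measureE.
have <- : (\int[m1]_x (r * \1_A x)%:E = m1 A * r%:E)%E.
  by rewrite ge0_EFin_integralZl// ?integral_indicT// muleC.
have f0 x : setT x -> (0 <= (r * \1_A x)%:E :> \bar R)%E by rewrite lee_fin mulr_ge0.
have mf : measurable_fun setT (fun x => (r * \1_A x)%:E : \bar R).
  by apply/measurable_EFinP; apply: measurable_funM => //; exact: measurable_indic.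
apply: (ge0_le_integral m1 measurableT f0 mf (measurable_fun_section mF)) => x _.
rewrite indicE; case: (boolP (x \in A)) => [|_]; last by rewrite mulr0.
by rewrite inE mulr1 => /H.
Qed.

Lemma product_measure_le (F : set (T1 * T2)) (A : set T1) (r : R) :
  measurable F -> measurable A -> 0 <= r ->
  (forall x, ~ A x -> m2 [set y | F (x, y)] <= r%:E)%E ->
  ((m1 \x m2) F <= m1 A + r%:E)%E.
Proof.
move=> mF mA r0 H; rewrite product_measureE.
have <- : (\int[m1]_x (\1_A x + r)%:E = m1 A + r%:E)%E.
  rewrite (@ge0_EFin_integralD _ _ _ m1 (\1_A) (fun=> r))// ?integral_indicT//.
  congr (_ + _)%E; rewrite -[RHS]mule1 -(probability_setT m1).
  exact: integral_cst.
have f0 x : setT x -> (0 <= m2 [set y | F (x, y)])%E by [].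
have mf : measurable_fun setT (fun x => (\1_A x + r)%:E : \bar R).
  by apply/measurable_EFinP; apply: measurable_funD => //; exact: measurable_indic.
apply: (ge0_le_integral m1 measurableT f0 (measurable_fun_section mF) mf) => x _.
rewrite indicE; case: (boolP (x \in A)) => [_|]; last first.
  by rewrite notin_setE add0r => /H.
apply: (@le_trans _ _ 1%E); first exact: probability_le1 (measurable_section _ mF).
by rewrite lee_fin lerDl.
Qed.

End ProductBounds.

Section SmallBall.
Variable R : realType.
Local Notation gauss := (gauss R).
Local Notation chi := (chi R).

(** A second-moment argument with an exponential. Let X = exp (th (u - m)) with
    th = 1 / (8 sqrt m). The mean of X exceeds 1 by at least 1 / 128, the mean
    of its square is at most 4 / 3, and X <= 1 where u <= m. Hence
    X <= 1 + ep X ^ 2 + K 1_(m <= u) pointwise as soon as 4 ep K = 1, and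
    integrating leaves a fixed amount of mass on the event m <= u. *)
Lemma chi_mass_above_mean : exists2 c : R, 0 < c &
  forall m, (c%:E <= chi m [set u | (m%:R <= u)%R])%E.
Proof.
(* 4 ep K = 1, and ep 4 / 3 is smaller than the gain 1 / 128; they are
   introduced through equations to keep the arithmetic tactics off the numerals *)
have [ep epE] : exists ep : R, ep = 512^-1 by exists 512^-1.
have [K KE] : exists K : R, K = 128 by exists 128.
have ep0 : 0 < ep by rewrite epE invr_gt0 ltr0n.
have K0 : 0 < K by rewrite KE ltr0n.
have epK : 4 * (ep * K) = 1 by rewrite epE KE; lra.
exists ((K^-1 - 4 / 3 * ep) / K).
  by rewrite divr_gt0// subr_gt0 epE KE; lra.
move=> m.
have mA : measurable [set u : R | m%:R <= u] by exact: measurable_ray.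
case: m mA => [|m] mA.
  by rewrite /= diracE mem_set//= lee_fin epE KE; lra.
set k := m.+1 in mA *.
pose q := Num.sqrt (k%:R : R).
have k1 : 1 <= k%:R :> R by rewrite ler1n.
have q2 : q ^+ 2 = k%:R by rewrite sqr_sqrtr// ler0n.
have q1 : 1 <= q by rewrite -[leLHS]sqrtr1 ler_sqrt// ltr0n.
have q0 : 0 < q by lra.
pose th := (8 * q)^-1.
have th0 : 0 < th by rewrite invr_gt0 mulr_gt0.
have th8 : th <= 8^-1 by rewrite lef_pV2 ?posrE ?mulr_gt0//; lra.
have thk : th ^+ 2 * k%:R = 64^-1.
  by rewrite -q2 /th; field; lra.
set p := chi k _.
have lb := @chi_mgf_lb R k th.
have ub := @chi_mgf_ub R k (2 * th).
have mth (c : R) : measurable_fun setT (fun u : R => expR (c * (u - k%:R))).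
  apply: measurableT_comp => //; apply: measurable_funM => //; exact: measurable_funB.
have mi : measurable_fun setT (\1_[set u : R | k%:R <= u] : R -> R) by exact: measurable_indic.
have I : (\int[chi k]_u (expR (th * (u - k%:R)))%:E <=
    1 + (ep%:E * \int[chi k]_u (expR (2 * th * (u - k%:R)))%:E + K%:E * p))%E.
  pose h (u : R) : R := 1 + (ep * expR (2 * th * (u - k%:R)) +
    K * \1_[set u : R | (k%:R <= u)%R] u).
  have mh1 : measurable_fun setT (fun u : R => ep * expR (2 * th * (u - k%:R))).
    exact: measurable_funM.
  have mh2 : measurable_fun setT (fun u : R => K * \1_[set u : R | k%:R <= u] u : R).
    exact: measurable_funM.
  have mh12 := measurable_funD mh1 mh2.
  have mh : measurable_fun setT h by exact: measurable_funD.
  have h10 (u : R) : 0 <= ep * expR (2 * th * (u - k%:R)).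
    by rewrite mulr_ge0 ?expR_ge0// ltW.
  have h20 (u : R) : 0 <= K * \1_[set u : R | k%:R <= u] u :> R.
    by rewrite mulr_ge0// ltW.
  apply: (@le_trans _ _ (\int[chi k]_u (h u)%:E)%E).
    apply: (ge0_EFin_integral_le (chi k) (mth th) mh (fun u => expR_ge0 _)) => u.
    rewrite /h; set x := expR _.
    have -> : expR (2 * th * (u - k%:R)) = x ^+ 2.
      by rewrite -expRM_natr; congr expR; ring.
    have x0 : 0 < x by exact: expR_gt0.
    rewrite indicE; case: (boolP (u \in _)) => [|].
      move=> _ /=; rewrite mulr1; have H := mulr_ge0 (ltW ep0) (sqr_ge0 (x - 2 * K)); nra.
    rewrite notin_setE /= => /negP; rewrite -ltNge => ku.
    have x1 : x <= 1 by rewrite /x expR_le1; nra.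
    by rewrite mulr0 addr0; have := mulr_ge0 (ltW ep0) (sqr_ge0 x); lra.
  rewrite (@ge0_EFin_integralD _ _ _ (chi k) (fun=> 1) _ (measurable_cst _) mh12 (fun=> ler01)); last first.
    by move=> u; exact: addr_ge0.
  rewrite (integral_prob1 (chi k)) leeD2l//.
  rewrite (ge0_EFin_integralD (chi k) mh1 mh2 h10 h20).
  rewrite (ge0_EFin_integralZl (chi k) (mth _) (fun=> expR_ge0 _) (ltW ep0)).
  have i0 (u : R) : 0 <= \1_[set u : R | k%:R <= u] u :> R by [].
  by rewrite (ge0_EFin_integralZl (chi k) mi i0 (ltW K0)) (integral_indicT (chi k) mA).
have pf : p = (fine p)%:E by rewrite fineK// fin_num_measure.
have e14 : expR (4^-1 : R) <= 4 / 3.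
  have H : 1 + (- 4^-1) <= expR (- 4^-1 : R) by exact: expR_ge1Dx.
  have H2 : expR (4^-1 : R) * expR (- 4^-1) = 1 by rewrite -expRD subrr expR0.
  have := expR_gt0 (4^-1 : R); nra.
have e128 : 1 + 128^-1 <= expR (128^-1 : R) by exact: expR_ge1Dx.
have {}lb : ((1 + 128^-1)%:E <= \int[chi k]_u (expR (th * (u - k%:R)))%:E)%E.
  apply: le_trans (lb _); last by apply/andP; split; lra.
  by rewrite lee_fin (_ : th ^+ 2 / 2 * k%:R = 128^-1)//; rewrite mulrAC thk; lra.
have {}ub : (\int[chi k]_u (expR (2 * th * (u - k%:R)))%:E <= (4 / 3)%:E)%E.
  apply: le_trans (ub _) _; first by rewrite ger0_norm; lra.
  rewrite lee_fin (_ : 4 * (2 * th) ^+ 2 * k%:R = 4^-1)//.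
  transitivity (16 * (th ^+ 2 * k%:R)); [ring|rewrite thk; lra].
have := le_trans lb I.
have H : (1 + (ep%:E * \int[chi k]_u (expR (2 * th * (u - k%:R)))%:E + K%:E * p)
   <= 1 + (ep%:E * (4/3)%:E + K%:E * p))%E.
  by rewrite leeD2l// leeD2r// lee_wpmul2l// lee_fin ltW.
move=> /le_trans /(_ H); rewrite pf -!EFinM -!EFinD !lee_fin => H3.
rewrite ler_pdivrMr//; rewrite epE KE in H3 *; lra.
Qed.

End SmallBall.

Section SmallBallSegments.
Variable R : realType.
Local Notation gauss := (gauss R).
Local Notation chi := (chi R).

(** The left-hand side is the mass of A under the law of X / a ^ 2. At u >= m its
    density relative to the law of X is a ^ m exp (- (a ^ 2 - 1) u / 2), which
    is at most 1 because a <= exp ((a ^ 2 - 1) / 2). So a set that moves away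
    from the mean loses mass, even though dilation makes it larger; this plays
    the role of the monotonicity of the density. *)
Lemma chi_dilate m (a : R) (A : set R) : 1 <= a -> measurable A ->
  (forall u, A u -> m%:R <= u) ->
  (chi m [set u | A (a ^- 2 * u)%R] <= chi m A)%E.
Proof.
move=> a1 mA Am; have a0 : 0 < a by lra.
have ai0 : 0 < a^-1 by rewrite invr_gt0.
have mi : measurable_fun setT (\1_A : R -> R) by exact: measurable_indic.
have mi' : measurable_fun setT (fun u : R => (\1_A u)%:E : \bar R) by exact/measurable_EFinP.
have i0 (u : R) : (0 <= (\1_A u)%:E :> \bar R)%E by rewrite lee_fin.
pose B := [set u | A (a ^- 2 * u)].
have mB : measurable B by apply: measurable_preim => //; exact: measurable_funM.
rewrite -/B -(integral_indicT (chi m) mB) -(integral_indicT (chi m) mA).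
have -> : (\int[chi m]_u (\1_B u)%:E = \int[chi m]_u (\1_A (a^-1 ^+ 2 * u)%R)%:E)%E.
  apply: eq_integral => u _; rewrite !indicE.
  suff -> : (u \in B) = (a^-1 ^+ 2 * u \in A) by [].
  by apply/idP/idP; rewrite !inE /B /= exprVn.
rewrite (chi_scale m ai0 mi' i0).
have f0 u : setT u -> (0 <= (\1_A u)%:E * (chi_weight a^-1 m u)%:E)%E.
  by move=> _; rewrite mule_ge0// lee_fin chi_weight_ge0.
have mf : measurable_fun setT (fun u => (\1_A u)%:E * (chi_weight a^-1 m u)%:E)%E.
  by apply: emeasurable_funM => //; apply/measurable_EFinP; exact: measurable_chi_weight.
apply: (ge0_le_integral (chi m) measurableT f0 mf mi') => u _.
rewrite -EFinM lee_fin indicE; case: (boolP (u \in A)); last by rewrite mul0r.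
rewrite inE => /Am mu; rewrite mul1r /chi_weight invrK exprVn invrK.
have aE : a <= expR ((a ^+ 2 - 1) / 2).
  rewrite -ler_sqr ?nnegrE ?expR_ge0 ?(ltW a0)// -expRM_natr.
  have -> : (a ^+ 2 - 1) / 2 * 2%:R = a ^+ 2 - 1 by field.
  by have := expR_ge1Dx (a ^+ 2 - 1); lra.
have aEm : a ^+ m <= expR ((a ^+ 2 - 1) / 2 * m%:R).
  by rewrite expRM_natr; apply: lerXn2r; rewrite ?nnegrE ?expR_ge0 ?(ltW a0).
apply: (le_trans (ler_wpM2r (expR_ge0 _) aEm)).
rewrite -expRD expR_le1.
have : 0 <= a ^+ 2 - 1 by nra.
nra.
Qed.

(** The dilation that sends p to p + j w stretches the segment of length w at p to
    a segment at p + j w of length at least w. *)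
Lemma chi_seg_shift m (p w : R) j : (0 < m)%N -> m%:R <= p -> 0 <= w ->
  (chi m [set u | (p + j%:R * w <= u <= p + j.+1%:R * w)%R] <=
   chi m [set u | (p <= u <= p + w)%R])%E.
Proof.
move=> m0 mp w0.
have p0 : 0 < p by apply: lt_le_trans mp; rewrite ltr0n.
have j0 : 0 <= j%:R :> R by rewrite ler0n.
(* the dilation factor is a ^ 2 *)
pose a := Num.sqrt (1 + j%:R * w / p).
have jwp : 0 <= j%:R * w / p by rewrite !mulr_ge0// invr_ge0 ltW.
have a1 : 1 <= a by rewrite -[leLHS]sqrtr1 ler_wsqrtr// lerDl.
have a2 : a ^+ 2 = 1 + j%:R * w / p by rewrite sqr_sqrtr// addr_ge0.
have pa : p * a ^+ 2 = p + j%:R * w by rewrite a2; field; rewrite gt_eqF.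
have a20 : 0 < a ^+ 2 by rewrite a2; lra.
apply: le_trans (chi_dilate (a := a) a1 (measurable_seg p (p + w)) _); last first.
  by move=> u /= /andP[pu _]; exact: le_trans pu.
apply: le_measure; rewrite ?inE.
- exact: measurable_seg.
- by apply: measurable_preim; [exact: measurable_funM|exact: measurable_seg].
move=> u /= /andP[u1 u2]; apply/andP; split.
  by rewrite mulrC ler_pdivlMr// pa.
rewrite mulrC ler_pdivrMr// mulrDl pa.
have wa : w <= w * a ^+ 2 by rewrite a2 -[leLHS]mulr1 ler_wpM2l// lerDl.
move: u2; rewrite -natr1 mulrDl mul1r; lra.
Qed.

Lemma chi_seg_cover m (p w : R) J : (0 < m)%N -> m%:R <= p -> 0 <= w -> (0 < J)%N ->
  (chi m [set u | (p <= u <= p + J%:R * w)%R] <=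
   J%:R%:E * chi m [set u | (p <= u <= p + w)%R])%E.
Proof.
move=> m0 mp w0; elim: J => // J IH _.
have [->|J0] := posnP J; first by rewrite mul1r mul1e.
apply: (@le_trans _ _ (chi m ([set u | (p <= u <= p + J%:R * w)%R] `|`
   [set u | (p + J%:R * w <= u <= p + J.+1%:R * w)%R]))).
  apply: le_measure; rewrite ?inE.
  - exact: measurable_seg.
  - by apply: measurableU; exact: measurable_seg.
  move=> u /= /andP[u1 u2]; have [uJ|/ltW Ju] := leP u (p + J%:R * w).
    by left; apply/andP.
  by right; apply/andP.
apply: le_trans (measureU2 _ (measurable_seg _ _) (measurable_seg _ _)) _.
rewrite -[in leRHS]natr1 EFinD ge0_muleDl ?lee_fin// mul1e.
by apply: leeD; [exact: IH|exact: chi_seg_shift].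
Qed.

Lemma gauss_seg_ge (p l : R) : 0 <= l -> 0 <= p -> p + l <= 2 ->
  ((l * gpdf (2 : R))%:E <= gauss [set y | (p <= y <= p + l)%R])%E.
Proof.
move=> l0 p0 pl.
rewrite (_ : [set y | _] = `[p, p + l]%classic); last first.
  by apply/seteqP; split => u /=; rewrite in_itv.
have mI : measurable (`[p, p + l]%classic : set R) by exact: measurable_itv.
rewrite gaussE_leb//.
have -> : ((l * gpdf 2)%:E = \int[leb (R:=R)]_(x in `[p, (p + l)%R]) (gpdf (2 : R))%:E)%E.
  rewrite integral_cst//= lebE lebesgue_measure_itv/= lte_fin ltrDl.
  case: ifPn => [_|]; first by rewrite -EFinB addrAC subrr add0r -EFinM mulrC.
  rewrite -leNgt => l1; have -> : l = 0 by lra.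
  by rewrite mul0r mule0.
apply: ge0_le_integral => //.
- by move=> x _; rewrite lee_fin gpdf_ge0.
- by apply/measurable_EFinP/measurable_funTS; exact: measurable_gpdf.
- move=> x /=; rewrite in_itv/= => /andP[x1 x2]; rewrite lee_fin.
  rewrite [leLHS]gpdfE [leRHS]gpdfE ler_wpM2l ?gpdf_ge0// ler_expR; nra.
Qed.

(** A fixed amount c1 of mass lies beyond k + 1: let one coordinate have square at
    least 2 and the others sum to at least their mean. Half of it lies within a
    distance O(sqrt k) of k by the exponential tail bound, hence is covered by
    O(sqrt k / w) segments of length w starting at p, the first of which is the
    heaviest. Allowing p up to k + 1 leaves room for adding one more square of
    size at most 1. *)
Lemma chi_small_ball : exists2 c : R, 0 < c & forall k (p w : R), (0 < k)%N ->
  k%:R <= p <= k%:R + 1 -> 0 < w -> w <= 2 * Num.sqrt k%:R ->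
  ((c * w / Num.sqrt k%:R)%:E <= chi k [set u | (p <= u <= p + w)%R])%E.
Proof.
have [c0 c00 Hc0] := chi_mass_above_mean R.
pose g0 := 2^-1 * gpdf (2 : R).
have g00 : 0 < g0 by rewrite mulr_gt0 ?gpdf_gt0// invr_gt0.
(* the segment [3/2, 2] lies in the set, and (3/2) ^ 2 >= 2 *)
have Hg0 : (g0%:E <= gauss [set y | (2 <= y ^+ 2)%R])%E.
  apply: (@le_trans _ _ (gauss [set y | (3/2 <= y <= 3/2 + 2^-1)%R])).
    apply: gauss_seg_ge; lra.
  apply: le_measure; rewrite ?inE.
  - exact: measurable_seg.
  - apply: (measurable_preim _ (A := [set y | 2 <= y])); last exact: measurable_ray.
    exact: measurable_funX.
  - by move=> y /= /andP[y1 y2]; nra.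
pose c1 := g0 * c0.
have c10 : 0 < c1 by exact: mulr_gt0.
have Hc1 k : (0 < k)%N -> (c1%:E <= chi k [set u | (k%:R + 1 <= u)%R])%E.
  case: k => // k _.
  have -> : chi k.+1 [set u | k.+1%:R + 1 <= u] =
    (gauss \x chi k)%E [set z | k.+1%:R + 1 <= sqadd z] by [].
  apply: (@le_trans _ _ ((gauss \x chi k)%E
      ([set y | (2 <= y ^+ 2)%R] `*` [set u | (k%:R <= u)%R]))).
    rewrite (@product_measure1E _ _ _ _ _ gauss (chi k))//; last 2 first.
    - apply: (measurable_preim _ (A := [set y | 2 <= y])); last exact: measurable_ray.
      exact: measurable_funX.
    - exact: measurable_ray.
    rewrite /c1 EFinM; apply: lee_pmul; [|by rewrite lee_fin ltW|exact: Hg0|exact: Hc0].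
    by rewrite lee_fin ltW.
  apply: le_measure; rewrite ?inE.
  - apply: measurableX; last exact: measurable_ray.
    apply: (measurable_preim _ (A := [set y | 2 <= y])); last exact: measurable_ray.
    exact: measurable_funX.
  - rewrite -[X in measurable X]setTI.
    exact: (@measurable_sqadd R measurableT _ (measurable_ray (k.+1%:R + 1))).
  - move=> [y u] /= [y2 uk]; rewrite /sqadd /= -natr1; lra.
(* x1 is such that the tail beyond k + 8 x1 sqrt k has mass at most c1 / 2 *)
pose x1 := Num.max 1 (1 - ln (c1 / 2)).
have x11 : 1 <= x1 by rewrite /x1 le_max lexx.
have Hx1 : expR (16^-1 - x1) <= c1 / 2.
  have c12 : 0 < c1 / 2 by lra.
  rewrite -[leRHS](@lnK R)// ler_expR.
  have : 1 - ln (c1 / 2) <= x1 by rewrite /x1 le_max lexx orbT.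
  lra.
exists (c1 / 2 / (8 * x1 + 2)).
  by rewrite !divr_gt0//; lra.
move=> k p w k0 /andP[p1 p2] w0 w1.
set q := Num.sqrt k%:R in w1 *.
have k1 : 1 <= k%:R :> R by rewrite ler1n.
have q2 : q ^+ 2 = k%:R by rewrite sqr_sqrtr// ler0n.
have q1 : 1 <= q by rewrite -[leLHS]sqrtr1 ler_sqrt// ltr0n.
have q0 : 0 < q by lra.
pose th := (8 * q)^-1.
have th0 : 0 < th by rewrite invr_gt0 mulr_gt0.
have th8 : th <= 8^-1 by rewrite lef_pV2 ?posrE ?mulr_gt0//; lra.
have thk : 4 * th ^+ 2 * k%:R = 16^-1 by rewrite -q2 /th; field; lra.
have thq : th * (8 * q) = 1 by rewrite mulVf// gt_eqF// mulr_gt0.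
have tail : (chi k [set u | (x1 <= th * (u - k%:R))%R] <= (c1 / 2)%:E)%E.
  apply: (le_trans (chi_tail _ _ _)); first by rewrite ger0_norm; lra.
  by rewrite thk lee_fin.
pose J := (Num.truncn (8 * x1 * q / w)).+1.
have Jw : 8 * x1 * q <= J%:R * w.
  by rewrite -ler_pdivrMr// ltW// truncnS_gt.
have J1 : J%:R <= (8 * x1 + 2) * q / w.
  rewrite /J -natr1 -lerBrDr; apply: (@le_trans _ _ (8 * x1 * q / w)).
    by rewrite truncn_le// divr_ge0 ?mulr_ge0 ?(ltW w0) ?(ltW q0)//; lra.
  have -> : (8 * x1 + 2) * q / w = 8 * x1 * q / w + 2 * q / w by ring.
  have : 1 <= 2 * q / w by rewrite ler_pdivlMr// mul1r.
  lra.
have cover : (c1%:E <= J%:R%:E * chi k [set u | (p <= u <= p + w)%R] + (c1 / 2)%:E)%E.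
  apply: (le_trans (Hc1 k k0)).
  apply: (@le_trans _ _ (chi k ([set u | (p <= u <= p + J%:R * w)%R] `|`
      [set u | (x1 <= th * (u - k%:R))%R]))).
    apply: le_measure; rewrite ?inE.
    - exact: measurable_ray.
    - apply: measurableU; first exact: measurable_seg.
      apply: (measurable_preim _ (A := [set y | x1 <= y])); last exact: measurable_ray.
      by apply: measurable_funM => //; exact: measurable_funB.
    move=> u /= ku; have [xu|xu] := leP x1 (th * (u - k%:R)); [by right|left].
    apply/andP; split; first lra.
    have : u - k%:R <= 8 * q * x1.
      rewrite -(ler_pM2l th0) mulrA thq; lra.
    lra.
  apply: le_trans (measureU2 _ _ _) _; first exact: measurable_seg.
    apply: (measurable_preim _ (A := [set y | x1 <= y])); last exact: measurable_ray.
    by apply: measurable_funM => //; exact: measurable_funB.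
  by apply: leeD => //; apply: chi_seg_cover => //; exact: ltW.
set c := chi k _ in cover *.
have cf : c = (fine c)%:E by rewrite fineK// fin_num_measure//; exact: measurable_seg.
have f0 : 0 <= fine c by apply: fine_ge0; exact: measure_ge0.
move: cover; rewrite cf -EFinM -EFinD !lee_fin => H.
have H2 : c1 / 2 <= (8 * x1 + 2) * q / w * fine c.
  apply: (@le_trans _ _ (J%:R * fine c)); first lra.
  exact: ler_wpM2r.
rewrite ler_pdivrMr// mulrAC ler_pdivrMr; last lra.
have -> : fine c * q * (8 * x1 + 2) = (8 * x1 + 2) * q / w * fine c * w.
  by field; rewrite gt_eqF.
by apply: ler_wpM2r => //; exact: ltW.
Qed.

End SmallBallSegments.

Section NoncentralBall.
Variable R : realType.
Local Notation gauss := (gauss R).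
Local Notation chi := (chi R).

Lemma measurable_noncentral (be x y : R) :
  measurable [set z : R * R | x <= (be + z.1) ^+ 2 + z.2 <= y].
Proof.
have mf : measurable_fun [set: R * R] (fun z => (be + z.1) ^+ 2 + z.2).
  apply: measurable_funD => //; apply: measurable_funX.
  exact: measurable_funD.
by rewrite -[X in measurable X]setTI; apply: (mf _ _ (measurable_seg x y)).
Qed.

(** Freeze the shifted coordinate y in a window where (be + y) ^ 2 = v <= 1; the
    sum of the m other squares then has to fall in a segment of length w
    starting at m + 1 - v, which lies between m and m + 1. When m = 0 there are
    no other squares and the Gaussian density is bounded below directly. *)
Lemma noncentral_small_ball : exists2 c : R, 0 < c & forall m (be w : R),
  0 <= be <= 4^-1 -> 0 < w -> w <= Num.sqrt m.+1%:R ->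
  ((c * w / Num.sqrt m.+1%:R)%:E <= (gauss \x chi m)%E
     [set z | (m.+1%:R <= (be + z.1) ^+ 2 + z.2 <= m.+1%:R + w)%R])%E.
Proof.
have [c0 c00 Hc0] := chi_small_ball R.
have g0 := @gpdf_gt0 R 2; set g := gpdf 2 in g0.
exists (Num.min (g / 3) (g / 2 * c0)).
  by rewrite lt_min !mulr_gt0// ?invr_gt0.
set c := Num.min _ _.
have cg : c <= g / 3 by rewrite /c ge_min lexx.
have cc : c <= g / 2 * c0 by rewrite /c ge_min lexx orbT.
move=> m be w /andP[b0 b1] w0 w1.
have mF := measurable_noncentral be m.+1%:R (m.+1%:R + w).
case: m w1 mF => [|k] w1 mF.
  rewrite sqrtr1 in w1 *.
  (* here 1 <= (be + y) ^ 2 <= 1 + w means that be + y lies between 1 and v *)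
  pose v := Num.sqrt (1 + w).
  have v2 : v ^+ 2 = 1 + w by rewrite sqr_sqrtr//; lra.
  have v0 : 0 <= v by exact: sqrtr_ge0.
  have v1 : 1 + w / 3 <= v by nra.
  have v3 : v <= 3 / 2 by nra.
  apply: le_trans (@product_measure_ge _ _ _ _ _ gauss (chi 0) _
    [set y | (1 - be <= y <= 1 - be + (v - 1))%R] _ mF (measurable_seg _ _) ler01 _).
    rewrite mule1; apply: le_trans (gauss_seg_ge _ _ _); [|lra|lra|lra].
    rewrite lee_fin divr1 -/g.
    have : c * w <= g / 3 * w by apply: ler_wpM2r => //; exact: ltW.
    have : g * (w / 3) <= g * (v - 1) by apply: ler_wpM2l; lra.
    lra.
  move=> y /= /andP[y1 y2]; rewrite diracE mem_set//=.
  by apply/andP; split; nra.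
pose q := Num.sqrt k.+1%:R : R.
have q0 : 0 < q by rewrite sqrtr_gt0 ltr0n.
have q2 : q ^+ 2 = k.+1%:R by rewrite sqr_sqrtr// ler0n.
have k1 : 1 <= k.+1%:R :> R by rewrite ler1n.
set q' := Num.sqrt k.+2%:R in w1 *.
have q'2 : q' ^+ 2 = k.+1%:R + 1 by rewrite sqr_sqrtr ?ler0n// natr1.
have q'0 : 0 <= q' by exact: sqrtr_ge0.
have qq' : q <= q' by nra.
have q'q : q' <= 2 * q by nra.
have r0 : 0 <= c0 * w / q by rewrite !mulr_ge0 ?invr_ge0 ?ltW.
apply: le_trans (@product_measure_ge _ _ _ _ _ gauss (chi k.+1) _
    [set y | (0 <= y <= 0 + 2^-1)%R] _ mF (measurable_seg _ _) r0 _).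
  apply: (@le_trans _ _ ((2^-1 * g)%:E * (c0 * w / q)%:E)%E); last first.
    by rewrite lee_wpmul2r ?lee_fin//; apply: gauss_seg_ge; lra.
  rewrite -EFinM lee_fin.
  have q'0' : 0 < q' by lra.
  apply: (@le_trans _ _ (c * w / q)).
    by rewrite ler_wpM2l ?lef_pV2 ?posrE// mulr_ge0 ?(ltW w0)// /c le_min !mulr_ge0 ?invr_ge0 ?ltW.
  rewrite [leRHS](_ : _ = g / 2 * c0 * w / q); last by ring.
  apply: ler_wpM2r; first by rewrite invr_ge0 ltW.
  by apply: ler_wpM2r => //; exact: ltW.
move=> y /= /andP[y1 y2]; pose v := (be + y) ^+ 2.
have v0 : 0 <= v by exact: sqr_ge0.
have v1 : v <= 1 by rewrite /v; nra.
apply: le_trans (Hc0 k.+1 (k.+1%:R + 1 - v) w _ _ w0 _) _ => //.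
- by apply/andP; split; lra.
- by rewrite -/q; lra.
apply: le_measure; rewrite ?inE; [exact: measurable_seg| |].
  exact: (measurable_section y mF).
by move=> u /= /andP[u1 u2]; rewrite -/v -[k.+2%:R]natr1; lra.
Qed.

(** The Chernoff exponent for a sum of M squares: sqrt (tau / 4 M) balances the
    two terms of chi_tail, and is capped at 1 / 4 where chi_tail stops being
    valid; the cap produces the linear term in tau. *)
Lemma tail_exponent (M tau : R) : 1 <= M -> 0 < tau -> exists th : R,
  [/\ 0 < th, th <= 4^-1, 4 * th ^+ 2 * M <= tau &
      2 * tau <= th * (8 * tau + 4 * Num.sqrt (M * tau))].
Proof.
move=> M1 t0; have [tM|tM] := leP tau (M / 4); last first.
  exists 4^-1; split; [lra|lra|lra|].
  have := sqrtr_ge0 (M * tau); lra.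
have x0 : 0 < tau / (4 * M) by rewrite divr_gt0//; lra.
exists (Num.sqrt (tau / (4 * M))).
set th := Num.sqrt _.
have th0 : 0 < th by rewrite sqrtr_gt0.
have th2 : th ^+ 2 = tau / (4 * M) by rewrite sqr_sqrtr// ltW.
split => //.
- have : th ^+ 2 <= (4^-1) ^+ 2.
    by rewrite th2 ler_pdivrMr; lra.
  by rewrite ler_sqr ?nnegrE ?(ltW th0)// invr_ge0.
- by rewrite th2 le_eqVlt; apply/orP; left; apply/eqP; field; lra.
- rewrite mulrDr; set s := Num.sqrt (M * tau).
  have -> : th * (4 * s) = 2 * tau.
    rewrite /s (_ : M * tau = (th * (2 * M)) ^+ 2); last by rewrite exprMn th2; field; lra.
    rewrite sqrtr_sqr ger0_norm; last by rewrite mulr_ge0 ?ltW//; lra.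
    rewrite (_ : th * _ = th ^+ 2 * (8 * M)); last by ring.
    by rewrite th2; field; lra.
  by rewrite lerDr mulr_ge0 ?ltW//; lra.
Qed.

End NoncentralBall.

(** * Gaussian vectors with a fixed shift *)

Section Noncentral.
Context d (T : measurableType d) (R : realType) (P : probability T R).
Local Notation gauss := (gauss R).
Local Notation chi := (chi R).

Definition shifted_sumsq m (b y : nat -> R) := \sum_(i < m) (b i + y i) ^+ 2.

Lemma shifted_sumsqE m b y :
  shifted_sumsq m b y = dot m b b + 2 * dot m b y + sumsq m y.
Proof.
rewrite /shifted_sumsq /dot /sumsq mulr_sumr -!big_split /=.
by apply: eq_bigr => i _; ring.
Qed.

(** Rotating the shift onto the first axis, it enters through its norm only. *)
Lemma shifted_sumsq_rot m (b : nat -> R) (Y : nat -> T -> R) :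
  iid P setT m.+1 Y -> exists2 Y' : nat -> T -> R, iid P setT m.+1 Y' &
    forall w, shifted_sumsq m.+1 b (fun i => Y i w) =
      dot m.+1 b b + 2 * Num.sqrt (dot m.+1 b b) * Y' 0%N w
        + sumsq m.+1 (fun i => Y' i w).
Proof.
move=> iY; have [A [Ad A0 Ai Ap]] := align m.+1 b.
exists (fun i w => A (fun j => Y j w) i); first exact: Ap.
move=> w; rewrite shifted_sumsqE !sumsq_dot -Ad -[dot _ b (fun=> _)]Ad.
rewrite [dot _ (A b) (A b)]Ad; congr (_ + _ + _); last by rewrite Ad.
rewrite -mulrA; congr (_ * _); rewrite dotS A0// [dot m _ _]big1 ?addr0// => i _.
by rewrite /shift Ai ?mul0r//= ltnS.
Qed.

Lemma measurable_shifted_sumsq m (b : nat -> R) (Y : nat -> T -> R) :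
  (forall i, measurable_fun setT (Y i)) ->
  measurable_fun setT (fun w => shifted_sumsq m b (fun i => Y i w)).
Proof.
move=> mY; apply: measurable_sum => i; apply: measurable_funX.
exact: measurable_funD.
Qed.

(** After rotation the deviation is |b| ^ 2 + 2 |b| Y'_0 plus a centred
    chi-square variable; the cross term is at most |b| ^ 2 + Y'_0 ^ 2, and each
    of the two Gaussian quantities has an exponential tail. *)
Lemma shifted_concentration m (b : nat -> R) (tau : R) (Y : nat -> T -> R) :
  iid P setT m.+1 Y -> 0 < tau ->
  (P [set x | (2 * dot m.+1 b b + 12 * tau + 4 * Num.sqrt (m.+1%:R * tau) <
     `|shifted_sumsq m.+1 b (fun i => Y i x) - m.+1%:R|)%R]
   <= (4 * expR (- tau))%:E)%E.
Proof.
move=> iY t0.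
have [Y' iY' SE] := shifted_sumsq_rot b iY.
have [_ mY _] := iY; have [_ mY' _] := iY'.
set be := Num.sqrt _ in SE.
have be2 : be ^+ 2 = dot m.+1 b b by rewrite sqr_sqrtr// dot_ge0.
have M1 : 1 <= m.+1%:R :> R by rewrite ler1n.
have [th [th0 th4 thM thx]] := tail_exponent M1 t0.
set s := Num.sqrt _ in thx *.
pose U x := sumsq m.+1 (fun i => Y' i x).
have mU : measurable_fun setT U by exact: measurable_sumsq.
have mUc (a : R) : measurable_fun setT (fun x : R => a * (x - m.+1%:R)).
  by apply: measurable_funM => //; exact: measurable_funB.
have mE (a y : R) : measurable [set u : R | y <= a * (u - m.+1%:R)].
  exact: (measurable_preim (mUc a) (measurable_ray y)).
have mG : measurable [set y : R | 4 * tau <= y ^+ 2].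
  apply: (measurable_preim _ (A := [set y | 4 * tau <= y])); last exact: measurable_ray.
  exact: measurable_funX.
pose E1 := [set x | 4 * tau <= Y' 0%N x ^+ 2].
pose E2 := [set x | 2 * tau <= th * (U x - m.+1%:R)].
pose E3 := [set x | 2 * tau <= - th * (U x - m.+1%:R)].
have mE1 : measurable E1 by rewrite -[E1]setTI; exact: (mY' 0%N measurableT _ mG).
have mE2 : measurable E2 by rewrite -[E2]setTI; exact: (mU measurableT _ (mE th (2 * tau))).
have mE3 : measurable E3 by rewrite -[E3]setTI; exact: (mU measurableT _ (mE (- th) (2 * tau))).
have P1 : (P E1 <= (2 * expR (- tau))%:E)%E.
  have := iid_head iY' mG; rewrite setTI probability_setT mul1e => ->.
  apply: (le_trans (gauss_tail _)); rewrite lee_fin ler_wpM2r ?expR_ge0//.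
  rewrite -[leRHS]ger0_norm// -sqrtr_sqr ler_wsqrtr//; lra.
have P2 : (P E2 <= (expR (- tau))%:E)%E.
  have := chi_law iY' (mE th (2 * tau)); rewrite setTI probability_setT mul1e => ->.
  apply: (le_trans (chi_tail _ _ _)); first by rewrite gtr0_norm.
  rewrite lee_fin ler_expR; lra.
have P3 : (P E3 <= (expR (- tau))%:E)%E.
  have := chi_law iY' (mE (- th) (2 * tau)); rewrite setTI probability_setT mul1e => ->.
  apply: (le_trans (chi_tail _ _ _)); first by rewrite normrN gtr0_norm.
  rewrite lee_fin ler_expR sqrrN; lra.
apply: (@le_trans _ _ (P (E1 `|` (E2 `|` E3)))).
  apply: le_measure; rewrite ?inE.
  - apply: measurable_superlevel; apply: measurableT_comp => //.
    by apply: measurable_funB => //; exact: measurable_shifted_sumsq.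
  - by apply: measurableU => //; exact: measurableU.
  move=> x /=; apply: contraPP => /not_orP[n1 /not_orP[n2 n3]].
  apply/negP; rewrite -leNgt SE.
  have {}n1 : Y' 0%N x ^+ 2 < 4 * tau by rewrite ltNge; apply/negP.
  have {}n2 : th * (U x - m.+1%:R) < 2 * tau by rewrite ltNge; apply/negP.
  have {}n3 : - th * (U x - m.+1%:R) < 2 * tau by rewrite ltNge; apply/negP.
  rewrite -/(U x) -be2.
  have u1 : U x - m.+1%:R <= 8 * tau + 4 * s.
    by rewrite -(ler_pM2l th0); lra.
  have u2 : - (U x - m.+1%:R) <= 8 * tau + 4 * s.
    by rewrite -(ler_pM2l th0); lra.
  have y1 := sqr_ge0 (be + Y' 0%N x); have y2 := sqr_ge0 (be - Y' 0%N x).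
  rewrite ler_norml; apply/andP; split; nra.
apply: le_trans (measureU2 _ mE1 (measurableU _ _ mE2 mE3)) _.
have := leeD P1 (le_trans (measureU2 _ mE2 mE3) (leeD P2 P3)).
move=> /le_trans; apply; rewrite -!EFinD lee_fin; lra.
Qed.

End Noncentral.

Lemma shifted_small_ball (R : realType) : exists2 c : R, 0 < c &
  forall d (T : measurableType d) (P : probability T R) m (b : nat -> R) (w : R)
    (Y : nat -> T -> R), iid P setT m.+1 Y ->
  dot m.+1 b b <= 16^-1 -> 0 < w -> w <= Num.sqrt m.+1%:R ->
  ((c * w / Num.sqrt m.+1%:R)%:E <= P
     [set x | (m.+1%:R <= shifted_sumsq m.+1 b (fun i => Y i x) <= m.+1%:R + w)%R])%E.
Proof.
have [c c0 H] := noncentral_small_ball R; exists c => // d T P m b w Y iY bb w0 w1.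
have [Y' iY' SE] := shifted_sumsq_rot b iY.
set be := Num.sqrt _ in SE.
have be2 : be ^+ 2 = dot m.+1 b b by rewrite sqr_sqrtr// dot_ge0.
have be0 : 0 <= be by exact: sqrtr_ge0.
have be1 : be <= 4^-1 by nra.
apply: le_trans (H m be w _ w0 w1) _; first by rewrite be0.
have := chi_pair iY' (measurable_noncentral be m.+1%:R (m.+1%:R + w)).
rewrite setTI probability_setT mul1e => <-.
rewrite le_eqVlt; apply/orP; left; apply/eqP; congr (P _).
apply/seteqP; split => x /=; rewrite SE sumsqS /shift -be2;
  by rewrite (_ : (be + _) ^+ 2 + _ = be ^+ 2 + 2 * be * Y' 0%N x + (Y' 0%N x ^+ 2 + sumsq m (fun j => Y' j.+1 x)))//; ring.
Qed.

(** * Independent sigma-algebras as a product space *)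

Section SubSigmaAlgebra.
Context d (T : measurableType d) (R : realType) (P : probability T R).
Variables (G : set (set T)) (sG : <<s G >> `<=` measurable).

(** The identity of T, seen as a measurable map onto T equipped with a smaller
    sigma-algebra. Measurability with respect to a part of the randomness thus
    becomes measurability in the ordinary sense. *)
Definition coarsen : T -> g_sigma_algebraType G := id.

Lemma measurable_coarsen : measurable_fun setT coarsen.
Proof. by move=> _ A mA; rewrite setTI; exact: sG. Qed.

Definition coarsened_prob : probability (g_sigma_algebraType G) R :=
  distribution P (mfun_Sub (mem_set measurable_coarsen : coarsen \in mfun)).

Lemma measurable_fun_coarse (f : T -> R) :
  measurable_fun setT (f : g_sigma_algebraType G -> R) -> measurable_fun setT f.
Proof.
move=> mf; exact: (measurableT_comp (f := f : g_sigma_algebraType G -> R) mf measurable_coarsen).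
Qed.

End SubSigmaAlgebra.

(** Two independent sigma-algebras are two coordinates: the diagonal map has a
    product law. An event that involves both can then be estimated by freezing
    one of them. *)
Lemma independent_product d (T : measurableType d) (R : realType)
    (P : probability T R) (G1 G2 : set (set T))
    (s1 : <<s G1 >> `<=` measurable) (s2 : <<s G2 >> `<=` measurable) :
  independent_salgebras P <<s G1 >> <<s G2 >> ->
  forall F : set (g_sigma_algebraType G1 * g_sigma_algebraType G2),
    measurable F ->
    P [set w | F (w, w)] = (coarsened_prob P s1 \x coarsened_prob P s2)%E F.
Proof.
move=> ind F mF.
have := @pair_law _ _ _ T (g_sigma_algebraType G1) (g_sigma_algebraType G2) R P setT
  (@coarsen _ T G1) (@coarsen _ T G2) (coarsened_prob P s1) (coarsened_prob P s2)
  measurableT (measurable_coarsen s1) (measurable_coarsen s2) _ F mF.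
rewrite probability_setT setTI mul1e; apply => A B mA mB.
by rewrite setTI mul1e; exact: ind.
Qed.

(** * The size of a Gaussian bias *)

Section BiasTail.
Context d (T : measurableType d) (R : realType) (P : probability T R).

Lemma integral_iid_head (n : nat) (Y : nat -> T -> R) (f : R -> \bar R) :
  iid P setT n.+1 Y -> measurable_fun setT f -> (forall x, 0 <= f x)%E ->
  (\int[P]_w f (Y 0%N w) = \int[gauss R]_y f y)%E.
Proof.
move=> iY mf f0; have [_ mY _] := iY.
pose X := mfun_Sub (mem_set (mY 0%N) : Y 0%N \in mfun).
rewrite -[LHS](@ge0_integral_distribution _ _ _ _ _ P X f mf f0).
apply: eq_measure_integral => A mA _.
rewrite /distribution /pushforward.
have := iid_head iY mA; rewrite setTI probability_setT mul1e.
exact.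
Qed.

(** Bound exp from below by its tangent line at the weighted mean; the missing
    weight sits at the point 0. *)
Lemma expR_jensen (m : nat) (p y : nat -> R) :
  (forall k, 0 <= p k) -> \sum_(k < m) p k <= 1 ->
  expR (\sum_(k < m) p k * y k) <=
    \sum_(k < m) p k * expR (y k) + (1 - \sum_(k < m) p k).
Proof.
move=> p0 p1; set x := \sum_(k < m) p k * y k; set q := \sum_(k < m) p k.
have tan z : expR x * (1 + (z - x)) <= expR z.
  have := expR_ge1Dx (z - x).
  by rewrite -(ler_pM2l (expR_gt0 x)) -expRD subrKC.
have H1 : \sum_(k < m) p k * (expR x * (1 + (y k - x))) <= \sum_(k < m) p k * expR (y k).
  by apply: ler_sum => k _; exact: ler_wpM2l.
have E1 : \sum_(k < m) p k * (expR x * (1 + (y k - x))) = expR x * (q * (1 - x) + x).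
  rewrite /q mulr_suml /x -big_split /= mulr_sumr.
  by apply: eq_bigr => k _; ring.
have H2 := tan 0; rewrite expR0 in H2.
have H3 : (1 - q) * (expR x * (1 + (0 - x))) <= 1 - q.
  by rewrite -[leRHS]mulr1; apply: ler_wpM2l => //; rewrite subr_ge0.
rewrite E1 in H1; nra.
Qed.

Definition mxact (r : nat) (a : nat -> nat -> R) (x : nat -> R) : nat -> R :=
  fun k => dot r (a k) x.

(** Coordinate k of the bias is sqrt v_k times a standard Gaussian variable, with
    the v_k summing to at most V. By convexity with weights v_k / V,
    exp (|b| ^ 2 / 4 V) is at most an average of variables exp (g ^ 2 / 4) and
    of the constant 1, hence has mean at most sqrt 2, whatever the correlations
    between the coordinates; Markov's inequality concludes. *)
Lemma bias_tail (m r : nat) (a : nat -> nat -> R) (V tau : R) (xi : nat -> T -> R) :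
  iid P setT r.+1 xi -> 0 < V ->
  \sum_(k < m) dot r.+1 (a k) (a k) <= V ->
  (P [set w | (4 * V * tau <= dot m (mxact r.+1 a (fun j => xi j w))
      (mxact r.+1 a (fun j => xi j w)))%R] <= (2 * expR (- tau))%:E)%E.
Proof.
move=> ixi V0 aV; pose b w := mxact r.+1 a (fun j => xi j w); have [_ mxi _] := ixi.
(* the standard Gaussian variable behind coordinate k: rotate the row a k onto the first axis *)
have /choice[eta Heta] : forall k, exists e : T -> R,
    [/\ measurable_fun setT e, (\int[P]_w (expR (e w ^+ 2 / 4))%:E = (Num.sqrt 2)%:E)%E &
     forall w, b w k = Num.sqrt (dot r.+1 (a k) (a k)) * e w].
  move=> k; have [A [Ad A0 Ai Ap]] := align r.+1 (a k).
  have iA := Ap _ _ _ _ _ ixi; have [_ mA _] := iA.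
  exists (fun w => A (fun j => xi j w) 0%N); split.
  - exact: mA.
  - rewrite -gauss_exp_sqr.
    apply: (@integral_iid_head r _ (fun x => (expR (x ^+ 2 / 4))%:E) iA).
      apply/measurable_EFinP; apply: measurableT_comp => //.
      by apply: measurable_funM => //; exact: measurable_funX.
    by move=> x; rewrite lee_fin expR_ge0.
  - move=> w; rewrite /b /mxact -Ad dotS A0//; rewrite [X in _ + X]big1 ?addr0// => i _.
    by rewrite /shift Ai ?mul0r//= ltnS.
pose v k := dot r.+1 (a k) (a k).
pose p k := v k / V.
have p0 k : 0 <= p k by rewrite divr_ge0 ?dot_ge0 ?ltW.
have p1 : \sum_(k < m) p k <= 1 by rewrite -mulr_suml ler_pdivrMr// mul1r.
have bE w : dot m (b w) (b w) / (4 * V) = \sum_(k < m) p k * (eta k w ^+ 2 / 4).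
  rewrite /dot mulr_suml; apply: eq_bigr => k _.
  have [_ _ ->] := Heta k; rewrite /p /v.
  rewrite mulrACA -!expr2 sqr_sqrtr ?dot_ge0//; field; lra.
have me k : measurable_fun setT (fun w => expR (eta k w ^+ 2 / 4)).
  have [mk _ _] := Heta k.
  apply: measurableT_comp => //; apply: measurable_funM => //.
  exact: measurable_funX.
have mb k : measurable_fun setT (b^~ k).
  by apply: measurable_sum => i; exact: measurable_funM.
have mbb : measurable_fun setT (fun w => dot m (b w) (b w)).
  by apply: measurable_sum => i; exact: measurable_funM.
have mset : measurable [set w | 4 * V * tau <= dot m (b w) (b w)].
  by rewrite -[X in measurable X]setTI; exact: (mbb measurableT _ (measurable_ray (4 * V * tau))).
have mexp : measurable_fun setT (fun w => expR (dot m (b w) (b w) / (4 * V))).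
  by apply: measurableT_comp => //; exact: measurable_funM.
have I : (\int[P]_w (expR (dot m (b w) (b w) / (4 * V)))%:E <= 2%:E)%E.
  pose g w := \sum_(k < m) p k * expR (eta k w ^+ 2 / 4).
  have mg : measurable_fun setT g.
    by apply: measurable_sum => i; exact: measurable_funM.
  have g0 w : 0 <= g w by apply: sumr_ge0 => k _; rewrite mulr_ge0 ?expR_ge0.
  have q0 : 0 <= 1 - \sum_(k < m) p k by rewrite subr_ge0.
  have mgq : measurable_fun setT (fun w => g w + (1 - \sum_(k < m) p k)).
    exact: measurable_funD.
  apply: (le_trans (ge0_EFin_integral_le P mexp mgq (fun=> expR_ge0 _) _)).
    by move=> w; rewrite bE; exact: (@expR_jensen m p (fun k => eta k w ^+ 2 / 4)).
  rewrite (ge0_EFin_integralD P mg (measurable_cst _) g0 (fun=> q0)).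
  have -> : (\int[P]_w (g w)%:E = (\sum_(k < m) p k * Num.sqrt 2)%:E)%E.
    transitivity (\int[P]_w (\sum_(k < m) (p k * expR (eta k w ^+ 2 / 4))%:E))%E.
      by apply: eq_integral => w _; rewrite sumEFin.
    rewrite ge0_integral_sum//; first last.
    - by move=> k w _; rewrite lee_fin mulr_ge0 ?expR_ge0.
    - by move=> k; apply/measurable_EFinP; exact: measurable_funM.
    rewrite -sumEFin; apply: eq_bigr => k _.
    by rewrite (ge0_EFin_integralZl P (me k) (fun=> expR_ge0 _) (p0 k)); have [_ -> _] := Heta k.
  have -> : (\int[P]_x (1 - \sum_(k < m) p k)%:E = (1 - \sum_(k < m) p k)%:E)%E.
    by rewrite -[RHS]mule1 -(probability_setT P); exact: integral_cst.
  rewrite -EFinD lee_fin -mulr_suml.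
  have s2 : Num.sqrt 2 <= 2 :> R.
    rewrite -[leRHS]ger0_norm// -sqrtr_sqr ler_wsqrtr//; lra.
  have : (\sum_(k < m) p k) * Num.sqrt 2 <= (\sum_(k < m) p k) * 2.
    by apply: ler_wpM2l => //; exact: sumr_ge0.
  lra.
have mh : measurable_fun setT (fun w => expR (- tau) * expR (dot m (b w) (b w) / (4 * V))).
  exact: measurable_funM.
apply: (le_trans (measure_le_integral P mset mh _ _)).
- by move=> w; rewrite mulr_ge0 ?expR_ge0.
- move=> w /= H; rewrite -expRD expR_ge1// addrC subr_ge0.
  by rewrite ler_pdivlMr ?mulr_gt0// mulrC.
rewrite (ge0_EFin_integralZl P mexp (fun=> expR_ge0 _) (expR_ge0 _)).
rewrite [X in (_ <= X%:E)%E]mulrC EFinM.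
by rewrite lee_wpmul2l// lee_fin expR_ge0.
Qed.

End BiasTail.

(** * Deviation bounds for the idealized model *)

Section ModelSetup.
Context d (T : measurableType d) (R : realType) (P : probability T R).
Variables (G1 G2 : set (set T)).
Hypotheses (s1 : <<s G1 >> `<=` measurable) (s2 : <<s G2 >> `<=` measurable).
Hypothesis ind : independent_salgebras P <<s G1 >> <<s G2 >>.
Local Notation T1 := (g_sigma_algebraType G1).
Local Notation T2 := (g_sigma_algebraType G2).
Local Notation P1 := (coarsened_prob P s1).
Local Notation P2 := (coarsened_prob P s2).
Variables (m r : nat) (a : nat -> nat -> R) (V : R).
Variables (xi : nat -> T1 -> R) (Y : nat -> T2 -> R).
Hypotheses (ixi : iid P1 setT r.+1 xi) (iY : iid P2 setT m.+1 Y).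
Hypotheses (V0 : 0 < V) (aV : \sum_(k < m.+1) dot r.+1 (a k) (a k) <= V).

Let M : R := m.+1%:R.
Let b (w : T1) : nat -> R := mxact r.+1 a (fun j => xi j w).
Let S (z : T1 * T2) : R := shifted_sumsq m.+1 (b z.1) (fun k => Y k z.2).

Let mb k : measurable_fun setT (b^~ k).
Proof.
have [_ mxi _] := ixi; apply: measurable_sum => i; exact: measurable_funM.
Qed.

Let mbb : measurable_fun setT (fun w => dot m.+1 (b w) (b w)).
Proof. by apply: measurable_sum => i; exact: measurable_funM. Qed.

Let mS : measurable_fun setT S.
Proof.
have [_ mY _] := iY; apply: measurable_sum => k; apply: measurable_funX.
apply: measurable_funD.
  by apply: (measurableT_comp (mb k)).
by apply: (measurableT_comp (mY k)).
Qed.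

Let mA tau : measurable [set w | 4 * V * tau <= dot m.+1 (b w) (b w)].
Proof.
exact: (measurable_preim mbb (measurable_ray (4 * V * tau))).
Qed.

(** Freeze the bias b: outside of the event |b| ^ 2 >= 4 V tau, of probability at
    most 2 exp (- tau), shifted_concentration bounds the probability of a large
    deviation by 4 exp (- tau). *)
Lemma model_concentration (tau : R) : 0 < tau ->
  (P [set w | (8 * V * tau + 12 * tau + 4 * Num.sqrt (M * tau) < `|S (w, w) - M|)%R]
   <= (6 * expR (- tau))%:E)%E.
Proof.
move=> t0.
pose x := 8 * V * tau + 12 * tau + 4 * Num.sqrt (M * tau).
pose F := [set z | x < `|S z - M|].
have mF : measurable F.
  apply: measurable_superlevel; apply: measurableT_comp => //.
  exact: measurable_funB.
rewrite [leLHS](independent_product s1 s2 ind mF).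
have e0 : 0 <= 4 * expR (- tau) by rewrite mulr_ge0 ?expR_ge0.
apply: (le_trans (@product_measure_le _ _ _ _ _ P1 P2 F _ _ mF (mA tau) e0 _)).
  move=> w /= /negP; rewrite -ltNge => bw.
  apply: le_trans (shifted_concentration (b w) iY t0).
  apply: le_measure; rewrite ?inE.
  - exact: measurable_section.
  - have [_ mY _] := iY; apply: measurable_superlevel; apply: measurableT_comp => //.
    by apply: measurable_funB => //; exact: measurable_shifted_sumsq.
  - move=> z; rewrite /F /x /S /M /=; lra.
have := bias_tail tau ixi V0 aV.
move=> H; apply: (le_trans (leeD2r _ H)).
by rewrite -EFinD lee_fin; lra.
Qed.

(** Freeze the bias on the event |b| ^ 2 < 4 V, where |b| ^ 2 <= 1 / 16. Its
    probability is at least 1 - 2 / e >= 1 / 9. The conclusion of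
    shifted_small_ball is taken as a premise in order to name its constant,
    which must be chosen before the model. *)
Lemma model_small_ball (c w : R) : 0 < c ->
  (forall d (T : measurableType d) (P : probability T R) m (b : nat -> R) (w : R)
    (Y : nat -> T -> R), iid P setT m.+1 Y ->
    dot m.+1 b b <= 16^-1 -> 0 < w -> w <= Num.sqrt m.+1%:R ->
    ((c * w / Num.sqrt m.+1%:R)%:E <= P
     [set x | (m.+1%:R <= shifted_sumsq m.+1 b (fun i => Y i x) <= m.+1%:R + w)%R])%E) ->
  V <= 64^-1 -> 0 < w -> w <= Num.sqrt M ->
  ((9^-1 * (c * w / Num.sqrt M))%:E <= P [set x | (M <= S (x, x) <= M + w)%R])%E.
Proof.
move=> c0 Hc V1 w0 w1.
pose F := [set z | M <= S z <= M + w].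
have mF : measurable F.
  exact: (measurable_preim mS (measurable_seg M (M + w))).
rewrite [leRHS](independent_product s1 s2 ind mF).
have r0 : 0 <= c * w / Num.sqrt M.
  by rewrite !mulr_ge0 ?invr_ge0 ?sqrtr_ge0 ?ltW.
pose A := [set w | 4 * V * 1 <= dot m.+1 (b w) (b w)].
have PA : (9^-1%:E <= P1 (~` A))%E.
  have PA1 := bias_tail 1 ixi V0 aV.
  have e1 : 2 * expR (- 1) <= 8 / 9 :> R.
    have h1 : 1 + 2^-1 <= expR (2^-1 : R) by exact: expR_ge1Dx.
    have h2 : expR (2^-1 : R) * expR (2^-1) * expR (- 1) = 1.
      by rewrite -!expRD -[RHS]expR0; congr expR; lra.
    have h3 : 9 / 4 <= expR (2^-1 : R) * expR (2^-1) by nra.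
    have := ler_wpM2r (expR_ge0 (- 1 : R)) h3; rewrite h2; lra.
  rewrite (probability_setC _ (mA 1)).
  have Af : P1 A = (fine (P1 A))%:E by rewrite fineK// fin_num_measure//; exact: mA.
  rewrite -/A Af -EFinB lee_fin.
  have : (P1 A <= (8 / 9)%:E)%E by apply: (le_trans PA1); rewrite lee_fin.
  by rewrite Af lee_fin; lra.
apply: le_trans (@product_measure_ge _ _ _ _ _ P1 P2 F (~` A) _ mF (measurableC (mA 1)) r0 _).
  by rewrite EFinM; apply: lee_wpmul2r => //; rewrite lee_fin.
move=> y /= /negP; rewrite -ltNge => yb.
apply: (Hc _ _ P2 m (b y) w Y iY _ w0 w1); lra.
Qed.

End ModelSetup.

(** The deviation of model_concentration at tau = t + 5 is comparable to the
    claimed one if t or V is bounded below. If t >= K ^ (- 2) then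
    t + 5 <= (1 + 5 K ^ 2) t; if t >= 1 the factor 6 does. If t < 1 and
    V > 1 / 64, the deviation is at most 48 V + 96, and B >= V gives
    48 B + 96 * 64 B = 6192 B. *)
Lemma threshold_bound (R : realType) (V M t K B : R) :
  0 < V -> 1 <= M -> 0 < t -> 1 <= K ->
  V * t <= B -> V <= B -> Num.sqrt (t / M) <= B -> t / M <= B ->
  (K ^- 2 <= t) || (64^-1 < V) ->
  (8 * V * (t + 5) + 12 * (t + 5) + 4 * Num.sqrt (M * (t + 5))) / M <=
    (24 * (1 + 5 * K ^+ 2) + 6192 + K) * B.
Proof.
move=> V0 M1 t0 K1 X1 X11 X2 X3 big.
have M0 : 0 < M by lra.
have Mi1 : M^-1 <= 1 by rewrite invf_le1.
have Mi0 : 0 < M^-1 by rewrite invr_gt0.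
have B0 : 0 < B by lra.
have sE : Num.sqrt (M * (t + 5)) / M = Num.sqrt ((t + 5) / M).
  rewrite (_ : _ * (t + 5) = M ^+ 2 * ((t + 5) / M)); last by field; rewrite gt_eqF.
  by rewrite sqrtrM ?sqr_ge0// sqrtr_sqr gtr0_norm// mulrAC divff ?mul1r// gt_eqF.
rewrite 2!mulrDl -[4 * _ / M]mulrA sE.
have KB : 0 <= K * B by apply: mulr_ge0; lra.
have K2B : 0 <= K ^+ 2 * B by apply: mulr_ge0; [exact: sqr_ge0|lra].
have scaled k : 1 <= k -> t + 5 <= k * t ->
    8 * V * (t + 5) / M + 12 * (t + 5) / M + 4 * Num.sqrt ((t + 5) / M) <= 24 * k * B.
  move=> k1 tk.
  have g1 : V * (t + 5) / M <= k * B.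
    have h1 : V * (t + 5) / M <= V * (t + 5) by rewrite ler_piMr// mulr_ge0//; lra.
    have h2 : V * (t + 5) <= V * (k * t) by rewrite ler_pM2l.
    have h3 : k * (V * t) <= k * B by apply: ler_wpM2l => //; lra.
    lra.
  have g2 : (t + 5) / M <= k * B.
    have h1 : (t + 5) / M <= k * t / M by rewrite ler_pM2r.
    have h2 : k * (t / M) <= k * B by apply: ler_wpM2l => //; lra.
    lra.
  have g3 : Num.sqrt ((t + 5) / M) <= k * B.
    apply: (@le_trans _ _ (k * Num.sqrt (t / M))); last by apply: ler_wpM2l => //; lra.
    have k0 : 0 <= k by lra.
    have -> : k * Num.sqrt (t / M) = Num.sqrt (k ^+ 2 * (t / M)).
      by rewrite [RHS]sqrtrM ?sqr_ge0// sqrtr_sqr ger0_norm.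
    rewrite ler_wsqrtr// mulrA.
    rewrite ler_pM2r//; apply: (le_trans tk); rewrite ler_pM2r// expr2.
    by rewrite ler_peMr.
  lra.
case/orP: big => [tK|V64].
  have tk : t + 5 <= (1 + 5 * K ^+ 2) * t.
    have K20 : 0 < K ^+ 2 by rewrite exprn_gt0//; lra.
    have : K ^+ 2 * K ^- 2 <= K ^+ 2 * t by rewrite ler_pM2l.
    rewrite divff ?gt_eqF//; lra.
  apply: le_trans (scaled _ _ tk) _; first by rewrite lerDl mulr_ge0// sqr_ge0.
  lra.
have [t1|t1] := leP 1 t.
  apply: (le_trans (scaled 6 _ _)); lra.
have h1 : V * (t + 5) / M <= 6 * V.
  have h1 : V * (t + 5) / M <= V * (t + 5) by rewrite ler_piMr// mulr_ge0//; lra.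
  have h2 : V * (t + 5) <= V * 6 by rewrite ler_pM2l//; lra.
  lra.
have h2 : (t + 5) / M <= 6.
  have h2 : (t + 5) / M <= t + 5 by rewrite ler_piMr//; lra.
  lra.
have h3 : Num.sqrt ((t + 5) / M) <= 6.
  rewrite -[leRHS]ger0_norm// -sqrtr_sqr ler_wsqrtr//; lra.
lra.
Qed.

Lemma small_deviation_level (R : realType) (K t : R) : 1 <= K -> 0 < t -> t < K ^- 2 ->
  K * Num.sqrt t <= 1 /\ 1 - expR (- t) <= Num.sqrt t.
Proof.
move=> K1 t0 tK; set st := Num.sqrt t.
have K0 : 0 < K by exact: lt_le_trans K1.
have st2 : st ^+ 2 = t by rewrite sqr_sqrtr// ltW.
have st0 : 0 <= st by exact: sqrtr_ge0.
have Kst : K * st <= 1.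
  rewrite -[leRHS]sqrtr1 -[leLHS]ger0_norm ?mulr_ge0 ?(ltW K0)// -sqrtr_sqr.
  rewrite ler_wsqrtr// exprMn st2 mulrC -ler_pdivlMr ?mul1r ?exprn_gt0//.
  exact: ltW.
split=> //; have := expR_ge1Dx (- t).
have : st <= 1 by apply: le_trans Kst; rewrite ler_peMl.
nra.
Qed.

(** Concentration alone does not suffice: as t tends to 0 the allowed deviation
    tends to 0, while an exponential bound is useless once its right-hand side
    exceeds 1. For small t and small V the roles change. The required
    probability 1 - exp (- t) <= t is small, so it is enough that the sum of
    squares falls in the segment [M, M + K sqrt (t M)], which has probability at
    least sqrt t. *)
Lemma model_bound (R : realType) : exists2 C : R, 0 < C &
  forall d (T : measurableType d) (P : probability T R) (G1 G2 : set (set T))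
    (s1 : <<s G1 >> `<=` measurable) (s2 : <<s G2 >> `<=` measurable)
    (m r : nat) (a : nat -> nat -> R) (V : R)
    (xi : nat -> g_sigma_algebraType G1 -> R) (Y : nat -> g_sigma_algebraType G2 -> R),
  independent_salgebras P <<s G1 >> <<s G2 >> ->
  iid (coarsened_prob P s1) setT r.+1 xi ->
  iid (coarsened_prob P s2) setT m.+1 Y ->
  0 < V -> \sum_(k < m.+1) dot r.+1 (a k) (a k) <= V ->
  forall t : R, 0 < t ->
  ((1 - expR (- t))%:E <= P [set w |
     (`|shifted_sumsq m.+1 (mxact r.+1 a (fun j => xi j w)) (fun k => Y k w)
        / m.+1%:R - 1| <=
      C * Num.max (V * Num.max (Num.max 1 (Num.sqrt t)) t)
        (Num.max (Num.sqrt (t / m.+1%:R)) (t / m.+1%:R)))%R])%E.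
Proof.
have [c c0 Hc] := shifted_small_ball R.
(* K is large enough for the small-ball probability c K sqrt t / 9 to exceed sqrt t *)
pose K := Num.max 1 (9 / c).
have K1 : 1 <= K by rewrite /K le_max lexx.
have Kc : 1 <= 9^-1 * c * K.
  have : 9 / c <= K by rewrite /K le_max lexx orbT.
  rewrite ler_pdivrMr//; nra.
pose ka := 1 + 5 * K ^+ 2.
have ka1 : 1 <= ka by rewrite /ka; nra.
pose C := 24 * ka + 6192 + K.
have C1 : 0 <= 24 * ka + 6192 by lra.
exists C; first by rewrite ltr_wpDl//; exact: lt_le_trans K1.
move=> d T P G1 G2 s1 s2 m r a V xi Y ind ixi iY V0 aV t t0.
set M : R := m.+1%:R.
have M1 : 1 <= M by rewrite ler1n.
have M0 : 0 < M by exact: lt_le_trans M1.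
have K0 : 0 < K by exact: lt_le_trans K1.
have [_ mxi _] := ixi; have [_ mY _] := iY.
pose S (w : T) := shifted_sumsq m.+1 (mxact r.+1 a (fun j => xi j w)) (fun k => Y k w).
have mS : measurable_fun setT S.
  have mxi' j : measurable_fun setT (xi j : T -> R).
    exact: (measurable_fun_coarse s1 (mxi j)).
  have mY' k : measurable_fun setT (Y k : T -> R).
    exact: (measurable_fun_coarse s2 (mY k)).
  have mb k : measurable_fun setT (fun w : T => mxact r.+1 a (fun j => xi j w) k).
    by apply: measurable_sum => j; apply: measurable_funM => //; exact: mxi'.
  apply: measurable_sum => k; apply: measurable_funX; apply: measurable_funD.
    exact: mb.
  exact: mY'.
set X1 := V * _; set X2 := Num.sqrt _; set X3 := t / M.
set B := Num.max _ _.
have X1B : X1 <= B by rewrite /B le_max lexx.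
have X2B : X2 <= B by rewrite /B !le_max lexx orbT.
have X3B : X3 <= B by rewrite /B !le_max lexx !orbT.
have B0 : 0 <= B by apply: le_trans X2B; exact: sqrtr_ge0.
have X1t : V * t <= X1 by rewrite /X1 ler_wpM2l ?(ltW V0)// le_max lexx orbT.
have X11 : V <= X1 by rewrite /X1 -[leLHS]mulr1 ler_wpM2l ?(ltW V0)// !le_max lexx.
have mG : measurable [set w | `|S w / M - 1| <= C * B].
  apply: measurable_sublevel; apply: measurableT_comp => //.
  by apply: measurable_funB => //; exact: measurable_funM.
have SM w : `|S w / M - 1| = `|S w - M| / M.
  have -> : S w / M - 1 = (S w - M) / M by field; rewrite gt_eqF.
  by rewrite normrM normfV (gtr0_norm M0).
have [Hbig|] := boolP ((K ^- 2 <= t) || (64^-1 < V)).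
  pose tau := t + 5.
  have tau0 : 0 < tau by rewrite addr_gt0.
  have H := model_concentration ind ixi iY V0 aV tau0.
  have key := threshold_bound V0 M1 t0 K1 (le_trans X1t X1B) (le_trans X11 X1B) X2B X3B Hbig.
  rewrite -/tau -/ka -/C in key; set s := Num.sqrt _ in H key.
  (* the shift by 5 absorbs the factor 6 of model_concentration *)
  have e5 : 6 * expR (- tau) <= expR (- t).
    have h : 1 + 5 <= expR 5 :> R by exact: expR_ge1Dx.
    have E : expR (- t) = expR 5 * expR (- tau).
      by rewrite -expRD; congr expR; rewrite /tau; ring.
    rewrite E ler_pM2r ?expR_gt0//; lra.
  have HC : (P (~` [set w | (`|S w / M - 1| <= C * B)%R]) <= (expR (- t))%:E)%E.
    apply: (@le_trans _ _ (6 * expR (- tau))%:E); last by rewrite lee_fin.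
    apply: le_trans H; apply: le_measure; rewrite ?inE.
    - exact: measurableC.
    - apply: measurable_superlevel; apply: measurableT_comp => //.
      exact: measurable_funB.
    move=> w /= /negP; rewrite -ltNge SM => h.
    have := le_lt_trans key h; rewrite ltr_pM2r ?invr_gt0//.
  rewrite -(setCK [set w | _]) probability_setC; last exact: measurableC.
  rewrite -[P (~` _)]fineK ?fin_num_measure//; last exact: measurableC.
  rewrite -EFinB lee_fin lerD2l lerN2 -lee_fin fineK//.
  by rewrite fin_num_measure//; exact: measurableC.
rewrite negb_or -ltNge -leNgt => /andP[tK V64].
pose q := Num.sqrt M.
have q2 : q ^+ 2 = M by rewrite sqr_sqrtr// ltW.
have q0 : 0 < q by rewrite sqrtr_gt0.
pose st := Num.sqrt t.
have st0 : 0 < st by rewrite sqrtr_gt0.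
have [Kst st1] := small_deviation_level K1 t0 tK.
pose w := K * st * q.
have w0 : 0 < w by rewrite !mulr_gt0.
have w1 : w <= Num.sqrt M by rewrite -/q /w ler_piMl// ltW.
have H := model_small_ball ind ixi iY V0 aV c0 Hc V64 w0 w1.
apply: (@le_trans _ _ st%:E).
  by rewrite lee_fin.
apply: le_trans (le_trans H _).
  rewrite lee_fin -/M -/q /w.
  rewrite (_ : 9^-1 * _ = 9^-1 * c * K * st); last by field; rewrite gt_eqF.
  by rewrite ler_peMl// ltW.
apply: le_measure; rewrite ?inE => //.
  exact: (measurable_preim mS (measurable_seg M (M + w))).
move=> z /= /andP[z1 z2]; rewrite SM ler_pdivrMr// ger0_norm ?subr_ge0//.
apply: (@le_trans _ _ w); first by rewrite lerBlDl.
have -> : w = K * X2 * M.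
  rewrite /X2 sqrtrM ?(ltW t0)// sqrtrV ?(ltW M0)// -/q -/st /w -q2.
  by field; rewrite gt_eqF.
rewrite ler_pM2r//; apply: (@le_trans _ _ (K * B)).
  by apply: ler_wpM2l => //; exact: ltW.
by apply: ler_wpM2r => //; rewrite lerDr.
Qed.

(** * The inner product of square-integrable functions *)

Section SquareIntegrable.
Variable R : realType.
Local Notation mu := (leb01 R).
Implicit Types f g h : R -> R.

Lemma inL2_measurable f : inL2 f -> measurable_fun setT f.
Proof. by rewrite /inL2 inE => /andP[/[!inE]]. Qed.

Lemma inL2_integrable f g : inL2 f -> inL2 g ->
  mu.-integrable setT (EFin \o (fun x => f x * g x)).
Proof. by move=> f2 g2; apply/Lfun1_integrable; exact: Lfun2_mul_Lfun1. Qed.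

Lemma inL2P f : measurable_fun setT f ->
  mu.-integrable setT (EFin \o (fun x => f x * f x)) -> inL2 f.
Proof.
move=> mf /integrableP[_ foo]; rewrite /inL2 inE; apply/andP; split; rewrite inE//=.
rewrite /finite_norm unlock; apply: poweR_lty.
apply: le_lt_trans foo; rewrite le_eqVlt; apply/orP; left; apply/eqP.
apply: eq_integral => x _ /=; rewrite powR_mulrn// expr2 -normrM.
by [].
Qed.

Lemma ip2C f g : ip2 f g = ip2 g f.
Proof. by apply: eq_Rintegral => x _; rewrite mulrC. Qed.

Lemma ip2_ge0 f : 0 <= ip2 f f.
Proof. by apply: Rintegral_ge0 => x _; rewrite -expr2 sqr_ge0. Qed.

Lemma inL2Z (k : R) f : inL2 f -> inL2 (fun x => k * f x).
Proof.
move=> f2; apply: inL2P.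
  by apply: measurable_funM => //; exact: inL2_measurable.
have := integrableZl measurableT (k * k) (inL2_integrable f2 f2).
by apply: eq_integrable => // x _ /=; rewrite -EFinM mulrACA.
Qed.

Lemma inL2D f g : inL2 f -> inL2 g -> inL2 (fun x => f x + g x).
Proof.
move=> f2 g2; apply: inL2P.
  by apply: measurable_funD => //; exact: inL2_measurable.
have i1 := inL2_integrable f2 f2; have i2 := inL2_integrable g2 g2.
have i3 := integrableZl measurableT 2 (inL2_integrable f2 g2).
have := integrableD measurableT (integrableD measurableT i1 i2) i3.
by apply: eq_integrable => // x _ /=; rewrite -EFinM -!EFinD; congr (_%:E); ring.
Qed.

Lemma inL2_0 : inL2 (fun=> 0 : R).
Proof.
apply: inL2P => //.
have := @integrable0 _ _ R mu setT.
by apply: eq_integrable => // x _ /=; rewrite mulr0.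
Qed.

Lemma inL2_sum (I : Type) (s : seq I) (F : I -> R -> R) (c : I -> R) :
  (forall i, inL2 (F i)) -> inL2 (fun x => \sum_(i <- s) c i * F i x).
Proof.
move=> HF; elim: s => [|i s IH].
  by under eq_fun do rewrite big_nil; exact: inL2_0.
under eq_fun do rewrite big_cons.
by apply: inL2D => //; exact: inL2Z.
Qed.

Lemma ip2Dl f g h : inL2 f -> inL2 g -> inL2 h ->
  ip2 (fun x => f x + g x) h = ip2 f h + ip2 g h.
Proof.
move=> f2 g2 h2; rewrite /ip2 -RintegralD//; last 2 first.
- exact: inL2_integrable.
- exact: inL2_integrable.
by apply: eq_Rintegral => x _; rewrite mulrDl.
Qed.

Lemma ip2Zl (k : R) f h : inL2 f -> inL2 h ->
  ip2 (fun x => k * f x) h = k * ip2 f h.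
Proof.
move=> f2 h2; rewrite /ip2 -RintegralZl//; last exact: inL2_integrable.
by apply: eq_Rintegral => x _; rewrite mulrA.
Qed.

Lemma ip2_0l h : ip2 (fun=> 0) h = 0.
Proof.
rewrite /ip2; under eq_Rintegral do rewrite mul0r.
by rewrite Rintegral_cst ?mul0r.
Qed.

Lemma ip2_suml (I : Type) (s : seq I) (F : I -> R -> R) (c : I -> R) h :
  (forall i, inL2 (F i)) -> inL2 h ->
  ip2 (fun x => \sum_(i <- s) c i * F i x) h = \sum_(i <- s) c i * ip2 (F i) h.
Proof.
move=> HF h2; elim: s => [|i s IH].
  by rewrite big_nil; under eq_fun do rewrite big_nil; exact: ip2_0l.
rewrite big_cons; under eq_fun do rewrite big_cons.
by rewrite ip2Dl ?ip2Zl ?IH//; [exact: inL2Z|exact: inL2_sum].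
Qed.

Lemma ip2_sumr (I : Type) (s : seq I) (F : I -> R -> R) (c : I -> R) h :
  (forall i, inL2 (F i)) -> inL2 h ->
  ip2 h (fun x => \sum_(i <- s) c i * F i x) = \sum_(i <- s) c i * ip2 h (F i).
Proof.
move=> HF h2; rewrite ip2C ip2_suml//.
by apply: eq_bigr => i _; rewrite ip2C.
Qed.

Definition l2norm f : R := Num.sqrt (ip2 f f).

Lemma norm2E f : inL2 f -> norm2 f = (l2norm f)%:E.
Proof.
move=> f2; rewrite /norm2 /l2norm unlock.
have -> : (\int[mu]_x (`|(EFin \o f) x| `^ 2) = (ip2 f f)%:E)%E.
  rewrite /ip2 /Rintegral fineK; last first.
    by apply: integrable_fin_num => //; exact: inL2_integrable.
  by apply: eq_integral => x _ /=; rewrite powR_mulrn// real_normK ?num_real// expr2.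
by rewrite poweR_EFin powR12_sqrt// ip2_ge0.
Qed.

Lemma cauchy_schwarz f g : inL2 f -> inL2 g -> `|ip2 f g| <= l2norm f * l2norm g.
Proof.
move=> f2 g2.
have quad (l : R) : 0 <= ip2 f f - 2 * l * ip2 f g + l ^+ 2 * ip2 g g.
  have lg := inL2Z (- l) g2.
  have := ip2_ge0 (fun x => f x + - l * g x).
  rewrite ip2Dl//; last exact: inL2D.
  rewrite ip2Zl//; last exact: inL2D.
  rewrite ![ip2 _ (fun x => f x + - l * g x)]ip2C !ip2Dl// !ip2Zl// (ip2C g f).
  by rewrite expr2; lra.
have F0 := ip2_ge0 f; have G0 := ip2_ge0 g.
have H : ip2 f g ^+ 2 <= ip2 f f * ip2 g g.
  have [G|G] := eqVneq (ip2 g g) 0.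
    rewrite G mulr0; suff -> : ip2 f g = 0 by rewrite expr0n.
    apply/eqP/negP => /negP H0.
    have := quad ((ip2 f f + 1) / (2 * ip2 f g)); rewrite G mulr0 addr0.
    have -> : 2 * ((ip2 f f + 1) / (2 * ip2 f g)) * ip2 f g = ip2 f f + 1 by field.
    lra.
  have Gp : 0 < ip2 g g by rewrite lt0r G.
  have := quad (ip2 f g / ip2 g g).
  have -> : ip2 f f - 2 * (ip2 f g / ip2 g g) * ip2 f g + (ip2 f g / ip2 g g) ^+ 2 * ip2 g g
     = ip2 f f - ip2 f g ^+ 2 / ip2 g g by field.
  by rewrite subr_ge0 ler_pdivrMr.
by rewrite -sqrtrM// -sqrtr_sqr ler_wsqrtr.
Qed.

End SquareIntegrable.

(** * Step functions on a common grid *)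

Section Steps.
Variable R : realType.
Local Notation mu := (leb01 R).

(** Both step_fun and step_integral have this form: F is the indicator of x <= t,
    as a function of t, in the first case and the integrator in the second. An
    identity between two such expressions for all F thus refines the function
    and its integral at once. *)
Definition step_diff (h : step01 R) (F : R -> R) : R :=
  \sum_(i < step_size h) step_val h i *
    (F (step_node h i.+1) - F (step_node h i)).

Lemma step_fun_diff (h : step01 R) x :
  step_fun h x = step_diff h (fun t => (x <= t)%R%:R).
Proof.
apply: eq_bigr => i _; congr (_ * _); rewrite indicE.
have nd : step_node h i <= step_node h i.+1 by apply: step_node_nd.
rewrite (_ : (x \in _) = (step_node h i < x <= step_node h i.+1)); last first.
  by apply/idP/idP; rewrite inE /= in_itv.
have [xa|ax] /= := leP x (step_node h i).
  by rewrite (le_trans xa nd) subrr.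
by rewrite subr0.
Qed.

(** Sort all the nodes and remove duplicates; each step then telescopes over the
    grid cells it contains. The cells must be nondegenerate because increments
    of the Brownian motion are going to be divided by their standard
    deviations. *)
Lemma common_grid (M : nat) (h : nat -> step01 R) :
  exists N (tau : nat -> R) (al : nat -> nat -> R),
  [/\ forall i, 0 <= tau i <= 1, nondecreasing_seq tau,
      forall i, (i < N)%N -> tau i < tau i.+1 &
      forall k F, (k < M)%N ->
        step_diff (h k) F = \sum_(i < N) al k i * (F (tau i.+1) - F (tau i))].
Proof.
pose nodes k := [seq step_node (h k) i | i <- iota 0 (step_size (h k)).+1].
pose s := sort <=%R (undup (flatten [seq nodes k | k <- iota 0 M])).
have s_mem k i : (k < M)%N -> (i <= step_size (h k))%N -> step_node (h k) i \in s.
  move=> kM ik; rewrite mem_sort mem_undup; apply/flattenP.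
  exists (nodes k); first by apply/mapP; exists k => //; rewrite mem_iota.
  by apply/mapP; exists i => //; rewrite mem_iota.
have s01 x : x \in s -> 0 <= x <= 1.
  rewrite mem_sort mem_undup => /flattenP[_ /mapP[k _ ->] /mapP[i _ ->]].
  exact: step_node01.
have s_lt : sorted <%R s.
  by rewrite lt_sorted_uniq_le sort_uniq undup_uniq sort_le_sorted.
pose tau i := nth 1 s i.
have tau_lt i j : (i < j)%N -> (j < size s)%N -> tau i < tau j.
  move=> ij js; apply: (sorted_ltn_nth lt_trans 1 s_lt) => //; rewrite inE//.
  exact: ltn_trans js.
(* a cell gets the value of each step that covers it; the default value 1 of
   nth keeps tau nondecreasing and in [0, 1] beyond the last node *)
exists (size s).-1, tau, (fun k j => \sum_(i < step_size (h k)) step_val (h k) i *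
  ((index (step_node (h k) i) s <= j) && (j < index (step_node (h k) i.+1) s))%N%:R).
split.
- move=> i; have [si|si] := ltnP i (size s); first exact/s01/mem_nth.
  by rewrite /tau nth_default// ler01 lexx.
- apply/nondecreasing_seqP => i; have [si|si] := ltnP i.+1 (size s).
    by rewrite ltW// tau_lt.
  rewrite /tau [leRHS]nth_default//; have [si'|si'] := ltnP i (size s).
    by have /andP[] := s01 _ (mem_nth 1 si').
  by rewrite nth_default.
- by move=> i; rewrite ltn_predRL => si; exact: tau_lt.
move=> k F kM; under [RHS]eq_bigr do rewrite mulr_suml.
rewrite exchange_big /=; apply: eq_bigr => i _.
under eq_bigr do rewrite -mulrA.
rewrite -mulr_sumr; congr (_ * _).
set p := index _ _; set q := index _ _.
have ps : (p < size s)%N by rewrite index_mem s_mem// ltnW.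
have qs : (q < size s)%N by rewrite index_mem s_mem.
have tp : tau p = step_node (h k) i by rewrite /tau nth_index// s_mem// ltnW.
have tq : tau q = step_node (h k) i.+1 by rewrite /tau nth_index// s_mem.
have pq : (p <= q)%N.
  rewrite leqNgt; apply/negP => qp; have := tau_lt _ _ qp ps.
  by rewrite tp tq ltNge step_node_nd.
have -> : F (step_node (h k) i.+1) - F (step_node (h k) i) =
    \sum_(p <= j < q) (F (tau j.+1) - F (tau j)).
  by rewrite (telescope_sumr (F \o tau) pq) /= tp tq.
rewrite (big_nat_widen _ _ (size s).-1); last by rewrite -ltnS (leq_trans qs)// leqSpred.
rewrite (big_nat_widenl _ 0)// big_mkcond big_mkord; apply: eq_bigr => j _ /=.
by rewrite andbC; case: ifP => _; [rewrite mul1r|rewrite mul0r].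
Qed.

Lemma step_fun_grid (h : step01 R) N tau al :
  (forall i, 0 <= tau i <= 1) -> nondecreasing_seq tau ->
  (forall F, step_diff h F = \sum_(i < N) al i * (F (tau i.+1) - F (tau i))) ->
  forall x, step_fun h x =
    \sum_(i < N) al i * \1_(`]tau i, tau i.+1]%classic : set R) x.
Proof.
move=> t01 tnd H x; rewrite step_fun_diff H; apply: eq_bigr => i _; congr (_ * _).
have nd : tau i <= tau i.+1 by apply: tnd.
rewrite indicE (_ : (x \in _) = (tau i < x <= tau i.+1)); last first.
  by apply/idP/idP; rewrite inE /= in_itv.
have [xa|ax] /= := leP x (tau i); first by rewrite (le_trans xa nd) subrr.
by rewrite subr0.
Qed.

Lemma inL2_indic (A : set R) : measurable A -> inL2 (\1_A : R -> R).
Proof.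
move=> mA; apply: inL2P; first exact: measurable_indic.
apply: (le_integrable measurableT _ _ (finite_measure_integrable_cst mu 1 measurableT)).
  by apply/measurable_EFinP; apply: measurable_funM; exact: measurable_indic.
by move=> x _; rewrite /= lee_fin indicE; case: (x \in A); rewrite ?mulr1 ?mulr0 ?normr0 ?normr1.
Qed.

Lemma ip2_indic (A B : set R) : measurable A -> measurable B ->
  ip2 (\1_A : R -> R) (\1_B) = fine (mu (A `&` B)).
Proof.
move=> mA mB; rewrite /ip2 /Rintegral; congr fine.
rewrite -[A `&` B]setIT -[RHS](@integral_indic _ _ R mu)//; last exact: measurableI.
by apply: eq_integral => x _; rewrite indicI.
Qed.

Lemma leb01_oc (a b : R) : 0 <= a -> a <= b -> b <= 1 ->
  mu `]a, b]%classic = (b - a)%:E.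
Proof.
move=> a0 ab b1; rewrite /leb01 /mrestr (_ : _ `&` _ = `]a, b]%classic); last first.
  apply/seteqP; split => x /=; first by case.
  rewrite !in_itv/= => /andP[ax xb]; split; first by rewrite ax.
  by apply/andP; split; lra.
rewrite lebesgue_measure_itv/= lte_fin; case: ifPn => //.
by rewrite -leNgt => ba; have -> : b - a = 0 by lra.
Qed.

Lemma inL2_oc (a b : R) : inL2 (\1_(`]a, b]%classic : set R) : R -> R).
Proof. by apply: inL2_indic; exact: measurable_itv. Qed.

Lemma inL2_step (h : step01 R) : inL2 (step_fun h).
Proof.
exact: (@inL2_sum R _ (index_enum 'I_(step_size h))
  (fun i : 'I_(step_size h) => \1_(`]step_node h i, step_node h i.+1]%classic : set R))
  (fun i => step_val h i) (fun i => inL2_oc _ _)).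
Qed.

Lemma ip2_grid N (tau : nat -> R) (al be : nat -> R) :
  (forall i, 0 <= tau i <= 1) -> nondecreasing_seq tau ->
  ip2 (fun x => \sum_(i < N) al i * \1_(`]tau i, tau i.+1]%classic : set R) x)
      (fun x => \sum_(i < N) be i * \1_(`]tau i, tau i.+1]%classic : set R) x) =
  \sum_(i < N) al i * be i * (tau i.+1 - tau i).
Proof.
move=> t01 tnd.
pose I (i : 'I_N) : R -> R := \1_(`]tau i, tau i.+1]%classic : set R).
have I2 i : inL2 (I i) by exact: inL2_oc.
have := @ip2_suml R _ (index_enum 'I_N) I al (fun x => \sum_(i < N) be i * I i x) I2.
move=> ->; last exact: (@inL2_sum R _ _ I be I2).
apply: eq_bigr => i _; rewrite -mulrA; congr (_ * _).
rewrite (@ip2_sumr R _ (index_enum 'I_N) I be (I i) I2)// (bigD1 i)//= big1 ?addr0.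
  congr (_ * _); rewrite ip2_indic; [|exact: measurable_itv|exact: measurable_itv].
  have /andP[ti _] := t01 i; have /andP[_ ti1] := t01 i.+1.
  by rewrite setIid leb01_oc//; exact: tnd.
move=> j ji; rewrite ip2_indic; [|exact: measurable_itv|exact: measurable_itv].
rewrite (_ : _ `&` _ = set0) ?measure0 ?mulr0//.
apply/seteqP; split => // x /=; rewrite !in_itv/= => -[/andP[a1 a2] /andP[b1 b2]].
move: ji; rewrite -val_eqE/= neq_ltn => /orP[ji|ij].
  by have := tnd _ _ ji; rewrite leNgt (lt_le_trans a1 b2).
by have := tnd _ _ ij; rewrite leNgt (lt_le_trans b1 a2).
Qed.

End Steps.

(** * From the process to independent Gaussian increments *)

Section GeneratedSigmaAlgebra.
Context d (T : measurableType d) (R : realType) (I : Type) (D : set I)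
  (Y : I -> T -> R).

(** The generators of generated_salgebra, named separately because
    g_sigma_algebraType takes a family of generators. *)
Definition gen_sets : set (set T) :=
  \bigcup_(i in D) preimage_set_system [set: T] (Y i) measurable.

Lemma gen_sets_sub : (forall i, D i -> measurable_fun setT (Y i)) ->
  <<s gen_sets >> `<=` measurable.
Proof.
move=> mY; apply: smallest_sub; first exact: sigma_algebra_measurable.
by move=> _ [i Di [B mB <-]]; exact: mY.
Qed.

Lemma gen_sets_measurable i : D i ->
  measurable_fun setT (Y i : g_sigma_algebraType gen_sets -> R).
Proof.
by move=> Di _ B mB; apply: sub_sigma_algebra; exists i => //; exists B.
Qed.

End GeneratedSigmaAlgebra.

Section IidFromIndependence.
Context d (T : measurableType d) (R : realType) (P : probability T R).

Lemma box_mem n (Y : nat -> T -> R) B w :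
  box n Y B w <-> forall i, (i < n)%N -> B i (Y i w).
Proof.
elim: n Y B => [|n IH] Y B /=; first by split.
split => [[B0 /IH Bn] [|i]|H] //; first exact: Bn.
by split; [exact: H|apply/IH => i ni; exact: H].
Qed.

Lemma gauss_boxE n (B : nat -> set R) : gauss_box n B = (\prod_(i < n) gauss R (B i))%E.
Proof.
elim: n B => [|n IH] B /=; first by rewrite big_ord0.
by rewrite big_ord_recl IH.
Qed.

Lemma iid_of_independent n (Y : nat -> T -> R) :
  (forall i, measurable_fun setT (Y i)) ->
  mutually_independent P (fun i : 'I_n => Y i) ->
  (forall i, (i < n)%N -> forall B, measurable B -> P (Y i @^-1` B) = gauss R B) ->
  iid P setT n Y.
Proof.
move=> mY ind law; split => // B mB.
rewrite setTI probability_setT mul1e gauss_boxE.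
transitivity (P (\bigcap_(i in [set: 'I_n]) (Y i @^-1` B i))).
  congr (P _); apply/seteqP; split => w.
    by move=> /box_mem H i _; exact: H.
  by move=> H; apply/box_mem => i ni; exact: (H (Ordinal ni) I).
rewrite (ind (fun i : 'I_n => B i))//; apply: eq_bigr => i _; exact: law.
Qed.

End IidFromIndependence.

Section NormalScaling.
Variable R : realType.

Lemma normal_prob_scale (s : R) (B : set R) : 0 < s -> measurable B ->
  normal_prob 0 s [set x | B (s^-1 * x)] = gauss R B.
Proof.
move=> s0 mB; have sn : s != 0 by rewrite gt_eqF.
pose A := [set x : R | B (s^-1 * x)].
have mA : measurable A by apply: measurable_preim => //; exact: measurable_funM.
have mi (C : set R) : measurable C -> measurable_fun setT (fun x : R => (\1_C x)%:E : \bar R).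
  by move=> mC; apply/measurable_EFinP; exact: measurable_indic.
have mp : measurable_fun setT (fun x : R => (normal_pdf 0 s x)%:E).
  by apply/measurable_EFinP; exact: measurable_normal_pdf.
pose f (x : R) := ((\1_A x)%:E * (normal_pdf 0 s x)%:E)%E.
have mf : measurable_fun setT f by apply: emeasurable_funM => //; exact: mi.
have f0 x : (0 <= f x)%E by rewrite mule_ge0// lee_fin ?normal_pdf_ge0.
transitivity (\int[leb (R:=R)]_x f x)%E.
  rewrite (ge0_integral_leb mf f0) /normal_prob [LHS]integral_mkcond.
  by apply: eq_integral => x _; rewrite epatch_indic muleC.
rewrite (ge0_integral_affine 0 sn mf f0).
have mfa : measurable_fun setT (fun x => f (s * x + 0)).
  by apply: (measurableT_comp mf); exact: measurable_affine.
have s0' : (0 <= `|s|%:E :> \bar R)%E by rewrite lee_fin.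
rewrite -(@ge0_integralZl _ _ _ (leb (R:=R)) setT measurableT _ mfa _ (fun x _ => f0 _) s0').
rewrite -(integral_indicT (gauss R) mB) (ge0_integral_gauss (mi B mB)); last first.
  by move=> x; rewrite lee_fin.
apply: eq_integral => x _; rewrite /f addr0 muleCA.
have -> : \1_A (s * x) = \1_B x :> R.
  rewrite !indicE; suff -> : (s * x \in A) = (x \in B) by [].
  by apply/idP/idP; rewrite !inE /A /= mulKf.
congr (_ * _)%E; rewrite -EFinM; congr _%:E.
rewrite /gpdf /normal_pdf (negbTE sn) oner_eq0 gtr0_norm//.
rewrite mulrA; congr (_ * _); last first.
  rewrite /normal_fun !subr0; congr expR; rewrite expr1n exprMn.
  by field; rewrite sn.
rewrite /normal_peak expr1n mul1r -mulrnAr sqrtrM ?sqr_ge0// sqrtr_sqr gtr0_norm//.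
by rewrite invfM mulrA divff// mul1r.
Qed.

End NormalScaling.

Section Tightness.
Variable R : realType.

Lemma tight d (T : measurableType d) (P : probability T R) (X : T -> R) (eps : R) :
  measurable_fun setT X -> 0 < eps ->
  exists2 K, 0 < K & (P [set w | (K < `|X w|)%R] <= eps%:E)%E.
Proof.
move=> mX e0.
have mabs : measurable_fun setT (fun w => `|X w|) by exact: measurableT_comp.
have mgt K : measurable [set w | K < `|X w|] by exact: measurable_superlevel.
pose F n := [set w | n%:R < `|X w|].
have F0 : \bigcap_n F n = set0.
  apply/seteqP; split => // w H.
  have := H (Num.truncn `|X w|).+1 I; rewrite /F /=.
  by rewrite ltNge ltW// truncnS_gt.
have := @nonincreasing_cvg_mu _ _ _ P F.
rewrite F0 measure0 => /(_ _ _ _ _)/fine_cvgP[].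
- by rewrite -ge0_fin_numE// fin_num_measure//; exact: mgt.
- by move=> n; exact: mgt.
- exact: measurable0.
- move=> n m nm; apply/subsetPset => w; rewrite /F /=.
  by apply: le_lt_trans; rewrite ler_nat.
move=> _ /cvgrPdist_le/(_ eps e0)[n _ Hn].
exists n.+1%:R; first by rewrite ltr0n.
have := Hn n.+1 (leqnSn n); rewrite /= sub0r normrN.
have Pf : P (F n.+1) \is a fin_num by rewrite fin_num_measure//; exact: mgt.
by rewrite -/(F n.+1) -(fineK Pf) lee_fin; apply: le_trans; exact: ler_norm.
Qed.

Lemma union_bound d (T : measurableType d) (P : probability T R)
    (M : nat) (A : nat -> set T) (delta : R) :
  (forall k, (k < M)%N -> measurable (A k)) ->
  (forall k, (k < M)%N -> (P (A k) <= delta%:E)%E) ->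
  let U := [set w | exists2 k, (k < M)%N & A k w] in
  measurable U /\ (P U <= (M%:R * delta)%:E)%E.
Proof.
elim: M => [|M IH] mA PA /=.
  rewrite (_ : [set w | _] = set0); last by apply/seteqP; split => // w [].
  by rewrite measure0 mul0r; split => //; exact: measurable0.
have [k kM|k kM|mU PU] := IH; [exact/mA/ltnW|exact/PA/ltnW|].
have mAM := mA M (ltnSn M).
rewrite (_ : [set w | _] = [set w | exists2 k, (k < M)%N & A k w] `|` A M); last first.
  apply/seteqP; split => w /=.
    move=> [k]; rewrite ltnS leq_eqVlt => /orP[/eqP ->|kM Ak]; first by right.
    by left; exists k.
  by move=> [[k kM Ak]|AM]; [exists k => //; exact: ltnW|exists M].
split; first exact: measurableU.
apply: le_trans (measureU2 _ mU mAM) _.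
rewrite -natr1 mulrDl mul1r EFinD; apply: leeD => //; exact: PA.
Qed.

Lemma cvge0_lt (u : nat -> \bar R) (eps : R) : u n @[n --> \oo] --> 0%E ->
  0 < eps -> \forall n \near \oo, (u n < eps%:E)%E.
Proof.
move=> cu e0; apply: (cu [set x | (x < eps%:E)%E]).
by apply: open_ereal_lt'; rewrite lte_fin.
Qed.

End Tightness.

Section BrownianIncrements.
Context d (T : measurableType d) (R : realType) (P : probability T R).
Variable W : R -> {RV P >-> R}.
Hypothesis brownW : standard_brownian01 W.

Lemma brownian_iid N (tau : nat -> R) :
  (forall i, 0 <= tau i <= 1) -> nondecreasing_seq tau ->
  (forall i, (i < N)%N -> tau i < tau i.+1) ->
  iid P setT N (fun i w =>
    (Num.sqrt (tau i.+1 - tau i))^-1 * (W (tau i.+1) w - W (tau i) w)).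
Proof.
move=> t01 tnd tlt; case: brownW => _ Wind Wlaw _.
apply: iid_of_independent.
- by move=> i; apply: measurable_funM => //; exact: measurable_funB.
- move=> B mB.
  pose B' (i : 'I_N) := [set x | B i ((Num.sqrt (tau i.+1 - tau i))^-1 * x)].
  have mB' i : measurable (B' i).
    by apply: (measurable_preim _ (mB i)); exact: measurable_funM.
  exact: (Wind N tau t01 tnd B' mB').
- move=> i iN B mB.
  have /andP[ti _] := t01 i; have /andP[_ ti1] := t01 i.+1.
  have s0 : 0 < Num.sqrt (tau i.+1 - tau i) by rewrite sqrtr_gt0 subr_gt0 tlt.
  rewrite -(normal_prob_scale s0 mB).
  apply: (Wlaw _ _ ti (tlt _ iN) ti1).
  by apply: (measurable_preim _ mB); exact: measurable_funM.
Qed.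

End BrownianIncrements.

Section StepIntegralOfModel.
Variable R : realType.
Local Notation mu := (leb01 R).

Lemma itv_integral (S : R -> R) (t : R) : inL2 S ->
  \int[mu]_(u in `[0, t]) S u = ip2 (\1_(`[0, t]%classic : set R)) S.
Proof.
move=> S2; rewrite Rintegral_mkcond; apply: eq_Rintegral => x _.
by rewrite patch_indic mulrC.
Qed.

(** A step integral is linear in the integrator, and integrating a step function
    against the primitive of S is the scalar product with S. *)
Lemma step_integral_model (T : Type) (X : R -> T -> R) (W : R -> T -> R) (w : T)
    (S : R -> R) (sigma : R) : inL2 S ->
  (forall t, 0 <= t <= 1 ->
     X t w = X 0 w + \int[mu]_(u in `[0, t]) S u + sigma * W t w) ->
  forall h : step01 R, step_integral X h w =
    ip2 (step_fun h) S + sigma * step_diff h (W^~ w).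
Proof.
move=> S2 HX h.
pose I (i : 'I_(step_size h)) : R -> R :=
  \1_(`]step_node h i, step_node h i.+1]%classic : set R).
have I2 i : inL2 (I i) by exact: inL2_oc.
have -> : ip2 (step_fun h) S = \sum_(i < step_size h) step_val h i * ip2 (I i) S.
  exact: (@ip2_suml R _ (index_enum 'I_(step_size h)) I (fun i => step_val h i) S I2 S2).
rewrite /step_diff mulr_sumr -big_split /=; apply: eq_bigr => i _.
rewrite mulrCA -mulrDr; congr (_ * _).
have t01 := step_node01 h i; have t01' := step_node01 h i.+1.
have nd : step_node h i <= step_node h i.+1 by apply: step_node_nd.
rewrite (HX _ t01) (HX _ t01') !itv_integral//.
have J2 (t : R) : inL2 (\1_(`[0, t]%classic : set R) : R -> R).
  by apply: inL2_indic; exact: measurable_itv.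
have -> : ip2 (\1_(`[0, step_node h i.+1]%classic : set R)) S =
    ip2 (\1_(`[0, step_node h i]%classic : set R)) S + ip2 (I i) S.
  rewrite -ip2Dl//; congr (ip2 _ S); apply/funext => x; rewrite /I !indicE.
  have -> : (x \in `[0, step_node h i.+1]%classic) = (0 <= x <= step_node h i.+1).
    by apply/idP/idP; rewrite inE /= in_itv.
  have -> : (x \in `[0, step_node h i]%classic) = (0 <= x <= step_node h i).
    by apply/idP/idP; rewrite inE /= in_itv.
  have -> : (x \in `]step_node h i, step_node h i.+1]%classic) =
      (step_node h i < x <= step_node h i.+1).
    by apply/idP/idP; rewrite inE /= in_itv.
  move: t01 => /andP[t0 _].
  have [xt|tx] /= := leP x (step_node h i).
    by rewrite (le_trans xt nd) andbT addr0.
  by rewrite (le_trans t0 (ltW tx)) /= add0r.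
by ring.
Qed.

End StepIntegralOfModel.

(** * Gaussian approximation of the observed coefficients *)

Lemma iid_coordinate d (T : measurableType d) (R : realType) (P : probability T R)
    E n (Y : nat -> T -> R) k B : iid P E n Y -> (k < n)%N -> measurable B ->
  P (E `&` Y k @^-1` B) = (P E * gauss R B)%E.
Proof.
move=> [mE mY H] kn mB.
pose D i := if i == k then B else setT.
have mD i : measurable (D i) by rewrite /D; case: ifP.
have Dk : D k = B by rewrite /D eqxx.
have := H D mD; rewrite gauss_boxE (bigD1 (Ordinal kn))//= Dk big1 ?mule1; last first.
  move=> i; rewrite -val_eqE /= /D => /negbTE ->; exact: probability_setT.
move=> <-; congr (P (_ `&` _)); apply/seteqP; split => w.
  by move=> Bw; apply/box_mem => i ni; rewrite /D; case: eqP => // ->.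
by move=> /box_mem /(_ k kn); rewrite /D eqxx.
Qed.

Section GaussianApproximation.
Context d (T : measurableType d) (R : realType) (P : probability T R).
Local Notation mu := (leb01 R).
Variables (e : nat -> R -> R) (m r L : nat) (sigma : R).
Variables (lambda : 'I_r -> R) (phi : 'I_r -> R -> R) (xi : 'I_r -> {RV P >-> R}).
Variables (W X : R -> {RV P >-> R}) (Z : nat -> {RV P >-> R}).
Hypothesis basis_e : orthonormal_basis e.
Hypothesis sigma0 : 0 < sigma.
Hypothesis ortho_phi : orthonormal_family [set: 'I_r] phi.
Hypothesis brownW : standard_brownian01 W.
Hypothesis modelX : {ae P, forall w, forall t, 0 <= t <= 1 ->
   X t w = X 0 w
           + \int[mu]_(u in `[0, t]) signal lambda (fun k => xi k : T -> R) phi w u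
           + sigma * W t w}.
Hypothesis integralZ : forall k, (1 <= k)%N ->
   is_stochastic_integral P (fun t => X t : T -> R) (e k) (Z k).

Let GW := gen_sets `[0, 1]%classic (fun t => W t : T -> R).
Hypothesis sW : <<s GW >> `<=` measurable.

Definition bias (k : nat) (w : T) : R :=
  \sum_(j < r) Num.sqrt (lambda j) * xi j w * ip2 (e (L + k.+1)%N) (phi j).

Lemma measurable_bias k : measurable_fun setT (bias k).
Proof.
by apply: measurable_sum => j; apply: measurable_funM => //; exact: measurable_funM.
Qed.

Let M : R := m.+1%:R.

Let ek_inL2 k : inL2 (e (L + k.+1)%N).
Proof. by case: basis_e => -[H _] _; apply: H; rewrite /= addnS. Qed.

Let phi_inL2 j : inL2 (phi j).
Proof. by case: ortho_phi => H _; exact: H. Qed.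

Let l2norm_phi j : l2norm (phi j) = 1.
Proof. by case: ortho_phi => _ H; rewrite /l2norm H// eqxx sqrtr1. Qed.

Let ip_ek k l : ip2 (e (L + k.+1)%N) (e (L + l.+1)%N) = (k == l)%:R.
Proof.
case: basis_e => -[_ H] _; rewrite H ?eqn_add2l ?eqSS//; by rewrite /= addnS.
Qed.

Let l2norm_ek k : l2norm (e (L + k.+1)%N) = 1.
Proof. by rewrite /l2norm ip_ek eqxx sqrtr1. Qed.

Let inL2B f g : inL2 f -> inL2 g -> inL2 (fun x : R => f x - g x).
Proof.
move=> f2 g2; have := inL2D f2 (inL2Z (-1) g2).
by congr inL2; apply/funext => x; rewrite mulN1r.
Qed.

Let ip2Bl f g h : inL2 f -> inL2 g -> inL2 h ->
  ip2 (fun x : R => f x - g x) h = ip2 f h - ip2 g h.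
Proof.
move=> f2 g2 h2; rewrite -[in RHS]mulN1r -ip2Zl// -ip2Dl//; last exact: inL2Z.
by congr (ip2 _ h); apply/funext => x; rewrite mulN1r.
Qed.

Let ip2Br f g h : inL2 f -> inL2 g -> inL2 h ->
  ip2 h (fun x : R => f x - g x) = ip2 h f - ip2 h g.
Proof. by move=> f2 g2 h2; rewrite ip2C ip2Bl// !(ip2C h). Qed.

Let choose_step (eta delta rho : R) k : 0 < eta -> 0 < delta -> 0 < rho ->
  exists h : step01 R, l2norm (fun x => step_fun h x - e (L + k.+1)%N x) <= eta /\
    (P [set w | (rho <= `|step_integral (fun t => X t : T -> R) h w - Z (L + k.+1)%N w|)%R]
      <= delta%:E)%E.
Proof.
move=> eta0 delta0 rho0.
have k1 : (1 <= L + k.+1)%N by rewrite addnS.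
have [h [h1 h2]] := integralZ k1.
have n1 := cvge0_lt h1 eta0; have n2 := cvge0_lt (h2 _ rho0) delta0.
near \oo => n.
exists (h n); split; last by apply: ltW; near: n.
have : (norm2 (fun x => (step_fun (h n) x - e (L + k.+1)%N x)%R) < eta%:E)%E by near: n.
rewrite norm2E; first by rewrite lte_fin => /ltW.
by apply: inL2B => //; exact: inL2_step.
Unshelve. all: by end_near. Qed.

(** Choose step functions h_k close to the e_(L + k + 1) with integrals against X
    close to the Z, and put them on one grid. The integral of h_k splits into
    <h_k, signal>, close to the bias, and sigma times a scalar product of the
    normalized increments of W with a vector whose Gram matrix is that of the
    h_k, hence almost the identity. near_orthonormal replaces these products by
    exactly independent Gaussian variables Y_k. As functions of the increments
    they are measurable for the sigma-algebra of W, and this is what keeps them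
    independent of the signal.

    Each of the three errors is at most eps / (3 M), except on events of total
    probability at most 3 eps / 4 and on a null set outside of which the model
    equation holds. *)
Lemma gaussian_approx (eps : R) : 0 < eps ->
  exists2 Y : nat -> g_sigma_algebraType GW -> R,
    iid (coarsened_prob P sW) setT m.+1 Y &
    (P [set w | (eps < \sum_(k < m.+1)
        `|Z (L + k.+1)%N w - (bias k w + sigma * Y k w)|)%R] <= eps%:E)%E.
Proof.
move=> eps0.
have M1 : 1 <= M by rewrite ler1n.
have M0 : 0 < M by lra.
have M3 : 0 < 3 * M by lra.
have M4 : 0 < 4 * M by lra.
have e4 : 0 < eps / 4 by lra.
(* bounds the dependence of the bias on the random weights xi *)
pose Xi w := \sum_(j < r) Num.sqrt (lambda j) * `|xi j w|.
have mXi : measurable_fun setT Xi.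
  apply: measurable_sum => j; apply: measurable_funM => //.
  exact: measurableT_comp.
have Xi0 w : 0 <= Xi w by apply: sumr_ge0 => j _; rewrite mulr_ge0// sqrtr_ge0.
have [K K0 PK] := tight P mXi e4.
have e4M : 0 < eps / (4 * M) by rewrite divr_gt0.
(* near_orthonormal has an error proportional to the sum of the Y_k, each of
   which exceeds ka with small probability, uniformly in the grid *)
have [ka ka0 Pka] := tight (gauss R) (@measurable_id _ R setT) e4M.
(* so that K eta = eps / (3 M), for the bias *)
pose eta := eps / (3 * M * K).
have eta0 : 0 < eta by rewrite divr_gt0// mulr_gt0.
(* so that sigma eta' (M ka) = eps / (3 M), for the noise *)
pose eta' := eps / (3 * M * (sigma * (M * ka))).
have eta'0 : 0 < eta' by rewrite divr_gt0// !mulr_gt0.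
have [delta delta0 Hdelta] := near_orthonormal m.+1 eta'0.
(* the Gram matrix of functions within eta1 <= 1 of orthonormal ones is off by
   at most 3 eta1 *)
pose eta1 := Num.min 1 (Num.min (delta / 3) eta).
have eta10 : 0 < eta1 by rewrite /eta1 !lt_min ltr01 eta0 divr_gt0.
have eta1a : eta1 <= 1 by rewrite /eta1 ge_min lexx.
have eta1b : 3 * eta1 <= delta.
  by rewrite mulrC -ler_pdivlMr// /eta1 !ge_min lexx orbT.
have eta1c : eta1 <= eta by rewrite /eta1 !ge_min lexx !orbT.
have rho0 : 0 < eps / (3 * M) by rewrite divr_gt0.
have /choice[h Hh] := fun k => @choose_step eta1 _ _ k eta10 e4M rho0.
have [N [tau [al [t01 tnd tlt Hal]]]] := common_grid m.+1 h.
pose Dl i := Num.sqrt (tau i.+1 - tau i).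
pose c k i := al k i * Dl i.
pose ga i (w : T) := (Dl i)^-1 * (W (tau i.+1) w - W (tau i) w).
have Dl0 i : (i < N)%N -> 0 < Dl i by move=> iN; rewrite sqrtr_gt0 subr_gt0 tlt.
have iga : iid (coarsened_prob P sW) setT N ga.
  have [_ _ H] := brownian_iid brownW t01 tnd tlt.
  split => // i; apply: measurable_funM => //; apply: measurable_funB.
    apply: (@gen_sets_measurable _ T R R _ (fun t => W t : T -> R) (tau i.+1)).
    by rewrite /= in_itv/=; exact: t01.
  apply: (@gen_sets_measurable _ T R R _ (fun t => W t : T -> R) (tau i)).
  by rewrite /= in_itv/=; exact: t01.
have dot_ga k w : (k < m.+1)%N -> dot N (c k) (fun i => ga i w) = step_diff (h k) (W^~ w).
  move=> kM; rewrite Hal//; apply: eq_bigr => i _; rewrite /c /ga.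
  by rewrite -mulrA mulVKf// gt_eqF// Dl0.
have stepE k : (k < m.+1)%N -> step_fun (h k) =
    (fun x => \sum_(i < N) al k i * \1_(`]tau i, tau i.+1]%classic : set R) x).
  by move=> kM; apply/funext => x; apply: step_fun_grid => // F; exact: Hal.
have dot_cc k l : (k < m.+1)%N -> (l < m.+1)%N ->
    dot N (c k) (c l) = ip2 (step_fun (h k)) (step_fun (h l)).
  move=> kM lM; rewrite (stepE k kM) (stepE l lM) ip2_grid//.
  apply: eq_bigr => i _; rewrite /c mulrACA -expr2 sqr_sqrtr//.
  by rewrite subr_ge0 tnd.
have hk2 k : inL2 (step_fun (h k)) by exact: inL2_step.
have dk2 k : inL2 (fun x => step_fun (h k) x - e (L + k.+1)%N x) by exact: inL2B.
have gram k l : (k < m.+1)%N -> (l < m.+1)%N ->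
    `|dot N (c k) (c l) - (k == l)%:R| <= delta.
  move=> kM lM; rewrite (dot_cc k l kM lM) -(ip_ek k l).
  have [Hk _] := Hh k; have [Hl _] := Hh l.
  have -> : ip2 (step_fun (h k)) (step_fun (h l)) - ip2 (e (L + k.+1)%N) (e (L + l.+1)%N) =
    ip2 (fun x => step_fun (h k) x - e (L + k.+1)%N x)
        (fun x => step_fun (h l) x - e (L + l.+1)%N x) +
    ip2 (fun x => step_fun (h k) x - e (L + k.+1)%N x) (e (L + l.+1)%N) +
    ip2 (fun x => step_fun (h l) x - e (L + l.+1)%N x) (e (L + k.+1)%N).
    rewrite (ip2Bl (hk2 k) (ek_inL2 k) (dk2 l)) !ip2Br//.
    rewrite (ip2Bl (hk2 k) (ek_inL2 k) (ek_inL2 l)) (ip2Bl (hk2 l) (ek_inL2 l) (ek_inL2 k)).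
    rewrite (ip2C (step_fun (h l)) (e (L + k.+1)%N)) (ip2C (e (L + l.+1)%N) (e (L + k.+1)%N)).
    by ring.
  have c1 := cauchy_schwarz (dk2 k) (dk2 l).
  have c2 := cauchy_schwarz (dk2 k) (ek_inL2 l).
  have c3 := cauchy_schwarz (dk2 l) (ek_inL2 k).
  rewrite l2norm_ek mulr1 in c2; rewrite l2norm_ek mulr1 in c3.
  have c1' : `|ip2 (fun x => step_fun (h k) x - e (L + k.+1)%N x)
        (fun x => step_fun (h l) x - e (L + l.+1)%N x)| <= eta1.
    apply: (le_trans c1); rewrite -[leRHS]mulr1; apply: ler_pM; rewrite ?sqrtr_ge0//.
    exact: le_trans Hl _.
  apply: (le_trans (ler_normD _ _)); apply: le_trans eta1b.
  have := ler_normD (ip2 (fun x => step_fun (h k) x - e (L + k.+1)%N x)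
        (fun x => step_fun (h l) x - e (L + l.+1)%N x))
        (ip2 (fun x => step_fun (h k) x - e (L + k.+1)%N x) (e (L + l.+1)%N)).
  lra.
have [A Ap Ae] := Hdelta N c gram.
pose Y i (w : g_sigma_algebraType GW) := A (fun j => ga j w) i.
have iY : iid (coarsened_prob P sW) setT m.+1 Y by exact: Ap iga.
exists Y => //.
have [_ mY _] := iY.
have mY' k : measurable_fun setT (Y k : T -> R) := measurable_fun_coarse sW (mY k).
have [A0 [mA0 PA00 HA0]] := modelX.
have PA0 : P A0 = 0%E by exact: PA00.
pose E1 := [set w | exists2 k, (k < m.+1)%N & (eps / (3 * M) <=
   `|step_integral (fun t => X t : T -> R) (h k) w - Z (L + k.+1)%N w|)%R].
pose E2 := [set w : T | exists2 k, (k < m.+1)%N & (ka < `|Y k w|)%R].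
pose E3 := [set w | K < `|Xi w|].
have mU k : measurable_fun setT (fun w =>
    `|step_integral (fun t => X t : T -> R) (h k) w - Z (L + k.+1)%N w|).
  apply: measurableT_comp => //; apply: measurable_funB => //.
  apply: measurable_sum => i; apply: measurable_funM => //.
  exact: measurable_funB.
have [mE1 PE1] : measurable E1 /\ (P E1 <= (m.+1%:R * (eps / (4 * M)))%:E)%E.
  apply: union_bound => k kM; first exact: (measurable_preim (mU k) (measurable_ray _)).
  by have [_] := Hh k.
have mYa k : measurable_fun setT (fun w : T => `|Y k w|) by exact: measurableT_comp (mY' k).
have mabs : measurable_fun setT (fun y : R => `|y|) by exact: measurableT_comp.
have mka := measurable_superlevel mabs ka.
have gauss_Y k : (k < m.+1)%N -> (P [set w | (ka < `|Y k w|)%R] <= (eps / (4 * M))%:E)%E.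
  move=> kM; have := iid_coordinate iY kM mka.
  by rewrite setTI probability_setT mul1e => H; apply: le_trans Pka; rewrite -H.
have [mE2 PE2] : measurable E2 /\ (P E2 <= (m.+1%:R * (eps / (4 * M)))%:E)%E.
  apply: union_bound => k kM; last exact: gauss_Y.
  exact: (measurable_superlevel (mYa k)).
have mE3 : measurable E3 by apply: measurable_superlevel; exact: measurableT_comp.
have M4e : m.+1%:R * (eps / (4 * M)) = eps / 4 by rewrite -/M; field; rewrite gt_eqF.
rewrite M4e in PE1 PE2.
have mbias k : measurable_fun setT (bias k) by exact: measurable_bias.
have mD : measurable_fun setT (fun w : T => \sum_(k < m.+1)
    `|Z (L + k.+1)%N w - (bias k w + sigma * Y k w)|).
  apply: measurable_sum => k; apply: measurableT_comp => //.
  apply: measurable_funB => //; apply: measurable_funD => //.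
  by apply: measurable_funM => //; exact: mY'.
apply: (@le_trans _ _ (P (A0 `|` (E1 `|` (E2 `|` E3))))); last first.
  have mE23 := measurableU _ _ mE2 mE3.
  have mE123 := measurableU _ _ mE1 mE23.
  have PA0' : (P A0 <= 0)%E by rewrite PA0.
  have B3 := le_trans (measureU2 _ mE2 mE3) (leeD PE2 PK).
  have B2 := le_trans (measureU2 _ mE1 mE23) (leeD PE1 B3).
  have B1 := le_trans (measureU2 _ mA0 mE123) (leeD PA0' B2).
  by apply: (le_trans B1); rewrite add0e -!EFinD lee_fin; lra.
apply: le_measure; rewrite ?inE; [exact: measurable_superlevel| |].
  by apply: measurableU => //; apply: measurableU => //; exact: measurableU.
move=> w /=; apply: contraPP => /not_orP[nA0 /not_orP[nE1 /not_orP[nE2 nE3]]].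
apply/negP; rewrite -leNgt.
have Xw : forall t, 0 <= t <= 1 -> X t w = X 0 w
   + \int[mu]_(u in `[0, t]) signal lambda (fun k => xi k : T -> R) phi w u
   + sigma * W t w.
  by apply: contrapT => nX; apply: nA0; exact: HA0.
have S2 : inL2 (signal lambda (fun k => xi k : T -> R) phi w).
  exact: (@inL2_sum R _ (index_enum 'I_r) phi (fun j => Num.sqrt (lambda j) * xi j w)).
have XiK : Xi w <= K by rewrite leNgt; apply/negP => KX; apply: nE3; rewrite /E3 /= ger0_norm.
have Yka k : (k < m.+1)%N -> `|Y k w| <= ka.
  by move=> kM; rewrite leNgt; apply/negP => kY; apply: nE2; exists k.
have Zk k : (k < m.+1)%N ->
    `|step_integral (fun t => X t : T -> R) (h k) w - Z (L + k.+1)%N w| <= eps / (3 * M).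
  by move=> kM; apply: ltW; rewrite ltNge; apply/negP => kY; apply: nE1; exists k.
have sumY : \sum_(j < m.+1) `|Y j w| <= M * ka.
  apply: (le_trans (ler_sum (G := fun=> ka) _ _)); first by move=> j _; exact: Yka.
  by rewrite sumr_const card_ord -mulr_natl.
have bound k : (k < m.+1)%N ->
    `|Z (L + k.+1)%N w - (bias k w + sigma * Y k w)| <= eps / M.
  move=> kM; have H1 := Zk k kM.
  have := @step_integral_model R T (fun t => X t : T -> R) (fun t => W t : T -> R) w _ sigma S2 Xw (h k).
  set U := step_integral _ _ _ => UE.
  have biasE : `|ip2 (step_fun (h k)) (signal lambda (fun k => xi k : T -> R) phi w) - bias k w|
      <= eps / (3 * M).
    rewrite /bias (@ip2_sumr R _ (index_enum 'I_r) phi (fun j => Num.sqrt (lambda j) * xi j w))//.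
    rewrite -sumrB; under eq_bigr do rewrite -mulrBr -ip2Bl//.
    apply: (le_trans (ler_norm_sum _ _ _)).
    apply: (@le_trans _ _ (\sum_(j < r) (Num.sqrt (lambda j) * `|xi j w|) * eta)).
      apply: ler_sum => j _; rewrite normrM normrM (ger0_norm (sqrtr_ge0 _)).
      apply: ler_wpM2l; first by rewrite mulr_ge0// sqrtr_ge0.
      have [Hk _] := Hh k.
      by apply: (le_trans (cauchy_schwarz (dk2 k) (phi_inL2 j))); rewrite l2norm_phi mulr1; lra.
    rewrite -mulr_suml -/(Xi w).
    have -> : eps / (3 * M) = K * eta by rewrite /eta; field; lra.
    by apply: ler_wpM2r => //; exact: ltW.
  have gaE : `|sigma * step_diff (h k) (W^~ w) - sigma * Y k w| <= eps / (3 * M).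
    rewrite -mulrBr normrM gtr0_norm// -(dot_ga k w kM).
    have := Ae (fun j => ga j w) k kM; rewrite -/(Y k w) => H.
    have H2 : eta' * \sum_(j < m.+1) `|A (fun j => ga j w) j| <= eta' * (M * ka).
      by apply: ler_wpM2l => //; exact: ltW.
    have -> : eps / (3 * M) = sigma * (eta' * (M * ka)).
      by rewrite /eta'; field; rewrite !gt_eqF.
    by rewrite ler_pM2l//; exact: le_trans H H2.
  have -> : Z (L + k.+1)%N w - (bias k w + sigma * Y k w) =
    - (U - Z (L + k.+1)%N w) +
    (ip2 (step_fun (h k)) (signal lambda (fun k => xi k : T -> R) phi w) - bias k w) +
    (sigma * step_diff (h k) (W^~ w) - sigma * Y k w) by rewrite UE; ring.
  apply: (le_trans (ler_normD _ _)).
  have -> : eps / M = eps / (3 * M) + eps / (3 * M) + eps / (3 * M) by field; rewrite gt_eqF.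
  apply: lerD => //; apply: (le_trans (ler_normD _ _)); apply: lerD => //.
  by rewrite normrN.
apply: (le_trans (ler_sum (G := fun=> eps / M) _ _)); first by move=> k _; exact: bound.
rewrite sumr_const card_ord -mulr_natl -/M.
by have -> : M * (eps / M) = eps by field; rewrite gt_eqF.
Qed.

End GaussianApproximation.

(** * The variance estimator *)

Section Estimator.
Variable R : realType.
Implicit Types (e : nat -> R -> R) (f : R -> R).

Lemma dotX_increment (T : Type) e (Z : nat -> T -> R) (L M : nat) w x :
  dotX e Z (L + M) w x - dotX e Z L w x =
  \sum_(k < M) Z (L + k.+1)%N w * e (L + k.+1)%N x.
Proof.
rewrite /dotX (@big_cat_nat _ _ _ L.+1 1 (L + M).+1)//=; last by rewrite ltnS leq_addr.
rewrite addrAC subrr add0r -{1}[L.+1]add0n big_addn subSS addKn big_mkord.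
by apply: eq_bigr => k _; rewrite addnC addnS addSn.
Qed.

Lemma sigma2_hatE (T : Type) e (Z : nat -> T -> R) (L M : nat) w :
  orthonormal_basis e ->
  sigma2_hat e Z L M w = M%:R^-1 * \sum_(k < M) Z (L + k.+1)%N w ^+ 2.
Proof.
move=> -[[e2 eo] _]; rewrite /sigma2_hat; congr (_ * _).
pose E (k : 'I_M) := e (L + k.+1)%N.
have E2 k : inL2 (E k) by apply: e2; rewrite /= addnS.
pose z (k : 'I_M) := Z (L + k.+1)%N w.
have -> : (fun x => dotX e Z (L + M) w x - dotX e Z L w x) =
    (fun x => \sum_(k < M) z k * E k x).
  by apply/funext => x; exact: dotX_increment.
have S2 : inL2 (fun x => \sum_(k < M) z k * E k x).
  exact: (@inL2_sum R _ (index_enum 'I_M) E z).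
rewrite norm2E//= /l2norm sqr_sqrtr ?ip2_ge0//.
rewrite (@ip2_suml R _ (index_enum 'I_M) E z _ E2 S2).
apply: eq_bigr => k _; rewrite (@ip2_sumr R _ (index_enum 'I_M) E z (E k) E2 (E2 k)).
rewrite (bigD1 k)//= big1 ?addr0; last first.
  move=> l lk; rewrite eo; [|by rewrite /= addnS..].
  by rewrite eqn_add2l eqSS eq_sym (inj_eq val_inj) (negbTE lk) mulr0.
rewrite eo; [|by rewrite /= addnS..].
by rewrite eqxx mulr1 expr2.
Qed.

(** Beyond L every squared coefficient carries a weight of at least L ^ (2 s) in
    the smoothness norm. *)
Lemma smooth_tail e s (c : R) f (L M : nat) : (0 < L)%N -> 0 < s -> 0 < c ->
  (smooth_norm e s f <= c%:E)%E ->
  \sum_(k < M) ip2 f (e (L + k.+1)%N) ^+ 2 <= c ^+ 2 * L%:R `^ (- (2 * s)).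
Proof.
move=> L0 s0 c0 H.
pose u k : R := k%:R `^ (2 * s) * ip2 f (e k) ^+ 2.
have u0 k : 0 <= u k by rewrite mulr_ge0 ?powR_ge0 ?sqr_ge0.
have LR : 0 < L%:R :> R by rewrite ltr0n.
have Lp : 0 < L%:R `^ (2 * s) :> R by rewrite powR_gt0.
have partial : \sum_(1 <= k < (L + M).+1) u k <= c ^+ 2.
  have : ((\sum_(1 <= k <oo) (u k)%:E) `^ 2^-1 <= c%:E)%E by exact: H.
  have S0 : (0 <= \sum_(1 <= k <oo) (u k)%:E)%E.
    by apply: nneseries_ge0 => k _ _; rewrite lee_fin.
  have : (\sum_(1 <= k < (L + M).+1) (u k)%:E <= \sum_(1 <= k <oo) (u k)%:E)%E.
    by apply: nneseries_lim_ge => k _; rewrite lee_fin.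
  rewrite sumEFin.
  case: (\sum_(1 <= k <oo) (u k)%:E)%E S0 => [x| |]//=.
    rewrite !lee_fin => x0 ux; rewrite powR12_sqrt// => xc.
    apply: (le_trans ux); rewrite -[leLHS]sqr_sqrtr// ler_sqr ?nnegrE ?sqrtr_ge0//.
    exact: ltW.
  by move=> _ _; case: ifP => [|_]; [rewrite invr_eq0 pnatr_eq0|rewrite leye_eq].
have tail : \sum_(k < M) u (L + k.+1)%N <= c ^+ 2.
  apply: le_trans partial.
  rewrite [leRHS](@big_cat_nat _ _ _ L.+1 1 (L + M).+1)//=; last by rewrite ltnS leq_addr.
  rewrite -[leLHS]add0r; apply: lerD; first exact: sumr_ge0.
  rewrite -{1}[L.+1]add0n big_addn subSS addKn big_mkord le_eqVlt.
  by apply/orP; left; apply/eqP; apply: eq_bigr => k _; rewrite addnC addnS addSn.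
rewrite powRN ler_pdivlMr//; apply: le_trans tail; rewrite mulr_suml.
apply: ler_sum => k _; rewrite mulrC /u ler_wpM2r ?sqr_ge0//.
by apply: ge0_ler_powR; rewrite ?nnegrE ?ler0n ?ler_nat ?leq_addr// mulr_ge0// ltW.
Qed.

Lemma ceil_exp_gt0 n : (0 < ceil_exp R n)%N.
Proof.
have : 0 < Num.ceil (expR n%:R : R) by rewrite ceil_gt0 expR_gt0.
by rewrite /ceil_exp absz_gt0 => /gt_eqF ->.
Qed.

End Estimator.

Theorem theorem14 (R : realType) :
  exists C : R, 0 < C /\
  forall (d : measure_display) (T : measurableType d) (P : probability T R)
    (e : nat -> R -> R) (n M r : nat) (sigma : R)
    (lambda : 'I_r -> R) (phi : 'I_r -> R -> R) (xi : 'I_r -> {RV P >-> R})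
    (W X : R -> {RV P >-> R}) (Z : nat -> {RV P >-> R}) (s c : R),
  orthonormal_basis e ->
  (1 <= n)%N -> (1 <= M)%N -> (1 <= r)%N -> 0 < sigma ->
  (forall k, 0 < lambda k) ->
  orthonormal_family [set: 'I_r] phi ->
  (forall k, has_normal_law P (xi k) 0 1) ->
  mutually_independent P (fun k => xi k : T -> R) ->
  standard_brownian01 W ->
  independent_salgebras P
    (generated_salgebra [set: 'I_r] (fun k => xi k : T -> R))
    (generated_salgebra `[0, 1] (fun t => W t : T -> R)) ->
  {ae P, forall w, forall t, 0 <= t <= 1 ->
     X t w = X 0 w
             + \int[leb01 R]_(u in `[0, t])
                 signal lambda (fun k => xi k : T -> R) phi w u
             + sigma * W t w} ->
  (forall k, (1 <= k)%N ->
     is_stochastic_integral P (fun t => X t : T -> R) (e k) (Z k)) ->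
  0 < s -> 0 < c ->
  (forall j, (smooth_norm e s (phi j) <= c%:E)%E) ->
  let L := ceil_exp R n in
  let lambda_max := \big[Num.max/0]_(j < r) lambda j in
  forall t : R, 0 < t ->
  ((1 - expR (- t))%:E <=
   P [set w | (`|sigma2_hat e (fun k => Z k : T -> R) L M w - sigma ^+ 2| <=
      C * Num.max
            (c ^+ 2 * r%:R * lambda_max * L%:R `^ (- (2 * s))
               * Num.max (Num.max 1 (Num.sqrt t)) t)
            (Num.max (sigma ^+ 2 * Num.sqrt (t / M%:R))
                     (sigma ^+ 2 * (t / M%:R))))%R])%E.
Proof.
have [C C0 HC] := model_bound R.
exists (2 * C); split; first by rewrite mulr_gt0.
move=> d T P e n [//|m] [//|r] sigma lambda phi xi W X Z s c.
move=> basis_e _ _ _ sigma0 lambda0 ortho_phi law_xi ind_xi brownW indep modelX intZ.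
move=> s0 c0 smooth L lmax t t0.
have L0 : (0 < L)%N by exact: ceil_exp_gt0.
set M : R := m.+1%:R.
have M1 : 1 <= M by rewrite ler1n.
have M0 : 0 < M by exact: lt_le_trans M1.
have Lp : 0 < L%:R `^ (- (2 * s)) :> R by rewrite powR_gt0// ltr0n.
have lmax_ge j : lambda j <= lmax by rewrite /lmax; exact: le_bigmax_cond.
have lmax0 : 0 < lmax by exact: lt_le_trans (lambda0 ord0) (lmax_ge ord0).
have s1 : <<s gen_sets [set: 'I_r.+1] (fun k => xi k : T -> R) >> `<=` measurable.
  by apply: gen_sets_sub => i _; exact: measurable_funP.
have s2 : <<s gen_sets `[0, 1]%classic (fun t => W t : T -> R) >> `<=` measurable.
  by apply: gen_sets_sub => i _; exact: measurable_funP.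
pose xin (j : nat) := xi (inord j : 'I_r.+1) : T -> R.
have ixi : iid (coarsened_prob P s1) setT r.+1 xin.
  have [_ _ H] : iid P setT r.+1 xin.
    apply: iid_of_independent; first by move=> i; exact: measurable_funP.
      have -> : (fun i : 'I_r.+1 => xin i) = (fun i => xi i : T -> R).
        by apply/funext => i; rewrite /xin inord_val.
      exact: ind_xi.
    by move=> i _ B mB; rewrite gaussE; exact: law_xi.
  split => // i.
  exact: (@gen_sets_measurable _ T R 'I_r.+1 setT (fun k => xi k : T -> R) (inord i) I).
pose a k j := Num.sqrt (lambda (inord j)) * ip2 (e (L + k.+1)%N) (phi (inord j)) / sigma.
(* V bounds the variance of the normalized bias: smooth_tail summed over the r
   eigenfunctions *)
pose V := c ^+ 2 * r.+1%:R * lmax * L%:R `^ (- (2 * s)) / sigma ^+ 2.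
have V0 : 0 < V by rewrite divr_gt0 ?mulr_gt0 ?exprn_gt0 ?ltr0n.
have aV : \sum_(k < m.+1) dot r.+1 (a k) (a k) <= V.
  rewrite exchange_big /=.
  apply: (@le_trans _ _ (\sum_(j < r.+1) (lmax / sigma ^+ 2 * (c ^+ 2 * L%:R `^ (- (2 * s)))))).
    apply: ler_sum => j _.
    have -> : \sum_(k < m.+1) a k j * a k j =
        lambda j / sigma ^+ 2 * \sum_(k < m.+1) ip2 (phi j) (e (L + k.+1)%N) ^+ 2.
      rewrite mulr_sumr; apply: eq_bigr => k _; rewrite /a inord_val (ip2C (phi j)).
      rewrite -expr2 !exprMn sqr_sqrtr ?(ltW (lambda0 j))// exprVn; ring.
    apply: ler_pM.
    - by rewrite divr_ge0 ?(ltW (lambda0 j)) ?sqr_ge0.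
    - by apply: sumr_ge0 => k _; exact: sqr_ge0.
    - by rewrite ler_pM2r ?invr_gt0 ?exprn_gt0.
    - exact: smooth_tail.
  rewrite sumr_const card_ord -[leLHS]mulr_natl le_eqVlt /V; apply/orP; left; apply/eqP.
  by field; rewrite gt_eqF.
have axi k w : mxact r.+1 a (fun j => xin j w) k =
    bias e L lambda phi xi k w / sigma.
  rewrite /mxact /dot /bias mulr_suml; apply: eq_bigr => j _.
  by rewrite /a /xin inord_val; ring.
pose mx := Num.max (Num.max 1 (Num.sqrt t)) t.
pose B0 := Num.max (V * mx) (Num.max (Num.sqrt (t / M)) (t / M)).
set B := Num.max _ _.
have sg2 : 0 < sigma ^+ 2 by rewrite exprn_gt0.
have BE : B = sigma ^+ 2 * B0.
  have dist u v : sigma ^+ 2 * Num.max u v = Num.max (sigma ^+ 2 * u) (sigma ^+ 2 * v).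
    by rewrite maxr_pMr// ltW.
  rewrite /B0 dist [in RHS](dist (Num.sqrt _)) /B /V; congr (Num.max _ _).
  by rewrite -/mx; field; rewrite gt_eqF.
have B00 : 0 < B0 by rewrite /B0 !lt_max sqrtr_gt0 divr_gt0// !orbT.
have CB : 0 < C * B by rewrite BE !mulr_gt0.
pose S2 w := \sum_(k < m.+1) Z (L + k.+1)%N w ^+ 2.
pose G := [set w | `|M^-1 * S2 w - sigma ^+ 2| <= 2 * C * B].
rewrite (_ : [set w | _] = G); last first.
  by apply/seteqP; split => w /=; rewrite /G /= (sigma2_hatE _ L m.+1 w basis_e).
have mS2 : measurable_fun setT S2.
  by apply: measurable_sum => k; exact: measurable_funX.
have mG : measurable G.
  apply: measurable_sublevel; apply: measurableT_comp => //; apply: measurable_funB => //.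
  exact: measurable_funM.
(* half of the slack e0 pays for the event where the Z are large, the other
   half for the event where the Gaussian approximation is off by more than eps *)
apply/lee_addgt0Pr => e0 e00.
pose ZZ w := \sum_(k < m.+1) `|Z (L + k.+1)%N w|.
have mZZ : measurable_fun setT ZZ.
  by apply: measurable_sum => k; exact: measurableT_comp.
have e02 : 0 < e0 / 2 by rewrite divr_gt0.
have [K K0 PK] := tight P mZZ e02.
have K1 : 0 < 2 * K + 1 by rewrite addr_gt0// mulr_gt0.
pose eps := Num.min (e0 / 2) (Num.min 1 (C * B / (2 * K + 1))).
have eps0 : 0 < eps by rewrite !lt_min e02 ltr01 divr_gt0.
have eps1 : eps <= e0 / 2 by rewrite /eps ge_min lexx.
have eps2 : eps <= 1 by rewrite /eps !ge_min lexx orbT.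
(* on the good events this makes replacing Z_k by its Gaussian approximation cost
   at most C B in the sum of squares, which doubles the constant *)
have eps3 : (2 * K + 1) * eps <= C * B.
  by rewrite mulrC -ler_pdivlMr// /eps !ge_min lexx !orbT.
have [Y iY PY] := gaussian_approx m L basis_e sigma0 ortho_phi brownW modelX intZ s2 eps0.
pose D w := \sum_(k < m.+1) `|Z (L + k.+1)%N w - (bias e L lambda phi xi k w + sigma * Y k w)|.
have [_ mY _] := iY.
have mY' k : measurable_fun setT (Y k : T -> R) := measurable_fun_coarse s2 (mY k).
have mD : measurable_fun setT D.
  apply: measurable_sum => k; apply: measurableT_comp => //.
  apply: measurable_funB => //; apply: measurable_funD; first exact: measurable_bias.
  by apply: measurable_funM => //; exact: mY'.
have HG' := HC _ T P _ _ s1 s2 m r a V xin Y indep ixi iY V0 aV t t0.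
pose E1 := [set w | eps < D w]; pose E2 := [set w | K < `|ZZ w|].
have mE1 : measurable E1 by exact: measurable_superlevel.
have mE2 : measurable E2 by apply: measurable_superlevel; exact: measurableT_comp.
apply: (le_trans HG'); rewrite -/M -/mx -/B0.
apply: (@le_trans _ _ (P (G `|` (E1 `|` E2)))); last first.
  have PE1 : (P E1 <= (e0 / 2)%:E)%E by apply: (le_trans PY); rewrite lee_fin.
  have H12 := le_trans (measureU2 _ mE1 mE2) (leeD PE1 PK).
  apply: (le_trans (measureU2 _ mG (measurableU _ _ mE1 mE2))).
  by apply: leeD => //; apply: (le_trans H12); rewrite -EFinD -splitr.
pose S' w := shifted_sumsq m.+1 (mxact r.+1 a (fun j => xin j w)) (fun k => Y k w).
have mS' : measurable_fun setT (S' : T -> R).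
  apply: measurable_sum => k; apply: measurable_funX; apply: measurable_funD; last exact: mY'.
  rewrite (_ : (fun _ => _) = (fun w => bias e L lambda phi xi k w / sigma)); last first.
    by apply/funext => w; exact: axi.
  by apply: measurable_funM => //; exact: measurable_bias.
apply: le_measure; rewrite ?inE.
- apply: measurable_sublevel; apply: measurableT_comp => //; apply: measurable_funB => //.
  by apply: measurable_funM.
- by apply: measurableU => //; exact: measurableU.
move=> w /= Hw.
have [D1|D1] := ltP eps (D w); first by right; left.
have [Z1|Z1] := ltP K `|ZZ w|; first by right; right.
left; rewrite /G /=.
pose Z' (k : nat) := bias e L lambda phi xi k w + sigma * Y k w.
have S'E : sigma ^+ 2 * S' w = \sum_(k < m.+1) Z' k ^+ 2.
  rewrite /S' /shifted_sumsq mulr_sumr; apply: eq_bigr => k _; rewrite axi /Z'.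
  by field; rewrite gt_eqF.
have ZZ0 : 0 <= ZZ w by apply: sumr_ge0.
rewrite ger0_norm// in Z1.
have close : `|S2 w - sigma ^+ 2 * S' w| <= C * B.
  rewrite S'E /S2 -sumrB; apply: (le_trans (ler_norm_sum _ _ _)).
  apply: (@le_trans _ _ (\sum_(k < m.+1) `|Z (L + k.+1)%N w - Z' k| * (2 * K + 1))).
    apply: ler_sum => k _.
    have -> : Z (L + k.+1)%N w ^+ 2 - Z' k ^+ 2 = (Z (L + k.+1)%N w - Z' k) *
       (2 * Z (L + k.+1)%N w - (Z (L + k.+1)%N w - Z' k)) by ring.
    rewrite normrM ler_wpM2l//; apply: (le_trans (ler_normB _ _)).
    apply: lerD.
      rewrite normrM ger0_norm// ler_pM2l//; apply: le_trans Z1.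
      by rewrite /ZZ (bigD1 k)//= lerDl sumr_ge0.
    apply: le_trans (le_trans D1 eps2).
    by rewrite /D (bigD1 k)//= lerDl sumr_ge0.
  rewrite -mulr_suml mulrC; apply: le_trans eps3.
  by rewrite ler_pM2l.
have -> : M^-1 * S2 w - sigma ^+ 2 =
   M^-1 * (S2 w - sigma ^+ 2 * S' w) + sigma ^+ 2 * (S' w / M - 1).
  by field; rewrite gt_eqF.
apply: (le_trans (ler_normD _ _)).
rewrite (_ : 2 * C * B = C * B + C * B); last by ring.
apply: lerD.
  rewrite normrM gtr0_norm ?invr_gt0// mulrC ler_pdivrMr//.
  by apply: (le_trans close); rewrite ler_peMr// ltW.
rewrite normrM gtr0_norm// BE mulrCA ler_pM2l//.
Qed.
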